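(* Let $M$ be an indecomposable $b\times a$ matrix with linear entries in $n+1$ variables and constant rank $r$, and let $\mathcal{C}_M$ be the cokernel of the induced morphism $M:\mathcal{O}_{\mathbb{P}^n}^{a}\to\mathcal{O}_{\mathbb{P}^n}(1)^{b}$. Assume that $\mathcal{C}_M(-1)$ has the property $L_1$. Then $M$ can be constructed from a morphism of acyclic complexes in the following sense: there exist acyclic bounded complexes of vector bundles $P_\bullet$ and $Q_\bullet$ on $\mathbb{P}^n$, an integer $j$, a morphism of complexes $\varphi_\bullet:P_\bullet\to Q_\bullet(-j)[j]$, and integers $r_P,s_P,r_Q,s_Q,i$ such that $P_\bullet$ is $(r_P,s_P)$-linear, $Q_\bullet$ is $(r_Q,s_Q)$-linear, $r_P\le i<s_P$, $r_Q\le i+j<s_Q$, the morphisms $\varphi_i:P_i\to Q_{i+j}(-j)$ and $\varphi_{i+1}:P_{i+1}\to Q_{i+j+1}(-j)$ are surjective, and $M$ is (up to choice of bases) the matrix of the morphism $$\mathcal{O}_{\mathbb{P}^n}^{a}\cong\ker(\varphi_{i+1})(-i-1)\longrightarrow\ker(\varphi_{i+2})(-i-1)\cong\mathcal{O}_{\mathbb{P}^n}(1)^{b}$$ induced by the differential $d_P^{i+1}$.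
   Context: We work over an algebraically closed field $k$ of characteristic $0$; $R=k[x_0,\dots,x_n]$ is the homogeneous coordinate ring of $\mathbb{P}^n$. A $b\times a$ matrix $M$ of linear forms in $n+1$ variables has constant rank $r$ if its evaluation at every point of $\mathbb{P}^n$ has rank $r$. It induces $M:\mathcal{O}_{\mathbb{P}^n}^{a}\to\mathcal{O}_{\mathbb{P}^n}(1)^{b}$ whose kernel $\mathcal{K}_M$, image $\mathcal{E}_M$ and cokernel $\mathcal{C}_M$ are vector bundles of ranks $a-r$, $r$, $b-r$. $M$ is indecomposable if the vector bundle $\mathcal{E}_M$ is indecomposable. For a vector bundle $\mathcal{E}$ put $H^0_*(\mathcal{E})=\bigoplus_{t\in\mathbb{Z}}H^0(\mathbb{P}^n,\mathcal{E}(t))$. For an integer $p\ge1$, $\mathcal{E}$ has the property $L_p$ (''is $L_p$-linear'') if (i) $\mathcal{E}$ is globally generated, and (ii) the first $p$ steps of a minimal free $R$-resolution of $H^0_*(\mathcal{E})$ are linear, i.e. it has the shape $$\cdots\to R(-p+1)^{a_{p-1}}\to\cdots\to R(-1)^{a_1}\to R^{a_0}\to H^0_*(\mathcal{E})\to0.$$ A bounded complex $P_\bullet$: $\cdots\to P_t\xrightarrow{d_P^t}P_{t+1}\to\cdots$ is acyclic if it is exact everywhere, and $(r,s)$-linear if $P_t=\mathcal{O}_{\mathbb{P}^n}(t)^{p_t}$ for all $r\le t\le s$. $P[j]_\bullet$ denotes the shift $P[j]_t=P_{j+t}$ and $P_t(j)=P_t\otimes\mathcal{O}_{\mathbb{P}^n}(j)$,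 so $\varphi_t:P_t\to Q_{t+j}(-j)$. Complexes are taken to be nonzero only in degrees between $-n-1$ and $0$ (without loss of generality, up to re-indexing and twisting).
   Formalization: For n ≤ 2 the complexes are bounded in degrees -4 to 0 instead of the normalization -n-1 to 0, which fails there, for instance for the matrix with rows (x_0,…,x_n) and 0; for n ≥ 3 the normalization is kept. *)

(* Defs.v *)
From HB Require Import structures.
From mathcomp Require Import all_boot all_order all_algebra.
From mathcomp Require Import boolp functions.
From mathcomp Require Import mpoly.

Set Implicit Arguments.
Unset Strict Implicit.
Unset Printing Implicit Defensive.

Import GRing.Theory.
Local Open Scope ring_scope.

(* Points of P^n are represented by their nonzero homogeneous coordinate
   vectors: an open subset of P^n is given by the cone over it (without the
   vertex), and a regular function on it, more generally a section of O(t), is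
   a function on that cone which is locally p / q with p and q homogeneous and
   deg p - deg q = t.  Since k is algebraically closed this is the classical
   description of the structure sheaf on the variety P^n. *)

Section ProjectiveSpace.
Variables (k : closedFieldType) (n : nat).

Notation poly := {mpoly k[n.+1]}.
Notation pt := 'rV[k]_n.+1.
Notation "p @ x" := (meval (fun i => x ord0 i) p) (at level 10).

Definition isform (t : int) (p : poly) : bool :=
  if t is Posz d then p \is d.-homog else p == 0.

Definition zopen (U : pt -> Prop) : Prop :=
  exists S : poly -> Prop,
    (forall p, S p -> exists t, isform t p) /\
    (forall x, U x <-> x != 0 /\ exists2 p, S p & p @ x != 0).

Record opn := Opn { carrier :> pt -> Prop; carrierP : zopen carrier }.

Definition osub (V U : opn) : Prop := forall x, V x -> U x.

Lemma sub_refl U : osub U U. Proof. by []. Qed.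
Lemma sub_trans V U W : osub V U -> osub U W -> osub V W.
Proof. by move=> h h' x /h /h'. Qed.

Lemma isformM t u p q : isform t p -> isform u q -> isform (t + u) (p * q).
Proof.
case: t => t /=; last by move=> /eqP -> _; rewrite mul0r; case: (_ + _) => m /=;
  rewrite ?dhomog0.
case: u => u /=; last by move=> _ /eqP ->; rewrite mulr0; case: (_ + _) => m /=;
  rewrite ?dhomog0.
exact: dhomogM.
Qed.

Lemma isformD t p q : isform t p -> isform t q -> isform t (p + q).
Proof.
case: t => t /=; first exact: rpredD.
by move=> /eqP -> /eqP ->; rewrite addr0.
Qed.

Lemma isformN t p : isform t p -> isform t (- p).
Proof. by case: t => t /=; [rewrite rpredN | move=> /eqP ->; rewrite oppr0]. Qed.

Lemma isform0 t : isform t 0.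
Proof. by case: t => t /=; rewrite ?dhomog0. Qed.

Lemma isform1 : isform 0 1.
Proof. exact: dhomog1. Qed.

Lemma isformX l : isform 1 'X_l.
Proof. by rewrite /= dhomogX /= mdeg1. Qed.

Lemma zopen_top : zopen (fun x => x != 0).
Proof.
exists (fun p => p = 1); split; first by move=> p ->; exists 0; exact: isform1.
move=> x; split=> [x0|[]//]; split=> //; exists 1 => //.
by rewrite meval1 oner_neq0.
Qed.
Definition otop : opn := Opn zopen_top.

Lemma zopen_chart l : zopen (fun x => x ord0 l != 0).
Proof.
exists (fun p => p = 'X_l); split.
  by move=> p ->; exists 1; exact: isformX.
move=> x; split=> [xl|[_ [p ->]]]; last by rewrite mevalXU.
split; last by exists 'X_l => //; rewrite mevalXU.
by apply: contraNneq xl => ->; rewrite mxE.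
Qed.
(* The standard affine chart x_l <> 0 *)
Definition chart l : opn := Opn (zopen_chart l).

Lemma zopen_cap (U V : opn) : zopen (fun x => U x /\ V x).
Proof.
case: U V => U [S [hS eU]] [V [T [hT eV]]] /=.
exists (fun r => exists p q, [/\ S p, T q & r = p * q]); split.
  move=> r [p [q [/hS [t tp] /hT [u uq] ->]]].
  by exists (t + u); exact: isformM.
move=> x; split.
  move=> [/eU [x0 [p Sp px]] /eV [_ [q Tq qx]]]; split=> //.
  by exists (p * q); [exists p, q | rewrite mevalM mulf_neq0].
move=> [x0 [_ [p [q [Sp Tq ->]]]]]; rewrite mevalM mulf_eq0 negb_or => /andP[px qx].
by split; [apply/eU | apply/eV]; split=> //; [exists p | exists q].
Qed.
Definition ocap (U V : opn) : opn := Opn (zopen_cap U V).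

Lemma capl U V : osub (ocap U V) U. Proof. by move=> x []. Qed.
Lemma capr U V : osub (ocap U V) V. Proof. by move=> x []. Qed.
Lemma cap_mono U U' V V' : osub U U' -> osub V V' -> osub (ocap U V) (ocap U' V').
Proof. by move=> h h' x [/h ? /h']. Qed.
Lemma capl_mono U U' V : osub U U' -> osub (ocap U V) (ocap U' V).
Proof. by move=> h; apply: cap_mono. Qed.
Lemma capr_mono U V V' : osub V V' -> osub (ocap U V) (ocap U V').
Proof. by move=> h; apply: cap_mono. Qed.

Definition pts (U : opn) : Type := {x : pt | U x}.
Definition pres U V (h : osub V U) (x : pts V) : pts U := exist _ (sval x) (h _ (svalP x)).

Definition regular (t : int) (U : opn) (f : pts U -> k) : Prop :=
  forall x : pts U, exists (V : opn) (d e : int) (p q : poly),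
    [/\ V (sval x), d - e = t, isform d p, isform e q &
        forall y : pts U, V (sval y) ->
          q @ (sval y) != 0 /\ f y = p @ (sval y) / q @ (sval y)].

Lemma regular_cst0 t U : regular (U := U) t 0.
Proof.
move=> x; exists otop, t, 0, 0, 1.
split; rewrite ?subr0 ?isform0 ?isform1 //.
  by case: x => x Ux /=; case: U Ux => U [S [hS eU]] /= /eU [].
by move=> y _; rewrite meval1 meval0 mul0r oner_neq0.
Qed.

Lemma regular_oppr t U (f : pts U -> k) : regular t f -> regular t (- f).
Proof.
move=> rf x; have [V [d [e [p [q [Vx <- hp hq H]]]]]] := rf x.
exists V, d, e, (- p), q; split=> //; first exact: isformN.
by move=> y /H [qy fy]; rewrite opprfctE mevalN mulNr fy.
Qed.

Lemma regular_add t U (f g : pts U -> k) :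
  regular t f -> regular t g -> regular t (f + g).
Proof.
move=> rf rg x; have [V [d [e [p [q [Vx dd hp hq H]]]]]] := rf x.
have [W [d' [e' [p' [q' [Wx ee' hp' hq' H']]]]]] := rg x.
exists (ocap V W), (d + e'), (e + e'), (p * q' + p' * q), (q * q'); split=> //.
- by rewrite opprD addrACA subrr addr0.
- apply: isformD; first exact: isformM.
  suff -> : d + e' = d' + e by apply: isformM.
  by rewrite -[d](subrK e) dd -ee' addrAC subrK.
- exact: isformM.
move=> y [/H [qy fy] /H' [qy' gy]].
by rewrite addrfctE fy gy mevalM mulf_neq0 // mevalD !mevalM addf_div.
Qed.

Lemma regular_mul t u v U (f g : pts U -> k) :
  t + u = v -> regular t f -> regular u g -> regular v (f * g).
Proof.
move=> <- rf rg x; have [V [d [e [p [q [Vx <- hp hq H]]]]]] := rf x.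
have [W [d' [e' [p' [q' [Wx <- hp' hq' H']]]]]] := rg x.
exists (ocap V W), (d + d'), (e + e'), (p * p'), (q * q'); split=> //.
- by rewrite opprD addrACA.
- exact: isformM.
- exact: isformM.
move=> y [/H [qy fy] /H' [qy' gy]].
by rewrite mulrfctE fy gy !mevalM mulf_neq0 // mulf_div.
Qed.

Lemma opn_neq0 (U : opn) x : U x -> x != 0.
Proof. by case: U => U [S [hS eU]] /= /eU []. Qed.

Lemma regular_form t p U : isform t p -> regular t (fun x : pts U => p @ (sval x)).
Proof.
move=> hp x; exists otop, t, 0, p, 1.
split; rewrite ?subr0 ?isform1 //; first exact: opn_neq0 (svalP x).
by move=> y _; rewrite meval1 divr1 oner_neq0.
Qed.

Lemma regular_coordX l (u : int) U : osub U (chart l) ->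
  regular u (fun x : pts U => sval x ord0 l ^ u).
Proof.
have hX m : isform m%:Z ('X_l ^+ m).
  elim: m => [|m IH]; first exact: isform1.
  by rewrite exprS -addn1 PoszD addrC; apply: isformM => //; exact: isformX.
move=> h x; case: u => m.
  exists U, m%:Z, 0, ('X_l ^+ m), 1; split; rewrite ?subr0 ?isform1 //.
    exact: svalP.
  by move=> y _; rewrite meval1 divr1 oner_neq0 rmorphXn /= mevalXU.
exists U, 0, m.+1%:Z, 1, ('X_l ^+ m.+1); split; rewrite ?isform1 ?sub0r //.
  exact: svalP.
move=> y Uy; rewrite meval1 div1r rmorphXn /= mevalXU; split=> //.
by apply: expf_neq0; exact: h Uy.
Qed.

Lemma regular_res t U V (h : osub V U) (f : pts U -> k) :
  regular t f -> regular t (f \o pres h).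
Proof.
move=> rf x; have [W [d [e [p [q [Wx <- hp hq H]]]]]] := rf (pres h x).
by exists W, d, e, p, q; split=> // y Wy; exact: (H (pres h y)).
Qed.

Definition regp t U : {pred pts U -> k} := fun f => `[< regular t f >].
Arguments regp : clear implicits.

Fact regp_zmod_closed t U : zmod_closed (regp t U).
Proof.
split=> [|f g /asboolP rf /asboolP rg]; apply/asboolP; first exact: regular_cst0.
by apply: regular_add => //; exact: regular_oppr.
Qed.
HB.instance Definition _ t U :=
  GRing.isZmodClosed.Build (pts U -> k) (regp t U) (regp_zmod_closed t U).

(* hreg t U = H^0(U, O(t)) *)
Record hreg t U := Hreg { hval :> pts U -> k; hvalP : hval \in regp t U }.
HB.instance Definition _ t U := [isSub for @hval t U].
HB.instance Definition _ t U := [Choice of hreg t U by <:].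
HB.instance Definition _ t U := [SubChoice_isSubZmodule of hreg t U by <:].

Lemma hregP t U (f : hreg t U) : regular t f.
Proof. by apply/asboolP; exact: hvalP. Qed.

Definition mkreg t U (f : pts U -> k) (hf : regular t f) : hreg t U :=
  Hreg (introT (asboolP _) hf).

Lemma hreg_eq t U (f g : hreg t U) : (forall x, f x = g x) -> f = g.
Proof. by move=> h; apply/val_inj/funext. Qed.

Definition hmul (t u v : int) (e : t + u = v) U (f : hreg t U) (g : hreg u U) : hreg v U :=
  mkreg (regular_mul e (hregP f) (hregP g)).

Definition sring U : Type := hreg 0 U.
HB.instance Definition _ U := GRing.Zmodule.on (sring U).

Lemma regular_one U : regular 0 (fun _ : pts U => 1).
Proof.
have -> : (fun _ : pts U => 1) = (fun x => 1 @ (sval x)) by apply/funext => x; rewrite meval1.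
exact: regular_form isform1.
Qed.
Definition sone U : sring U := mkreg (@regular_one U).
Definition smul U (f g : sring U) : sring U := hmul (addr0 0) f g.

Fact smulA U : associative (@smul U).
Proof. by move=> f g h; apply: hreg_eq => x /=; rewrite !mulrfctE mulrA. Qed.
Fact smulC U : commutative (@smul U).
Proof. by move=> f g; apply: hreg_eq => x /=; rewrite !mulrfctE mulrC. Qed.
Fact smul1 U : left_id (sone U) (@smul U).
Proof. by move=> f; apply: hreg_eq => x /=; rewrite !mulrfctE mul1r. Qed.
Fact smulDl U : left_distributive (@smul U) +%R.
Proof.
by move=> f g h; apply: hreg_eq => x; rewrite /= !mulrfctE /= !addrfctE mulrDl.
Qed.
HB.instance Definition _ U := GRing.Zmodule_isComPzRing.Build (sring U)
  (@smulA U) (@smulC U) (@smul1 U) (@smulDl U).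

Definition hscale t U (f : sring U) (g : hreg t U) : hreg t U := hmul (add0r t) f g.

Fact hscaleA t U (f g : sring U) (h : hreg t U) :
  hscale f (hscale g h) = hscale (f * g) h.
Proof. by apply: hreg_eq => x /=; rewrite !mulrfctE mulrA. Qed.
Fact hscale1 t U : left_id 1 (@hscale t U).
Proof. by move=> f; apply: hreg_eq => x /=; rewrite !mulrfctE mul1r. Qed.
Fact hscaleDr t U : right_distributive (@hscale t U) +%R.
Proof. by move=> f g h; apply: hreg_eq => x; rewrite /= !mulrfctE /= !addrfctE mulrDr. Qed.
Fact hscaleDl t U (g : hreg t U) : {morph (@hscale t U)^~ g : f f' / f + f'}.
Proof. by move=> f h; apply: hreg_eq => x; rewrite /= !mulrfctE /= !addrfctE mulrDl. Qed.
HB.instance Definition _ t U := GRing.Zmodule_isLmodule.Build (sring U) (hreg t U)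
  (@hscaleA t U) (@hscale1 t U) (@hscaleDr t U) (@hscaleDl t U).

Definition hres t U V (h : osub V U) (f : hreg t U) : hreg t V :=
  mkreg (regular_res h (hregP f)).

Definition rres U V (h : osub V U) (f : sring U) : sring V := hres h f.

Definition covers (I : Type) (V : I -> opn) (U : opn) : Prop :=
  forall x, U x -> exists i, V i x.

Record sheaf := Sheaf {
  sec : forall U : opn, lmodType (sring U);
  res : forall U V : opn, osub V U -> sec U -> sec V;
  resD : forall U V (h : osub V U) s t, res h (s + t) = res h s + res h t;
  resZ : forall U V (h : osub V U) a s, res h (a *: s) = rres h a *: res h s;
  res_id : forall U (h : osub U U) s, res h s = s;
  res_comp : forall U V W (h : osub V U) (h' : osub W V) (h'' : osub W U) s,
    res h' (res h s) = res h'' s;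
  sheaf_sep : forall (U : opn) (I : Type) (V : I -> opn) (h : forall i, osub (V i) U),
    covers V U -> forall s t : sec U,
    (forall i, res (h i) s = res (h i) t) -> s = t;
  sheaf_glue : forall (U : opn) (I : Type) (V : I -> opn) (h : forall i, osub (V i) U),
    covers V U -> forall s : forall i, sec (V i),
    (forall i j, res (@capl (V i) (V j)) (s i) = res (@capr (V i) (V j)) (s j)) ->
    exists t : sec U, forall i, res (h i) t = s i }.

Lemma res0 F U V (h : osub V U) : res h (0 : sec F U) = 0.
Proof. by apply: (@addrI _ (res h 0)); rewrite -resD !addr0. Qed.

Lemma resN F U V (h : osub V U) (s : sec F U) : res h (- s) = - res h s.
Proof. by apply: (@addrI _ (res h s)); rewrite -resD !subrr res0. Qed.

Lemma res_irr F U V (h h' : osub V U) (s : sec F U) : res h s = res h' s.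
Proof. by congr res; exact: Prop_irrelevance. Qed.

Lemma sheaf_eq_local F U (s t : sec F U) :
  (forall x, U x -> exists (V : opn) (h : osub V U), V x /\ res h s = res h t) ->
  s = t.
Proof.
move=> H; pose I := {V : opn | exists h : osub V U, res h s = res h t}.
pose V (i : I) := sval i; pose h (i : I) : osub (V i) U := projT1 (cid (svalP i)).
apply: (@sheaf_sep F U I V h) => [x Ux|i]; last exact: (projT2 (cid (svalP i))).
by have [W [hW [Wx e]]] := H x Ux; exists (exist _ W (ex_intro _ hW e)).
Qed.

Fact hresD t U V (h : osub V U) (f g : hreg t U) : hres h (f + g) = hres h f + hres h g.
Proof. exact: hreg_eq. Qed.
Fact hresZ t U V (h : osub V U) a (f : hreg t U) : hres h (a *: f) = rres h a *: hres h f.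
Proof. exact: hreg_eq. Qed.
Lemma pts_eq U (x y : pts U) : sval x = sval y -> x = y.
Proof. by case: x y => [x Ux] [y Uy] /= e; subst y; congr exist; exact: Prop_irrelevance. Qed.
Fact hres_id t U (h : osub U U) (f : hreg t U) : hres h f = f.
Proof. by apply: hreg_eq => x /=; congr (hval f _); exact: pts_eq. Qed.
Fact hres_comp t U V W (h : osub V U) (h' : osub W V) (h'' : osub W U) (f : hreg t U) :
  hres h' (hres h f) = hres h'' f.
Proof. by apply: hreg_eq => x /=; congr (hval f _); exact: pts_eq. Qed.

Fact hreg_sep t (U : opn) (I : Type) (V : I -> opn) (h : forall i, osub (V i) U) :
  covers V U -> forall f g : hreg t U,
  (forall i, hres (h i) f = hres (h i) g) -> f = g.
Proof.
move=> cV f g e; apply: hreg_eq => x; have [i Vx] := cV _ (svalP x).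
have := congr1 (fun u : hreg t (V i) => u (exist _ (sval x) Vx)) (e i) => /=.
by rewrite /pres /=; congr (_ = _); congr (hval _ _); exact: pts_eq.
Qed.

Fact hreg_glue t (U : opn) (I : Type) (V : I -> opn) (h : forall i, osub (V i) U) :
  covers V U -> forall s : forall i, hreg t (V i),
  (forall i j, hres (@capl (V i) (V j)) (s i) = hres (@capr (V i) (V j)) (s j)) ->
  exists f : hreg t U, forall i, hres (h i) f = s i.
Proof.
move=> cV s e.
pose ix (x : pts U) : {i | V i (sval x)} := cid (cV _ (svalP x)).
pose f (x : pts U) : k := s (sval (ix x)) (exist _ (sval x) (svalP (ix x))).
have fE i (x : pts U) (Vx : V i (sval x)) : f x = s i (exist _ (sval x) Vx).
  rewrite /f; case: (ix x) => j Vj /=.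
  have := congr1 (fun u : hreg t (ocap (V j) (V i)) =>
    u (exist _ (sval x) (conj Vj Vx))) (e j i) => /=.
  by rewrite /pres /=; congr (_ = _); congr (hval _ _); exact: pts_eq.
have rf : regular t f.
  move=> x; have [i Vx] := cV _ (svalP x).
  have [W [d [e' [p [q [Wx dd hp hq H]]]]]] := hregP (s i) (exist _ (sval x) Vx).
  exists (ocap W (V i)), d, e', p, q; split=> // y [Wy Vy].
  by rewrite (fE i y Vy); exact: (H (exist _ (sval y) Vy)).
exists (mkreg rf) => i; apply: hreg_eq => -[x Vx].
exact: (fE i (pres (h i) (exist _ x Vx)) Vx).
Qed.

Definition OO (t : int) : sheaf :=
  Sheaf (sec := fun U => hreg t U) (@hresD t) (@hresZ t) (@hres_id t)
    (@hres_comp t) (@hreg_sep t) (@hreg_glue t).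

Section FinSum.
Variables (F : sheaf) (p : nat).
Definition fs_sec U : lmodType (sring U) := {ffun 'I_p -> sec F U}.
Definition fs_res U V (h : osub V U) (s : fs_sec U) : fs_sec V := [ffun i => res h (s i)].
Fact fs_resD U V (h : osub V U) s t : fs_res h (s + t) = fs_res h s + fs_res h t.
Proof. by apply/ffunP => i; rewrite !ffunE resD. Qed.
Fact fs_resZ U V (h : osub V U) a s : fs_res h (a *: s) = rres h a *: fs_res h s.
Proof. by apply/ffunP => i; rewrite !ffunE resZ. Qed.
Fact fs_res_id U (h : osub U U) s : fs_res h s = s.
Proof. by apply/ffunP => i; rewrite !ffunE res_id. Qed.
Fact fs_res_comp U V W (h : osub V U) (h' : osub W V) (h'' : osub W U) s :
  fs_res h' (fs_res h s) = fs_res h'' s.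
Proof. by apply/ffunP => i; rewrite !ffunE (res_comp h h' h''). Qed.
Fact fs_sep (U : opn) (I : Type) (V : I -> opn) (h : forall i, osub (V i) U) :
  covers V U -> forall s t : fs_sec U,
  (forall i, fs_res (h i) s = fs_res (h i) t) -> s = t.
Proof.
move=> cV s t e; apply/ffunP => l; apply: (sheaf_sep cV) => i.
by have /ffunP/(_ l) := e i; rewrite !ffunE; apply.
Qed.
Fact fs_glue (U : opn) (I : Type) (V : I -> opn) (h : forall i, osub (V i) U) :
  covers V U -> forall s : forall i, fs_sec (V i),
  (forall i j, fs_res (@capl (V i) (V j)) (s i) = fs_res (@capr (V i) (V j)) (s j)) ->
  exists t : fs_sec U, forall i, fs_res (h i) t = s i.
Proof.
move=> cV s e.
have H l : exists t : sec F U, forall i, res (h i) t = s i l.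
  by apply: (sheaf_glue h cV) => i j; have /ffunP/(_ l) := e i j; rewrite !ffunE.
exists [ffun l => sval (cid (H l))] => i; apply/ffunP => l.
by rewrite !ffunE; exact: (svalP (cid (H l)) i).
Qed.
Definition fsum : sheaf :=
  Sheaf fs_resD fs_resZ fs_res_id fs_res_comp fs_sep fs_glue.
End FinSum.

Section DirectSum.
Variables (F G : sheaf).
Definition ds_sec U : lmodType (sring U) := (sec F U * sec G U)%type.
Definition ds_res U V (h : osub V U) (s : ds_sec U) : ds_sec V := (res h s.1, res h s.2).
Fact ds_resD U V (h : osub V U) s t : ds_res h (s + t) = ds_res h s + ds_res h t.
Proof. by rewrite /ds_res !resD. Qed.
Fact ds_resZ U V (h : osub V U) a s : ds_res h (a *: s) = rres h a *: ds_res h s.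
Proof. by rewrite /ds_res !resZ. Qed.
Fact ds_res_id U (h : osub U U) s : ds_res h s = s.
Proof. by rewrite /ds_res !res_id; case: s. Qed.
Fact ds_res_comp U V W (h : osub V U) (h' : osub W V) (h'' : osub W U) s :
  ds_res h' (ds_res h s) = ds_res h'' s.
Proof. by rewrite /ds_res !(res_comp h h' h''). Qed.
Fact ds_sep (U : opn) (I : Type) (V : I -> opn) (h : forall i, osub (V i) U) :
  covers V U -> forall s t : ds_sec U,
  (forall i, ds_res (h i) s = ds_res (h i) t) -> s = t.
Proof.
move=> cV [s1 s2] [t1 t2] e; congr pair; apply: (sheaf_sep cV) => i.
  by case: (e i) => H _; exact: H.
by case: (e i) => _ H; exact: H.
Qed.
Fact ds_glue (U : opn) (I : Type) (V : I -> opn) (h : forall i, osub (V i) U) :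
  covers V U -> forall s : forall i, ds_sec (V i),
  (forall i j, ds_res (@capl (V i) (V j)) (s i) = ds_res (@capr (V i) (V j)) (s j)) ->
  exists t : ds_sec U, forall i, ds_res (h i) t = s i.
Proof.
move=> cV s e.
have [|t1 H1] := @sheaf_glue F U I V h cV (fun i => (s i).1).
  by move=> i j; case: (e i j).
have [|t2 H2] := @sheaf_glue G U I V h cV (fun i => (s i).2).
  by move=> i j; case: (e i j).
by exists (t1, t2) => i; rewrite /ds_res H1 H2; case: (s i).
Qed.
Definition dsum : sheaf :=
  Sheaf ds_resD ds_resZ ds_res_id ds_res_comp ds_sep ds_glue.
End DirectSum.

Record subsheaf (F : sheaf) := Subsheaf {
  smem : forall U, sec F U -> Prop;
  smem0 : forall U, smem (0 : sec F U);
  smem_lin : forall U (a : sring U) (s t : sec F U),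
    smem s -> smem t -> smem (a *: s + t);
  smem_res : forall U V (h : osub V U) (s : sec F U), smem s -> smem (res h s);
  smem_loc : forall U (s : sec F U),
    (forall x, U x -> exists (V : opn) (h : osub V U), V x /\ smem (res h s)) ->
    smem s }.

Section SheafOfSubsheaf.
Variables (F : sheaf) (S : subsheaf F).

Definition ss_pred U : {pred sec F U} := fun s => `[< smem S s >].
Arguments ss_pred : clear implicits.
Fact ss_submod_closed U : submod_closed (ss_pred U).
Proof.
split; first by apply/asboolP; exact: smem0.
by move=> a s t /asboolP hs /asboolP ht; apply/asboolP; exact: smem_lin.
Qed.
HB.instance Definition _ U :=
  GRing.isSubmodClosed.Build (sring U) (sec F U) (ss_pred U) (ss_submod_closed U).

Record ss_type U := SubSec { ss_val : sec F U; ss_valP : ss_val \in ss_pred U }.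
HB.instance Definition _ U := [isSub for @ss_val U].
HB.instance Definition _ U := [Choice of ss_type U by <:].
HB.instance Definition _ U := [SubChoice_isSubLmodule of ss_type U by <:].

Definition ss_sec U : lmodType (sring U) := ss_type U.
Lemma ss_mem U (s : ss_sec U) : smem S (ss_val s).
Proof. by apply/asboolP; exact: ss_valP. Qed.
Definition mkss U (s : sec F U) (hs : smem S s) : ss_sec U :=
  SubSec (introT (asboolP _) hs).
Lemma ss_eq U (s t : ss_sec U) : ss_val s = ss_val t -> s = t.
Proof. exact: val_inj. Qed.

Definition ss_res U V (h : osub V U) (s : ss_sec U) : ss_sec V :=
  mkss (smem_res h (ss_mem s)).
Fact ss_resD U V (h : osub V U) s t : ss_res h (s + t) = ss_res h s + ss_res h t.
Proof. by apply: ss_eq; exact: resD. Qed.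
Fact ss_resZ U V (h : osub V U) a s : ss_res h (a *: s) = rres h a *: ss_res h s.
Proof. by apply: ss_eq; exact: resZ. Qed.
Fact ss_res_id U (h : osub U U) s : ss_res h s = s.
Proof. by apply: ss_eq; exact: res_id. Qed.
Fact ss_res_comp U V W (h : osub V U) (h' : osub W V) (h'' : osub W U) s :
  ss_res h' (ss_res h s) = ss_res h'' s.
Proof. by apply: ss_eq; exact: res_comp. Qed.
Fact ss_sep (U : opn) (I : Type) (V : I -> opn) (h : forall i, osub (V i) U) :
  covers V U -> forall s t : ss_sec U,
  (forall i, ss_res (h i) s = ss_res (h i) t) -> s = t.
Proof.
move=> cV s t e; apply: ss_eq; apply: (sheaf_sep cV) => i.
exact: (congr1 (@ss_val _) (e i)).
Qed.
Fact ss_glue (U : opn) (I : Type) (V : I -> opn) (h : forall i, osub (V i) U) :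
  covers V U -> forall s : forall i, ss_sec (V i),
  (forall i j, ss_res (@capl (V i) (V j)) (s i) = ss_res (@capr (V i) (V j)) (s j)) ->
  exists t : ss_sec U, forall i, ss_res (h i) t = s i.
Proof.
move=> cV s e.
have [|t ht] := @sheaf_glue F U I V h cV (fun i => ss_val (s i)).
  by move=> i j; exact: (congr1 (@ss_val _) (e i j)).
have St : smem S t.
  apply: smem_loc => x /cV [i Vx]; exists (V i), (h i); split=> //.
  by rewrite ht; exact: ss_mem.
by exists (mkss St) => i; apply: ss_eq; exact: ht.
Qed.
Definition sheaf_of : sheaf :=
  Sheaf ss_resD ss_resZ ss_res_id ss_res_comp ss_sep ss_glue.
End SheafOfSubsheaf.

Record shom (F G : sheaf) := Hom {
  app :> forall U, sec F U -> sec G U;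
  appL : forall U (a : sring U) s t, app (a *: s + t) = a *: app s + app t;
  app_res : forall U V (h : osub V U) s, app (res h s) = res h (app s) }.

Lemma app0 F G (f : shom F G) U : f U 0 = 0.
Proof.
have := appL f 1 (0 : sec F U) 0; rewrite scaler0 add0r scale1r => e.
by apply: (@addrI _ (f U 0)); rewrite addr0 -e.
Qed.

Lemma appD F G (f : shom F G) U (s t : sec F U) : f U (s + t) = f U s + f U t.
Proof. by have := appL f 1 s t; rewrite !scale1r. Qed.

Lemma appZ F G (f : shom F G) U a (s : sec F U) : f U (a *: s) = a *: f U s.
Proof. by have := appL f a s 0; rewrite app0 !addr0. Qed.

Definition eqhom F G (f g : shom F G) : Prop := forall U s, f U s = g U s.

Fact idL F U (a : sring U) (s t : sec F U) : id (a *: s + t) = a *: id s + id t.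
Proof. by []. Qed.
Fact id_res F U V (h : osub V U) (s : sec F U) : id (res h s) = res h (id s).
Proof. by []. Qed.
Definition idh F : shom F F := Hom (app := fun U s => s) (@idL F) (@id_res F).

Section Composition.
Variables (F G H : sheaf) (g : shom G H) (f : shom F G).
Fact compL U (a : sring U) s t : g U (f U (a *: s + t)) = a *: g U (f U s) + g U (f U t).
Proof. by rewrite !appL. Qed.
Fact comp_res U V (h : osub V U) s : g V (f V (res h s)) = res h (g U (f U s)).
Proof. by rewrite !app_res. Qed.
Definition comph : shom F H := Hom compL comp_res.
End Composition.

Definition is_zeroh F G (f : shom F G) : Prop := forall U s, f U s = 0.
Definition is_zero F : Prop := forall U (s : sec F U), s = 0.

Definition inverseh F G (f : shom F G) (g : shom G F) : Prop :=
  eqhom (comph g f) (idh F) /\ eqhom (comph f g) (idh G).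
Definition is_iso F G (f : shom F G) : Prop := exists g, inverseh f g.
Definition isomorphic F G : Prop := exists f : shom F G, is_iso f.

Definition loc_image F G (f : shom F G) U (s : sec G U) : Prop :=
  forall x, U x -> exists (V : opn) (h : osub V U),
    V x /\ exists t : sec F V, f V t = res h s.

(* Surjectivity and exactness in the category of sheaves: preimages exist locally *)
Definition surjective F G (f : shom F G) : Prop := forall U (s : sec G U), loc_image f s.

Definition sexact F G H (f : shom F G) (g : shom G H) : Prop :=
  forall U (s : sec G U), g U s = 0 <-> loc_image f s.

Definition is_cokernel F G C (f : shom F G) (c : shom G C) : Prop :=
  sexact f c /\ surjective c.

Section Kernel.
Variables (F G : sheaf) (f : shom F G).
Fact ker_mem0 U : f U 0 = 0. Proof. exact: app0. Qed.
Fact ker_mem_lin U (a : sring U) s t : f U s = 0 -> f U t = 0 -> f U (a *: s + t) = 0.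
Proof. by move=> hs ht; rewrite appL hs ht scaler0 addr0. Qed.
Fact ker_mem_res U V (h : osub V U) s : f U s = 0 -> f V (res h s) = 0.
Proof. by move=> hs; rewrite app_res hs res0. Qed.
Fact ker_mem_loc U (s : sec F U) :
  (forall x, U x -> exists (V : opn) (h : osub V U), V x /\ f V (res h s) = 0) ->
  f U s = 0.
Proof.
move=> H; apply: sheaf_eq_local => x /H [V [h [Vx e]]].
by exists V, h; rewrite -app_res e res0.
Qed.
Definition ker_sub : subsheaf F :=
  Subsheaf ker_mem0 ker_mem_lin ker_mem_res ker_mem_loc.
Definition ker : sheaf := sheaf_of ker_sub.
End Kernel.

Section Image.
Variables (F G : sheaf) (f : shom F G).
Fact img_mem0 U : loc_image f (0 : sec G U).
Proof. by move=> x Ux; exists U, (@sub_refl U); split=> //; exists 0; rewrite app0 res0. Qed.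
Fact img_mem_lin U (a : sring U) (s t : sec G U) :
  loc_image f s -> loc_image f t -> loc_image f (a *: s + t).
Proof.
move=> hs ht x Ux; have [V [h [Vx [s' es]]]] := hs x Ux.
have [W [h' [Wx [t' et]]]] := ht x Ux.
have hc : osub (ocap V W) U := sub_trans (@capl V W) h.
exists (ocap V W), hc; split=> //.
exists (rres hc a *: res (@capl V W) s' + res (@capr V W) t').
by rewrite appL !app_res es et (res_comp _ _ hc) (res_comp _ _ hc) resD resZ.
Qed.
Fact img_mem_res U V (h : osub V U) (s : sec G U) : loc_image f s -> loc_image f (res h s).
Proof.
move=> hs x Vx; have [W [h' [Wx [t et]]]] := hs x (h _ Vx).
exists (ocap W V), (@capr W V); split=> //; exists (res (@capl W V) t).
have hc : osub (ocap W V) U := sub_trans (@capl W V) h'.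
by rewrite app_res et (res_comp _ _ hc) (res_comp _ _ hc).
Qed.
Fact img_mem_loc U (s : sec G U) :
  (forall x, U x -> exists (V : opn) (h : osub V U), V x /\ loc_image f (res h s)) ->
  loc_image f s.
Proof.
move=> H x Ux; have [V [h [Vx hV]]] := H x Ux.
have [W [h' [Wx [t et]]]] := hV x Vx; exists W, (sub_trans h' h); split=> //.
by exists t; rewrite et (res_comp _ _ (sub_trans h' h)).
Qed.
Definition img_sub : subsheaf G :=
  Subsheaf img_mem0 img_mem_lin img_mem_res img_mem_loc.
Definition img : sheaf := sheaf_of img_sub.
End Image.

Section KernelMap.
Variables (F F' G G' : sheaf) (f : shom F G) (g : shom F' G') (d : shom F F') (e : shom G G').
Hypothesis sq : eqhom (comph g d) (comph e f).
Fact kermap_mem U (s : sec (ker f) U) : g U (d U (ss_val s)) = 0.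
Proof. by have := sq (ss_val s) => /= ->; rewrite (ss_mem s) app0. Qed.
Definition kermap_fun U (s : sec (ker f) U) : sec (ker g) U :=
  mkss (S := ker_sub g) (kermap_mem s).
Fact kermapL U (a : sring U) s t :
  kermap_fun (a *: s + t) = a *: kermap_fun s + kermap_fun t.
Proof. by apply: ss_eq; exact: appL. Qed.
Fact kermap_res U V (h : osub V U) s : kermap_fun (res h s) = res h (kermap_fun s).
Proof. by apply: ss_eq; exact: app_res. Qed.
Definition kermap : shom (ker f) (ker g) := Hom kermapL kermap_res.
End KernelMap.

Definition vbundle (F : sheaf) : Prop :=
  forall x : pt, x != 0 -> exists (U : opn) (r : nat) (e : 'I_r -> sec F U),
    U x /\ forall V (h : osub V U) (s : sec F V),
      exists! c : {ffun 'I_r -> sring V}, s = \sum_i c i *: res h (e i).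

Definition indecomposable (E : sheaf) : Prop :=
  ~ is_zero E /\ forall F G, vbundle F -> vbundle G ->
    isomorphic E (dsum F G) -> is_zero F \/ is_zero G.

Definition globally_generated (F : sheaf) : Prop :=
  forall U (s : sec F U) x, U x -> exists (V : opn) (h : osub V U) (h' : osub V otop)
    (N : nat) (g : 'I_N -> sec F otop) (c : 'I_N -> sring V),
    V x /\ res h s = \sum_i c i *: res h' (g i).

(* F(t) = F (x) O(t), glued from the trivializations x_l^t of O(t) on chart l: a
   section over U is a family s_l in F(U /\ chart l), standing for s_l (x) x_l^t,
   with s_l = (x_m / x_l)^t s_m on the overlaps. *)
Definition overlap U l m : opn := ocap U (ocap (chart l) (chart m)).
Lemma overlap_l U l m : osub (overlap U l m) (chart l). Proof. by move=> x [_ []]. Qed.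
Lemma overlap_r U l m : osub (overlap U l m) (chart m). Proof. by move=> x [_ []]. Qed.
Lemma overlap_ol U l m : osub (overlap U l m) (ocap U (chart l)). Proof. by move=> x [? []]. Qed.
Lemma overlap_or U l m : osub (overlap U l m) (ocap U (chart m)). Proof. by move=> x [? []]. Qed.

Definition coordX l u U (h : osub U (chart l)) : hreg u U := mkreg (regular_coordX u h).
Definition ratio U l m (t : int) : sring (overlap U l m) :=
  hmul (subrr t) (coordX t (@overlap_r U l m)) (coordX (- t) (@overlap_l U l m)).

Section Twist.
Variables (F : sheaf) (t : int).

Definition cocycle U (s : forall l, sec F (ocap U (chart l))) : Prop :=
  forall l m, res (@overlap_ol U l m) (s l) =
    ratio U l m t *: res (@overlap_or U l m) (s m).
Record tw_type U := Tw { tw :> forall l, sec F (ocap U (chart l)); twP : cocycle tw }.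
HB.instance Definition _ U := gen_eqMixin (tw_type U).
HB.instance Definition _ U := gen_choiceMixin (tw_type U).

Lemma tw_eq U (s s' : tw_type U) : (forall l, s l = s' l) -> s = s'.
Proof.
case: s s' => [s Ps] [s' Ps'] /= e.
have E : s = s' by apply: functional_extensionality_dep.
by subst s'; congr Tw; exact: Prop_irrelevance.
Qed.

Fact tw0P U : @cocycle U (fun l => 0).
Proof. by move=> l m; rewrite !res0 scaler0. Qed.
Fact twNP U (s : tw_type U) : @cocycle U (fun l => - s l).
Proof. by move=> l m; rewrite !resN (twP s) scalerN. Qed.
Fact twDP U (s s' : tw_type U) : @cocycle U (fun l => s l + s' l).
Proof. by move=> l m; rewrite !resD (twP s) (twP s') scalerDr. Qed.
Fact twZP U a (s : tw_type U) :
  @cocycle U (fun l => rres (@capl U (chart l)) a *: s l).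
Proof.
move=> l m; rewrite !resZ (twP s) !scalerA mulrC; congr (_ * _ *: _).
have hU : osub (overlap U l m) U := @capl _ _.
by rewrite /rres !(hres_comp _ _ hU).
Qed.
Definition tw_zero U := Tw (@tw0P U).
Definition tw_opp U (s : tw_type U) := Tw (twNP s).
Definition tw_add U (s s' : tw_type U) := Tw (twDP s s').
Definition tw_scale U a (s : tw_type U) := Tw (twZP a s).

Fact tw_addA U : associative (@tw_add U).
Proof. by move=> s s' s''; apply: tw_eq => l; exact: addrA. Qed.
Fact tw_addC U : commutative (@tw_add U).
Proof. by move=> s s'; apply: tw_eq => l; exact: addrC. Qed.
Fact tw_add0 U : left_id (@tw_zero U) (@tw_add U).
Proof. by move=> s; apply: tw_eq => l; exact: add0r. Qed.
Fact tw_addN U : left_inverse (@tw_zero U) (@tw_opp U) (@tw_add U).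
Proof. by move=> s; apply: tw_eq => l; exact: addNr. Qed.
HB.instance Definition _ U := GRing.isZmodule.Build (tw_type U)
  (@tw_addA U) (@tw_addC U) (@tw_add0 U) (@tw_addN U).

Fact tw_scaleA U (a b : sring U) (s : tw_type U) :
  tw_scale a (tw_scale b s) = tw_scale (a * b) s.
Proof. by apply: tw_eq => l; rewrite /= scalerA; congr (_ *: _); exact: hreg_eq. Qed.
Fact tw_scale1 U : left_id 1 (@tw_scale U).
Proof.
move=> s; apply: tw_eq => l /=; rewrite -[RHS]scale1r; congr (_ *: _).
exact: hreg_eq.
Qed.
Fact tw_scaleDr U : right_distributive (@tw_scale U) +%R.
Proof. by move=> a s s'; apply: tw_eq => l; exact: scalerDr. Qed.
Fact tw_scaleDl U (s : tw_type U) : {morph (@tw_scale U)^~ s : a b / a + b}.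
Proof.
move=> a b; apply: tw_eq => l; rewrite /= -scalerDl; congr (_ *: _).
exact: hreg_eq.
Qed.
HB.instance Definition _ U := GRing.Zmodule_isLmodule.Build (sring U) (tw_type U)
  (@tw_scaleA U) (@tw_scale1 U) (@tw_scaleDr U) (@tw_scaleDl U).

Definition tw_sec U : lmodType (sring U) := tw_type U.

Fact tw_resP U V (h : osub V U) (s : tw_type U) :
  @cocycle V (fun l => res (capl_mono (V := chart l) h) (s l)).
Proof.
move=> l m.
have ho : osub (overlap V l m) (overlap U l m) := capl_mono h.
rewrite (res_comp _ _ (sub_trans ho (@overlap_ol U l m))).
rewrite -(res_comp (@overlap_ol U l m) ho) twP resZ.
rewrite (res_comp _ _ (sub_trans ho (@overlap_or U l m))).
rewrite (res_comp _ _ (sub_trans ho (@overlap_or U l m))).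
by congr (_ *: _); exact: hreg_eq.
Qed.
Definition tw_res U V (h : osub V U) (s : tw_sec U) : tw_sec V := Tw (tw_resP h s).
Fact tw_resD U V (h : osub V U) s s' : tw_res h (s + s') = tw_res h s + tw_res h s'.
Proof. by apply: tw_eq => l; exact: resD. Qed.
Fact tw_resZ U V (h : osub V U) a s : tw_res h (a *: s) = rres h a *: tw_res h s.
Proof.
apply: tw_eq => l /=; rewrite resZ; congr (_ *: _).
by apply: hreg_eq => x /=; congr (hval a _); exact: pts_eq.
Qed.
Fact tw_res_id U (h : osub U U) s : tw_res h s = s.
Proof. by apply: tw_eq => l; exact: res_id. Qed.
Fact tw_res_comp U V W (h : osub V U) (h' : osub W V) (h'' : osub W U) s :
  tw_res h' (tw_res h s) = tw_res h'' s.
Proof. by apply: tw_eq => l; exact: res_comp. Qed.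
Fact tw_sep (U : opn) (I : Type) (V : I -> opn) (h : forall i, osub (V i) U) :
  covers V U -> forall s s' : tw_sec U,
  (forall i, tw_res (h i) s = tw_res (h i) s') -> s = s'.
Proof.
move=> cV s s' e; apply: tw_eq => l.
apply: (@sheaf_sep F _ I (fun i => ocap (V i) (chart l)) (fun i => capl_mono (h i))).
  by move=> x [/cV [i Vx] Dx]; exists i.
by move=> i; exact: (congr1 (fun u : tw_type (V i) => u l) (e i)).
Qed.
Fact tw_glue (U : opn) (I : Type) (V : I -> opn) (h : forall i, osub (V i) U) :
  covers V U -> forall s : forall i, tw_sec (V i),
  (forall i j, tw_res (@capl (V i) (V j)) (s i) = tw_res (@capr (V i) (V j)) (s j)) ->
  exists t : tw_sec U, forall i, tw_res (h i) t = s i.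
Proof.
move=> cV s e.
have H l : exists u : sec F (ocap U (chart l)),
    forall i, res (capl_mono (V := chart l) (h i)) u = s i l.
  apply: (@sheaf_glue F _ I (fun i => ocap (V i) (chart l)) (fun i => capl_mono (h i))).
    by move=> x [/cV [i Vx] Dx]; exists i.
  move=> i j.
  pose W := ocap (ocap (V i) (chart l)) (ocap (V j) (chart l)).
  have hW : osub W (ocap (ocap (V i) (V j)) (chart l)) by move=> x [[? ?] [? ?]].
  have := congr1 (fun u : tw_type (ocap (V i) (V j)) => res hW (u l)) (e i j).
  rewrite /= !(res_comp _ _ (@capl (ocap (V i) (chart l)) (ocap (V j) (chart l)))).
  by rewrite !(res_comp _ _ (@capr (ocap (V i) (chart l)) (ocap (V j) (chart l)))).
pose u l := sval (cid (H l)).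
have uE l i : res (capl_mono (V := chart l) (h i)) (u l) = s i l := svalP (cid (H l)) i.
have uP : cocycle u.
  move=> l m.
  apply: (@sheaf_sep F _ I (fun i => overlap (V i) l m) (fun i => capl_mono (h i))).
    by move=> x [/cV [i Vx] Dx]; exists i.
  move=> i; pose ho : osub (overlap (V i) l m) (overlap U l m) := capl_mono (h i).
  rewrite (res_comp _ _ (sub_trans ho (@overlap_ol U l m))).
  rewrite -(res_comp (capl_mono (h i)) (@overlap_ol (V i) l m)) uE (twP (s i)).
  rewrite resZ (res_comp _ _ (sub_trans ho (@overlap_or U l m))).
  rewrite -(res_comp (capl_mono (h i)) (@overlap_or (V i) l m)) uE.
  by congr (_ *: _); exact: hreg_eq.
by exists (Tw uP) => i; apply: tw_eq => l; exact: uE.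
Qed.
Definition twist : sheaf :=
  Sheaf tw_resD tw_resZ tw_res_id tw_res_comp tw_sep tw_glue.
End Twist.

Section TwistMorphism.
Variables (F G : sheaf) (f : shom F G) (t : int).
Fact twist_homP U (s : sec (twist F t) U) :
  @cocycle G t U (fun l => f _ ((s : tw_type F t U) l)).
Proof. by move=> l m; rewrite -!app_res twP appZ. Qed.
Definition twist_fun U (s : sec (twist F t) U) : sec (twist G t) U := Tw (twist_homP s).
Fact twist_homL U (a : sring U) s s' :
  twist_fun (a *: s + s') = a *: twist_fun s + twist_fun s'.
Proof. by apply: tw_eq => l; exact: appL. Qed.
Fact twist_hom_res U V (h : osub V U) s : twist_fun (res h s) = res h (twist_fun s).
Proof. by apply: tw_eq => l; exact: app_res. Qed.
Definition twist_hom : shom (twist F t) (twist G t) := Hom twist_homL twist_hom_res.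
End TwistMorphism.

Definition linear_mx a b (M : 'M[poly]_(b, a)) : Prop := forall i j, isform 1 (M i j).

Definition constant_rank a b (M : 'M[poly]_(b, a)) (r : nat) : Prop :=
  forall x : pt, x != 0 -> \rank (map_mx (meval (x ord0)) M) = r.

Definition formsec t p (hp : isform t p) U : hreg t U := mkreg (@regular_form t p U hp).

Section MatrixMorphism.
Variables (a b : nat) (M : 'M[poly]_(b, a)) (hM : linear_mx M).
Definition mx_fun U (s : sec (fsum (OO 0) a) U) : sec (fsum (OO 1) b) U :=
  [ffun i => \sum_j hmul (add0r 1) ((s : {ffun 'I_a -> hreg 0 U}) j) (formsec (hM i j) U)].
Fact mx_homL U (c : sring U) s s' : mx_fun (c *: s + s') = c *: mx_fun s + mx_fun s'.
Proof.
apply/ffunP => i; rewrite !ffunE scaler_sumr -big_split /=; apply: eq_bigr => j _.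
rewrite !ffunE; apply: hreg_eq => x /=.
by rewrite !mulrfctE /= !addrfctE mulrDl -mulrA.
Qed.
Fact mx_hom_res U V (h : osub V U) s : mx_fun (res h s) = res h (mx_fun s).
Proof.
apply/ffunP => i; rewrite !ffunE.
rewrite (big_morph (@res (OO 1) U V h) (@resD (OO 1) U V h) (@res0 (OO 1) U V h)).
by apply: eq_bigr => j _; rewrite !ffunE; exact: hreg_eq.
Qed.
Definition mx_hom : shom (fsum (OO 0) a) (fsum (OO 1) b) := Hom mx_homL mx_hom_res.
End MatrixMorphism.

(* The graded R-module H^0_*(E), with homogeneous component H0 E t in degree t;
   H0mul is the action R_t x H^0(E(0)) -> H^0(E(t)).  On chart l the form f and the
   section s (x) x_l^0 multiply to ((f / x_l^t) s) (x) x_l^t. *)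
Definition H0 (E : sheaf) (t : int) : lmodType (sring otop) := sec (twist E t) otop.

Definition dehomog l t p (hp : isform t p) : sring (ocap otop (chart l)) :=
  hmul (subrr t) (formsec hp _) (coordX (- t) (@capr otop (chart l))).

Fact H0mulP (E : sheaf) t p (hp : isform t p) (s : H0 E 0) :
  @cocycle E t otop (fun l => dehomog l hp *: (s : tw_type E 0 otop) l).
Proof.
move=> l m; rewrite !resZ twP !scalerA; congr (_ *: _).
apply: hreg_eq => x /=; rewrite !mulrfctE /=.
have xl : sval x ord0 l != 0 := overlap_l (svalP x).
have xm : sval x ord0 m != 0 := overlap_r (svalP x).
rewrite oppr0 !expr0z !mulr1 [p @ _ * _ in RHS]mulrC mulrACA.
by rewrite -expfzDr // subrr expr0z mul1r mulrC.
Qed.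
Definition H0mul (E : sheaf) t p (hp : isform t p) (s : H0 E 0) : H0 E t :=
  Tw (H0mulP hp s).

Definition formrow (t : int) a (u : 'rV[poly]_a) : Prop := forall j, isform t (u ord0 j).

Definition H0comb (E : sheaf) a (g : 'I_a -> H0 E 0) t (u : 'rV[poly]_a)
    (hu : formrow t u) : H0 E t := \sum_j H0mul (hu j) (g j).

(* Property L_p, for p >= 1.  A homogeneous element of R(-m)^(a m) of degree t is
   a row of forms of degree t - m.  The last two clauses say that no map
   R(-m)^(a m) -> R(-m+1)^(a (m-1)), and not the augmentation either, kills a
   nonzero constant row, i.e. that the resolution is minimal. *)
Definition L_linear (p : nat) (E : sheaf) : Prop :=
  globally_generated E /\
  exists (a : nat -> nat) (g : 'I_(a 0%N) -> H0 E 0)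
         (d : forall m, 'M[poly]_(a m.+1, a m)),
    [/\ forall m, (m.+1 < p)%N -> linear_mx (d m),
        forall t (s : H0 E t), exists u (hu : formrow t u), s = H0comb g hu,
        (1 < p)%N -> forall t u (hu : formrow t u),
          H0comb g hu = 0 <-> exists2 w, formrow (t - 1) w & u = w *m d 0%N,
        forall m, (m.+2 < p)%N -> forall t (u : 'rV_(a m.+1)), formrow t u ->
          (u *m d m = 0 <-> exists2 w, formrow (t - 1) w & u = w *m d m.+1) &
        (forall u (hu : formrow 0 u), H0comb g hu = 0 -> u = 0) /\
        (forall m, (m.+1 < p)%N -> forall u : 'rV_(a m.+1), formrow 0 u ->
          u *m d m = 0 -> u = 0)].

(* diff s t is the differential when t = s + 1 and is 0 otherwise *)
Record complex := Complex {
  term :> int -> sheaf;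
  diff : forall s t, shom (term s) (term t);
  diff_off : forall s t, s + 1 != t -> is_zeroh (diff s t);
  diff_sq : forall s t u, is_zeroh (comph (diff t u) (diff s t)) }.

Section Shift.
Variables (P : complex) (j : int).
Fact shift_off s t : s + 1 != t -> is_zeroh (diff P (j + s) (j + t)).
Proof. by move=> h; apply: diff_off; rewrite -addrA (inj_eq (addrI j)). Qed.
Fact shift_sq s t u : is_zeroh (comph (diff P (j + t) (j + u)) (diff P (j + s) (j + t))).
Proof. exact: diff_sq. Qed.
(* P[j], without a sign on the differential *)
Definition cshift : complex := Complex shift_off shift_sq.
End Shift.

Section ComplexTwist.
Variables (P : complex) (m : int).
Fact ctwist_off s t : s + 1 != t -> is_zeroh (twist_hom (diff P s t) m).
Proof. by move=> h U x; apply: tw_eq => l; exact: diff_off. Qed.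
Fact ctwist_sq s t u :
  is_zeroh (comph (twist_hom (diff P t u) m) (twist_hom (diff P s t) m)).
Proof. by move=> U x; apply: tw_eq => l; exact: diff_sq. Qed.
Definition ctwist : complex := Complex ctwist_off ctwist_sq.
End ComplexTwist.

Record cmap (P Q : complex) := Cmap {
  cm :> forall t, shom (P t) (Q t);
  cm_comm : forall s t, eqhom (comph (cm t) (diff P s t)) (comph (diff Q s t) (cm s)) }.

Definition acyclic (P : complex) : Prop :=
  forall t, sexact (diff P (t - 1) t) (diff P t (t + 1)).

Definition supported (lo hi : int) (P : complex) : Prop :=
  forall t, ~~ (lo <= t <= hi) -> is_zero (P t).

(* The normalization of complexes to degrees -n-1, ..., 0 (width n = n + 1).
   When n < 3 no choice of indices achieves it, for instance for the matrix with
   rows (x_0, ..., x_n) and 0, and the window is widened to -4, ..., 0. *)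
Definition width : int := (maxn n 3).+1.

Definition linear_between (r s : int) (P : complex) : Prop :=
  forall t, r <= t <= s -> exists p, isomorphic (P t) (fsum (OO t) p).

End ProjectiveSpace.

Arguments OO k n t : clear implicits.
Arguments cm_comm {k n P Q} c s t : rename.

(* Main.v *)
Require Import Defs.
From HB Require Import structures.
From mathcomp Require Import all_boot all_order all_algebra.
From mathcomp Require Import boolp functions.
From mathcomp Require Import mpoly.
From mathcomp Require Import zify ring.

(** The obstacle is that the known generators [V] of K have degree 2r + 1, while the complexes must
    be linear near M. Adding [T] to both rows moves this high degree into ker T, at the left end,
    where no linearity is asked. Exactness of P at O^a + O^q is the equality L (ker T) = K: if (vM,
    w) = t (LM, T) for row vectors, then v - tL lies in K, and changing t by an element of ker T
    puts (v, w) in the image of (L, T). The inclusion of L (ker T) in K also gives (ML, T) the same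
    rank as T, so that D is a bundle, and it makes O(1)^b embed in D. All sheaves are realised
    inside sheaves of arbitrary vector-valued functions, so identities and kernels are checked point
    by point. Constant rank then yields local regular generalized inverses, which turn pointwise
    solutions into regular ones. Sections are rows and matrices act on the right, so M enters
    transposed. *)

(** Let K be the kernel of M : O^a -> O(1)^b.  Cramer's rule provides a pointwise
   surjection V : O(-m-1)^N -> K given by forms of degree m + 1.  The truncated
   module of R in degrees >= m has a linear presentation; its dual is a matrix
   T : O(-1)^p -> O^q of linear forms, of constant rank, whose kernel is O(-m-1)^N.
   Forms of degree m + 1 are combinations with linear coefficients of the monomials of
   degree m, so V extends to a matrix L : O(-1)^p -> O^a of linear forms, and
   L (ker T) = K.  Then, up to a twist, the complexes are

     P : 0 -> ker (L, T) -> O(-1)^p -> O^a + O^q -> D -> coker M -> 0,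
     Q : 0 -> ker T      -> O(-1)^p -> O^q       -> coker T -> 0,

   where D is the cokernel of (M L, T) : O(-1)^p -> O(1)^b + O^q, and P -> Q is the
   identity on O(-1)^p and the projection on the other terms.  Its kernel is O^a and
   O(1)^b in the next two degrees, because M L vanishes on ker T. *)

Set Implicit Arguments.
Unset Strict Implicit.
Unset Printing Implicit Defensive.

Import GRing.Theory.
Local Open Scope ring_scope.

(** * Regular functions and matrices *)

Section RegularFunctions.
Variables (k : closedFieldType) (n : nat).
Notation pt := 'rV[k]_n.+1.
Notation opn := (opn k n).
Notation chart := (@chart k n).
Implicit Types (U V W : opn) (t u v : int) (f g : pt -> k).

(** Total functions on the ambient space, with regularity asked only over [U], keep matrix
    identities free of the dependent type [pts U]. *)
Variant reg U t f : Prop := Reg of regular t (fun x : pts U => f (sval x)).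

Lemma reg_ext U t f g : reg U t f -> (forall x, U x -> f x = g x) -> reg U t g.
Proof.
case=> rf e; split; move: rf; have -> // : (fun x : pts U => f (sval x)) = (fun x => g (sval x)).
by apply/funext => x; apply: e; exact: svalP.
Qed.

Lemma reg_sub U V t f : reg U t f -> osub V U -> reg V t f.
Proof. by case=> r h; split; have := regular_res h r. Qed.

Lemma reg_local U t f :
  (forall x, U x -> exists2 V : opn, V x & reg V t f) -> reg U t f.
Proof.
move=> H; split=> x; have [V Vx [rV]] := H _ (svalP x).
have [W [d [e [p [q [Wx de hp hq Hpq]]]]]] := rV (exist _ (sval x) Vx).
exists (ocap V W), d, e, p, q; split=> // y [Vy Wy].
exact: (Hpq (exist _ (sval y) Vy)).
Qed.

Lemma reg0 U t : reg U t (fun=> 0).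
Proof. by split; exact: regular_cst0. Qed.

Lemma reg_form U t p : isform t p -> reg U t (fun x => meval (fun i => x ord0 i) p).
Proof. by split; exact: regular_form. Qed.

Lemma reg_cst U c : reg U 0 (fun=> c).
Proof.
have h : isform 0 (c *: 1 : {mpoly k[n.+1]}) by rewrite /= rpredZ ?dhomog1.
by apply: (reg_ext (reg_form U h)) => x _; rewrite mevalZ meval1 mulr1.
Qed.

Lemma regD U t f g : reg U t f -> reg U t g -> reg U t (fun x => f x + g x).
Proof. by case=> r [r']; split; exact: regular_add r r'. Qed.

Lemma regN U t f : reg U t f -> reg U t (fun x => - f x).
Proof. by case=> r; split; exact: regular_oppr r. Qed.

Lemma regM U t u v f g :
  t + u = v -> reg U t f -> reg U u g -> reg U v (fun x => f x * g x).
Proof. by move=> e [r] [r']; split; exact: regular_mul e r r'. Qed.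

Lemma reg_sum U t (I : Type) (r : seq I) (P : pred I) (F : I -> pt -> k) :
  (forall i, P i -> reg U t (F i)) -> reg U t (fun x => \sum_(i <- r | P i) F i x).
Proof.
move=> H; elim: r => [|i r IH].
  by apply: (reg_ext (reg0 U t)) => x _; rewrite big_nil.
case Pi: (P i); last by apply: (reg_ext IH) => x _; rewrite big_cons Pi.
by apply: (reg_ext (regD (H _ Pi) IH)) => x _; rewrite big_cons Pi.
Qed.

Lemma reg_prod0 U (I : Type) (r : seq I) (F : I -> pt -> k) :
  (forall i, reg U 0 (F i)) -> reg U 0 (fun x => \prod_(i <- r) F i x).
Proof.
move=> H; elim: r => [|i r IH].
  by apply: (reg_ext (reg_cst U 1)) => x _; rewrite big_nil.
by apply: (reg_ext (regM (addr0 0) (H i) IH)) => x _; rewrite big_cons.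
Qed.

Lemma reg_coord U l : reg U 1 (fun x => x ord0 l).
Proof.
apply: (reg_ext (reg_form U (isformX k l))) => x _.
exact: mevalXU.
Qed.

Lemma reg_coordX U l t : osub U (chart l) -> reg U t (fun x => x ord0 l ^ t).
Proof. by split; exact: regular_coordX. Qed.

Lemma zopen_form (p : {mpoly k[n.+1]}) t : isform t p ->
  zopen (fun x : pt => x != 0 /\ meval (fun i => x ord0 i) p != 0).
Proof.
move=> hp; exists (fun q => q = p); split; first by move=> q ->; exists t.
move=> x; split=> [[x0 px]|[x0 [q -> px]]] //; split=> //; by exists p.
Qed.

(** Near [x] the function is a quotient p / q, and it stays nonzero where the numerator does. *)
Lemma reg_neq0 U t f x : reg U t f -> U x -> f x != 0 ->
  exists V : opn, [/\ V x, osub V U & forall y, V y -> f y != 0].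
Proof.
case=> rf Ux fx; have [W [d [e [p [q [Wx de hp hq H]]]]]] := rf (exist _ x Ux).
exists (ocap (ocap U W) (Opn (zopen_form hp))); split.
- have [_ e'] := H (exist _ x Ux) Wx; split=> //; split; first exact: opn_neq0 Ux.
  by move: fx; rewrite e' mulf_eq0 negb_or => /andP[].
- by move=> y [[]].
move=> y [[Uy Wy] [_ py]]; have [qy /= ->] := H (exist _ y Uy) Wy.
by rewrite mulf_neq0 // invr_neq0.
Qed.

Lemma regV U f : reg U 0 f -> (forall x, U x -> f x != 0) -> reg U 0 (fun x => (f x)^-1).
Proof.
case=> rf f0; split=> x; have [W [d [e [p [q [Wx de hp hq H]]]]]] := rf x.
exists (ocap U W), e, d, q, p; split=> //; first by split=> //; exact: svalP.
  by move: de => /eqP; rewrite subr_eq0 => /eqP ->; rewrite subrr.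
move=> y [Uy Wy]; have [qy /= e'] := H y Wy.
have := f0 _ (svalP y); rewrite e' mulf_eq0 negb_or => /andP[py _].
by split=> //; rewrite invf_div.
Qed.

(* [regmx U d e A]: over U, right multiplication of row vectors by A is a map from
   the sum of the O(d i) to the sum of the O(e j). *)
Definition regmx U p q (d : 'I_p -> int) (e : 'I_q -> int) (A : pt -> 'M[k]_(p, q)) :=
  forall i j, reg U (e j - d i) (fun x => A x i j).
Definition regv U p (d : 'I_p -> int) (s : pt -> 'rV[k]_p) :=
  forall j, reg U (d j) (fun x => s x ord0 j).

Section RegularMatrices.
Variables (p q m : nat) (d : 'I_p -> int) (e : 'I_q -> int) (f : 'I_m -> int).

Lemma regmx_sub U V A : regmx U d e A -> osub V U -> regmx V d e A.
Proof. by move=> rA h i j; exact: (reg_sub (rA i j)). Qed.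
Lemma regv_ext U s s' : regv U d s -> (forall x, U x -> s x = s' x) -> regv U d s'.
Proof. by move=> rA h i; apply: (reg_ext (rA i)) => x /h ->. Qed.
Lemma regv_sub U V s : regv U d s -> osub V U -> regv V d s.
Proof. by move=> rA h i; exact: (reg_sub (rA i)). Qed.
Lemma regv_local U s :
  (forall x, U x -> exists2 V : opn, V x & regv V d s) -> regv U d s.
Proof. by move=> H j; apply: reg_local => x /H [V Vx rV]; exists V. Qed.

Lemma regmxD U A B : regmx U d e A -> regmx U d e B -> regmx U d e (fun x => A x + B x).
Proof.
move=> rA rB i j; apply: (reg_ext (regD (rA i j) (rB i j))) => x _.
by rewrite mxE.
Qed.
Lemma regmxN U A : regmx U d e A -> regmx U d e (fun x => - A x).
Proof. by move=> rA i j; apply: (reg_ext (regN (rA i j))) => x _; rewrite mxE. Qed.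
Lemma regvD U s s' : regv U d s -> regv U d s' -> regv U d (fun x => s x + s' x).
Proof. by move=> rA rB i; apply: (reg_ext (regD (rA i) (rB i))) => x _; rewrite mxE. Qed.
Lemma regvZ U a s : reg U 0 a -> regv U d s -> regv U d (fun x => a x *: s x).
Proof.
by move=> ra rs i; apply: (reg_ext (regM (add0r _) ra (rs i))) => x _; rewrite mxE.
Qed.
Lemma regv0 U : regv U d (fun=> 0).
Proof. by move=> i; apply: (reg_ext (reg0 _ _)) => x _; rewrite mxE. Qed.
Lemma regmxM U A B : regmx U d e A -> regmx U e f B -> regmx U d f (fun x => A x *m B x).
Proof.
move=> rA rB i j.
apply: (@reg_ext _ _ (fun x => \sum_l A x i l * B x l j)) => [|x _]; last by rewrite mxE.
by apply: reg_sum => l _; apply: (regM _ (rA i l) (rB l j)); lia.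
Qed.
Lemma regvM U s A : regv U d s -> regmx U d e A -> regv U e (fun x => s x *m A x).
Proof.
move=> rA rB j.
apply: (@reg_ext _ _ (fun x => \sum_l s x ord0 l * A x l j)) => [|x _]; last by rewrite mxE.
by apply: reg_sum => l _; apply: (regM _ (rA l) (rB l j)); lia.
Qed.
Lemma regmx0 U : regmx U d e (fun=> 0).
Proof. by move=> i j; apply: (reg_ext (reg0 _ _)) => x _; rewrite mxE. Qed.
Lemma regmx1 U : regmx U d d (fun=> 1%:M).
Proof.
move=> i j; case: (eqVneq i j) => [->|ij].
  by rewrite subrr; apply: (reg_ext (reg_cst U 1)) => x _; rewrite mxE eqxx.
by apply: (reg_ext (reg0 _ _)) => x _; rewrite mxE (negPf ij).
Qed.
Lemma regmx_cst U (A : 'M_(p, q)) : regmx U (fun=> 0) (fun=> 0) (fun=> A).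
Proof. by move=> i j; rewrite subr0; exact: reg_cst. Qed.

End RegularMatrices.

Definition catd p q (d : 'I_p -> int) (e : 'I_q -> int) (j : 'I_(p + q)) : int :=
  match fintype.split j with inl i => d i | inr i => e i end.

Lemma regmx_row U p q m (d : 'I_p -> int) (e : 'I_q -> int) (f : 'I_m -> int) A B :
  regmx U d e A -> regmx U d f B -> regmx U d (catd e f) (fun x => row_mx (A x) (B x)).
Proof.
move=> rA rB i j; rewrite /catd -[j](splitK); case: (fintype.split j) => l.
  by rewrite unsplitK; apply: (reg_ext (rA i l)) => x _; rewrite row_mxEl.
by rewrite unsplitK; apply: (reg_ext (rB i l)) => x _; rewrite row_mxEr.
Qed.

Lemma regmx_col U p q m (d : 'I_p -> int) (e : 'I_q -> int) (f : 'I_m -> int) A B :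
  regmx U e d A -> regmx U f d B -> regmx U (catd e f) d (fun x => col_mx (A x) (B x)).
Proof.
move=> rA rB j i; rewrite /catd -[j](splitK); case: (fintype.split j) => l.
  by rewrite unsplitK; apply: (reg_ext (rA l i)) => x _; rewrite col_mxEu.
by rewrite unsplitK; apply: (reg_ext (rB l i)) => x _; rewrite col_mxEd.
Qed.

Definition deg0 p : 'I_p -> int := fun=> 0.

Lemma reg_det U p (A : pt -> 'M[k]_p) : regmx U (@deg0 p) (@deg0 p) A ->
  reg U 0 (fun x => \det (A x)).
Proof.
move=> rA; rewrite /determinant; apply: reg_sum => s _.
apply: (regM (addr0 0) (reg_cst U _)); apply: reg_prod0 => i.
by rewrite -[0](subr0 (0 : int)); exact: rA.
Qed.

Lemma regmx_adj U p (A : pt -> 'M[k]_p) : regmx U (@deg0 p) (@deg0 p) A ->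
  regmx U (@deg0 p) (@deg0 p) (fun x => \adj (A x)).
Proof.
move=> rA i j; rewrite subr0.
apply: (@reg_ext _ _ (fun x => cofactor (A x) j i)) => [|x _]; last by rewrite mxE.
rewrite /cofactor; apply: (regM (addr0 0) (reg_cst U _)).
apply: reg_det => i' j'; rewrite subr0.
have := rA (lift j i') (lift i j'); rewrite subr0 => r; apply: (reg_ext r) => x _.
by rewrite !mxE.
Qed.

(** The determinant is regular of degree 0 and equals 1 at [x], so it is invertible nearby; the
    inverse is the adjugate divided by it. *)
Lemma regmx_inv U x p (A : pt -> 'M[k]_p) : regmx U (@deg0 p) (@deg0 p) A ->
  U x -> A x = 1%:M ->
  exists V : opn, [/\ V x, osub V U, forall y, V y -> A y \in unitmx &
    regmx V (@deg0 p) (@deg0 p) (fun x => invmx (A x))].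
Proof.
move=> rA Ux A1.
have [|V [Vx VU hV]] := reg_neq0 (reg_det rA) Ux; first by rewrite A1 det1 oner_neq0.
exists V; split=> // [y /hV h|]; first by rewrite unitmxE unitfE.
move=> i j; rewrite /deg0 subr0.
apply: (@reg_ext _ _ (fun y => (\det (A y))^-1 * \adj (A y) i j)) => [|y /hV h]; last first.
  by rewrite /invmx unitmxE unitfE h [in RHS]mxE.
apply: (regM (addr0 0)).
  by apply: regV => //; exact: (reg_sub (reg_det rA)).
by have := regmx_adj rA i j; rewrite subr0 => r; exact: (reg_sub r).
Qed.

End RegularFunctions.

(** * Local splittings *)

Section LocalSplitting.
Variables (k : closedFieldType) (n : nat).
Notation pt := 'rV[k]_n.+1.
Notation opn := (opn k n).
Notation chart := (@chart k n).
Notation deg0 := (@deg0 _).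

(** The trivialization of the sum of the O(d i) on the chart x_l <> 0: multiplying by it on either
    side reduces graded matrices to matrices of functions of degree 0. *)
Definition dgm p (l : 'I_n.+1) (d : 'I_p -> int) (x : pt) : 'M[k]_p :=
  diag_mx (\row_i x ord0 l ^ d i).

Lemma dgmK p l (d d' : 'I_p -> int) (x : pt) : (forall i, d i + d' i = 0) ->
  x ord0 l != 0 -> dgm l d x *m dgm l d' x = 1%:M.
Proof.
move=> e x0; rewrite /dgm mulmx_diag -diag_const_mx; congr diag_mx.
by apply/rowP => i; rewrite !mxE -expfzDr // e.
Qed.

Lemma regmx_dgm p l (d : 'I_p -> int) U : osub U (chart l) ->
  regmx U deg0 d (dgm l d).
Proof.
move=> h i j; rewrite subr0; case: (eqVneq i j) => [->|ij].
  by apply: (reg_ext (reg_coordX (d j) h)) => x _; rewrite !mxE eqxx mulr1n.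
by apply: (reg_ext (reg0 _ _)) => x _; rewrite !mxE (negPf ij) mulr0n.
Qed.

Lemma regmx_dgmN p l (d : 'I_p -> int) U : osub U (chart l) ->
  regmx U d deg0 (dgm l (fun i => - d i)).
Proof.
move=> h i j; case: (eqVneq i j) => [->|ij].
  apply: (reg_ext (reg_coordX (deg0 j - d j) h)) => x _.
  by rewrite !mxE eqxx mulr1n sub0r.
by apply: (reg_ext (reg0 _ _)) => x _; rewrite !mxE (negPf ij) mulr0n.
Qed.

Lemma chart_neq0 (x : pt) : x != 0 -> exists l, x ord0 l != 0.
Proof.
move=> x0; apply/existsP; apply: contraNT x0; rewrite negb_exists => /forallP h.
by apply/eqP/rowP => l; rewrite mxE; apply/eqP; rewrite -[_ == _]negbK.
Qed.

(** A local regular generalized inverse. The idempotents [R B] and [B R] then split off kernel and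
    image, and a row [w] in the row space of [R] is the image of the regular row [w B]. *)
Definition lsplit p q (d : 'I_p -> int) (e : 'I_q -> int) (R : pt -> 'M[k]_(p, q)) :=
  forall x : pt, x != 0 -> exists (V : opn) (B : pt -> 'M[k]_(q, p)),
    [/\ V x, regmx V e d B & forall y, V y -> R y *m B y *m R y = R y].

(* A0 B0 A0 = A0 makes H := 1 + (A - A0) B0 map ker A into ker A0; when the ranks
   agree this is an isomorphism near the point and B0 H^-1 is a generalized inverse
   of A. *)
Lemma ginv_near (p q : nat) (A A0 : 'M[k]_(p, q)) (B0 : 'M_(q, p)) :
  let H := 1%:M + (A - A0) *m B0 in
  A0 *m B0 *m A0 = A0 -> \rank A = \rank A0 -> H \in unitmx ->
  A *m (B0 *m invmx H) *m A = A.
Proof.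
move=> H e rk uH.
have sub : (kermx A *m H <= kermx A0)%MS.
  apply/sub_kermxP; rewrite -mulmxA.
  have -> : H *m A0 = A0 + A *m B0 *m A0 - A0 *m B0 *m A0.
    by rewrite /H mulmxDl mul1mx !mulmxBl addrA.
  by rewrite e [A0 + _]addrC addrK !mulmxA mulmx_ker !mul0mx.
(* Equal ranks turn the inclusion [sub] into an equality, which can be inverted. *)
have sub' : (kermx A0 *m invmx H <= kermx A)%MS.
  have rkH : \rank (kermx A *m H) = \rank (kermx A0).
    by rewrite mxrankMfree ?row_free_unit // !mxrank_ker rk.
  have := mxrank_leqif_eq sub; rewrite rkH => -[_]; rewrite eqxx => /esym h.
  rewrite -[kermx A](mulmxK uH) submxMr //.
  by move: h; case/andP.
(* The rows of [1 - A0 B0] lie in ker A0, which [invmx H] carries into ker A. Replacing [1 - A0 B0]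
   by [H - A B0] then leaves A = A B0 H^-1 A. *)
have h0 : (1%:M - A0 *m B0) *m invmx H *m A = 0.
  apply/sub_kermxP; apply: submx_trans sub'; apply: submxMr.
  by apply/sub_kermxP; rewrite mulmxBl mul1mx e subrr.
have e1 : 1%:M - A0 *m B0 = H - A *m B0.
  by rewrite /H mulmxBl addrA addrAC addrK.
move: h0; rewrite e1 mulmxBl mulmxV // mulmxBl mul1mx => /eqP.
by rewrite subr_eq0 => /eqP {3}->; rewrite !mulmxA.
Qed.

Lemma ginvP (p q : nat) (A : 'M[k]_(p, q)) : A *m pinvmx A *m A = A.
Proof. by rewrite mulmxKpV. Qed.

(** On a chart the matrix becomes one of degree 0. The pseudo-inverse at the single point [x],
    corrected by the regular matrix [invmx (H y)], is a generalized inverse at all nearby points. *)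
Lemma const_rank_lsplit p q (d : 'I_p -> int) (e : 'I_q -> int)
    (R : pt -> 'M[k]_(p, q)) r :
  (forall U : opn, regmx U d e R) -> (forall x, x != 0 -> \rank (R x) = r) ->
  lsplit d e R.
Proof.
move=> rR rkR x x0; have [l xl] := chart_neq0 x0.
have hl : osub (chart l) (chart l) by [].
pose A y := dgm l d y *m R y *m dgm l (fun i => - e i) y.
have rA : regmx (chart l) deg0 deg0 A.
  exact: regmxM (regmxM (regmx_dgm d hl) (rR _)) (regmx_dgmN e hl).
have RE y : chart l y -> R y = dgm l (fun i => - d i) y *m A y *m dgm l e y.
  move=> yl; rewrite /A !mulmxA dgmK //; last by move=> i; rewrite addNr.
  by rewrite mul1mx -mulmxA dgmK ?mulmx1 // => i; rewrite addNr.
have rkA y : chart l y -> \rank (A y) = r.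
  move=> yl; rewrite -(rkR y (opn_neq0 yl)); apply/eqP; rewrite eqn_leq; apply/andP; split.
    by rewrite /A (leq_trans (mxrankM_maxl _ _)) // mxrankM_maxr.
  by rewrite RE // (leq_trans (mxrankM_maxl _ _)) // mxrankM_maxr.
pose B0 := pinvmx (A x); pose H y := 1%:M + (A y - A x) *m B0.
have rH : regmx (chart l) deg0 deg0 H.
  apply: (regmxD (@regmx1 _ _ _ deg0 _)); apply: (regmxM (e := deg0)).
    by apply: regmxD => //; exact: regmx_cst.
  exact: regmx_cst.
have [|V [Vx Vl uH rH']] := regmx_inv rH (xl : chart l x).
  by rewrite /H subrr mul0mx addr0.
exists V, (fun y => dgm l (fun i => - e i) y *m (B0 *m invmx (H y)) *m dgm l d y).
split=> // [|y Vy].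
  apply: (regmxM (e := deg0)); last exact: regmx_dgm.
  apply: (regmxM (e := deg0)); first exact: regmx_dgmN.
  by apply: (regmxM (e := deg0)) => //; exact: regmx_cst.
have yl := Vl _ Vy; rewrite RE //.
set D1 := dgm l (fun i => - d i) y; set D2 := dgm l e y.
have k1 : D2 *m dgm l (fun i => - e i) y = 1%:M by apply: dgmK => // i; rewrite addrN.
have k2 : dgm l d y *m D1 = 1%:M by apply: dgmK => // i; rewrite addrN.
have g : A y *m (B0 *m invmx (H y)) *m A y = A y.
  by apply: ginv_near; [exact: ginvP | rewrite rkA ?rkA | exact: uH].
move: (A y) (B0 *m invmx (H y)) g => Ay By g; rewrite -[in RHS]g !mulmxA.
rewrite -[_ *m D2 *m _]mulmxA k1 mulmx1.
by rewrite -[_ *m dgm l d y *m D1]mulmxA k2 mulmx1.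
Qed.

(** Both sides reduce to [A *m E], since [1 - E] kills [E] and [A] kills [1 - A]. *)
Lemma idem_conj p (A E : 'M[k]_p) : A *m A = A -> E *m E = E ->
  (A *m E + (1%:M - A) *m (1%:M - E)) *m E = A *m (A *m E + (1%:M - A) *m (1%:M - E)).
Proof.
move=> iA iE.
have z1 : (1%:M - E) *m E = 0 by rewrite mulmxBl mul1mx iE subrr.
have z2 : A *m (1%:M - A) = 0 by rewrite mulmxBr mulmx1 iA subrr.
by rewrite [in LHS]mulmxDl [in RHS]mulmxDr -!mulmxA iE z1 mulmx0 !mulmxA iA z2 mul0mx.
Qed.

(* H := E0 E + (1 - E0)(1 - E) conjugates the idempotent E into E0. *)
Lemma idem_split p (d : 'I_p -> int) (U : opn) (E : pt -> 'M[k]_p) x :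
  regmx U d d E -> (forall y, U y -> E y *m E y = E y) -> U x ->
  exists (V : opn) (r : nat) (F : pt -> 'M[k]_(r, p)) (G : pt -> 'M[k]_(p, r)),
    [/\ V x /\ osub V U, regmx V deg0 d F, regmx V d deg0 G &
        forall y, V y -> F y *m G y = 1%:M /\ G y *m F y = E y].
Proof.
move=> rE idE Ux; have [l xl] := chart_neq0 (opn_neq0 Ux).
pose W := ocap U (chart l); have Wl : osub W (chart l) by move=> y [].
have WU : osub W U by move=> y [].
pose A y := dgm l d y *m E y *m dgm l (fun i => - d i) y.
have rA : regmx W deg0 deg0 A.
  exact: regmxM (regmxM (regmx_dgm d Wl) (regmx_sub rE WU)) (regmx_dgmN d Wl).
have k1 y : W y -> dgm l (fun i => - d i) y *m dgm l d y = 1%:M.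
  by move=> /Wl yl; apply: dgmK => // i; rewrite addNr.
have k2 y : W y -> dgm l d y *m dgm l (fun i => - d i) y = 1%:M.
  by move=> /Wl yl; apply: dgmK => // i; rewrite addrN.
have EE y : W y -> E y = dgm l (fun i => - d i) y *m A y *m dgm l d y.
  move=> Wy; rewrite /A !mulmxA k1 // mul1mx -mulmxA k1 ?mulmx1 //.
have idA y : W y -> A y *m A y = A y.
  move=> Wy; rewrite /A !mulmxA -[_ *m _ *m dgm l d y]mulmxA k1 // mulmx1.
  by rewrite -[_ *m E y *m E y]mulmxA idE //; exact: WU.
have Wx : W x by [].
pose H y := A x *m A y + (1%:M - A x) *m (1%:M - A y).
have rc (C : 'M[k]_p) : regmx W deg0 deg0 (fun=> C) by exact: regmx_cst.
have rH : regmx W deg0 deg0 H.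
  apply: regmxD; apply: (regmxM (e := deg0)) => //.
  by apply: regmxD => //; exact: regmxN.
have idA' y : W y -> (1%:M - A y) *m (1%:M - A y) = 1%:M - A y.
  by move=> Wy; rewrite mulmxBl mul1mx mulmxBr mulmx1 idA // subrr subr0.
have [|V [Vx VW uH rH']] := regmx_inv rH Wx.
  by rewrite /H idA // idA' // addrC subrK.
have HA y : W y -> H y *m A y = A x *m H y.
  by move=> Wy; exact: idem_conj (idA x Wx) (idA y Wy).
clearbody H; clearbody A; pose R0 := row_base (A x); pose C0 := col_base (A x).
have CR : C0 *m R0 = A x by exact: mulmx_base.
(* Idempotence of [A x] reads C0 R0 C0 R0 = C0 R0, and the outer factors have full rank, so they
   cancel. *)
have RC : R0 *m C0 = 1%:M.
  apply: (row_free_inj (row_base_free (A x))).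
  apply: (row_full_inj (col_base_full (A x))).
  by rewrite -/C0 -/R0 mul1mx -mulmxA CR mulmxA CR idA.
exists V, (\rank (A x)), (fun y => R0 *m H y *m dgm l d y).
exists (fun y => dgm l (fun i => - d i) y *m (invmx (H y) *m C0)).
have Vl : osub V (chart l) by exact: sub_trans Wl.
split=> [|||y Vy].
- by split=> //; exact: sub_trans WU.
- apply: (regmxM (e := deg0)); last exact: regmx_dgm.
  apply: (regmxM (e := deg0)); first exact: regmx_cst.
  exact: regmx_sub rH VW.
- apply: (regmxM (e := deg0)); first exact: regmx_dgmN.
  by apply: (regmxM (e := deg0)) => //; exact: regmx_cst.
have Wy := VW _ Vy; clearbody C0 R0; split.
  rewrite -!mulmxA [dgm l d y *m _]mulmxA k2 // mul1mx [H y *m _]mulmxA.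
  by rewrite mulmxV ?uH // mul1mx.
have e : invmx (H y) *m (C0 *m R0 *m H y) = A y by rewrite CR -HA // mulKmx ?uH.
by rewrite EE // -e !mulmxA.
Qed.

End LocalSplitting.

(** * Sheaves defined by matrices *)

Section MatrixSheaves.
Variables (k : closedFieldType) (n : nat).
Notation pt := 'rV[k]_n.+1.
Notation opn := (opn k n).
Notation chart := (@chart k n).
Notation deg0 := (@deg0 _).
Notation sheaf := (sheaf k n).
Implicit Types (U V W : opn).

Definition ext U (T : zmodType) (f : pts U -> T) (x : pt) : T :=
  if pselect (U x) is left h then f (exist _ x h) else 0.

Lemma extE U (T : zmodType) (f : pts U -> T) (x : pts U) : ext f (sval x) = f x.
Proof.
rewrite /ext; case: pselect => [h|]; last by case: x.
by congr f; exact: pts_eq.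
Qed.

Lemma reg_extend U t (f : pts U -> k) : regular t f -> reg U t (ext f).
Proof.
move=> rf; split; have -> // : (fun x : pts U => ext f (sval x)) = f.
by apply/funext => x; rewrite extE.
Qed.

Section FunctionSheaf.
Variable p : nat.
Definition fns U : Type := pts U -> 'rV[k]_p.
HB.instance Definition _ U := GRing.Zmodule.on (fns U).
Definition fn_scale U (a : sring U) (s : fns U) : fns U := fun x => a x *: s x.
Fact fn_scaleA U (a b : sring U) s : fn_scale a (fn_scale b s) = fn_scale (a * b) s.
Proof. by apply/funext => x; rewrite /fn_scale scalerA. Qed.
Fact fn_scale1 U : left_id 1 (@fn_scale U).
Proof. by move=> s; apply/funext => x; rewrite /fn_scale scale1r. Qed.
Fact fn_scaleDr U : right_distributive (@fn_scale U) +%R.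
Proof. by move=> a s t; apply/funext => x; rewrite /fn_scale /= scalerDr. Qed.
Fact fn_scaleDl U (s : fns U) : {morph (@fn_scale U)^~ s : a b / a + b}.
Proof. by move=> a b; apply/funext => x; exact: scalerDl. Qed.
HB.instance Definition _ U := GRing.Zmodule_isLmodule.Build (sring U) (fns U)
  (@fn_scaleA U) (@fn_scale1 U) (@fn_scaleDr U) (@fn_scaleDl U).
Definition fn_sec U : lmodType (sring U) := fns U.
Definition fn_res U V (h : osub V U) (s : fn_sec U) : fn_sec V :=
  fun x => (s : fns U) (pres h x).
Fact fn_resD U V (h : osub V U) s t : fn_res h (s + t) = fn_res h s + fn_res h t.
Proof. by []. Qed.
Fact fn_resZ U V (h : osub V U) a s : fn_res h (a *: s) = rres h a *: fn_res h s.
Proof. by []. Qed.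
Fact fn_res_id U (h : osub U U) s : fn_res h s = s.
Proof. by apply/funext => x; congr s; exact: pts_eq. Qed.
Fact fn_res_comp U V W (h : osub V U) (h' : osub W V) (h'' : osub W U) s :
  fn_res h' (fn_res h s) = fn_res h'' s.
Proof. by apply/funext => x; congr s; exact: pts_eq. Qed.
Fact fn_sep (U : opn) (I : Type) (V : I -> opn) (h : forall i, osub (V i) U) :
  covers V U -> forall s t : fn_sec U,
  (forall i, fn_res (h i) s = fn_res (h i) t) -> s = t.
Proof.
move=> cV s t e; apply/funext => x; have [i Vx] := cV _ (svalP x).
have := congr1 (fun u : fns (V i) => u (exist _ (sval x) Vx)) (e i).
by rewrite /fn_res; congr (_ = _); [congr s | congr t]; exact: pts_eq.
Qed.
Fact fn_glue (U : opn) (I : Type) (V : I -> opn) (h : forall i, osub (V i) U) :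
  covers V U -> forall s : forall i, fn_sec (V i),
  (forall i j, fn_res (@capl _ _ (V i) (V j)) (s i) = fn_res (@capr _ _ (V i) (V j)) (s j)) ->
  exists t : fn_sec U, forall i, fn_res (h i) t = s i.
Proof.
move=> cV s e.
pose ix (x : pts U) : {i | V i (sval x)} := cid (cV _ (svalP x)).
exists (fun x : pts U => (s (sval (ix x)) : fns _) (exist _ (sval x) (svalP (ix x)))) => i.
apply/funext => -[x Vx]; rewrite /fn_res /=; case: (ix _) => j /= Vj.
have := congr1 (fun u : fns (ocap (V j) (V i)) => u (exist (ocap (V j) (V i)) x (conj Vj Vx))) (e j i).
by rewrite /fn_res; congr (_ = _); [congr (s j _) | congr (s i _)]; exact: pts_eq.
Qed.
(** The ambient sheaf: no regularity is asked, so it also receives cokernels embedded by matrices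
    that do not vary regularly. *)
Definition Fn : sheaf := Sheaf fn_resD fn_resZ fn_res_id fn_res_comp fn_sep fn_glue.

Lemma fn_sumE U (I : Type) (r : seq I) (P : pred I) (F : I -> sec Fn U) (x : pts U) :
  (\sum_(i <- r | P i) F i : fns U) x = \sum_(i <- r | P i) (F i : fns U) x.
Proof. by rewrite (big_morph (fun s : fns U => s x) (id1 := 0) (op1 := +%R)). Qed.
End FunctionSheaf.

Section GeneralMorphisms.
Variables (F G : sheaf).

Fact zerohL U (a : sring U) (s t : sec F U) : (0 : sec G U) = a *: 0 + 0.
Proof. by rewrite scaler0 addr0. Qed.
Fact zeroh_res U V (h : osub V U) (s : sec F U) : (0 : sec G V) = res h 0.
Proof. by rewrite res0. Qed.
Definition zeroh : shom F G := Defs.Hom (app := fun U _ => 0) zerohL zeroh_res.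

Variable S : subsheaf F.
Fact ss_inclL U (a : sring U) (s t : sec (sheaf_of S) U) :
  ss_val (a *: s + t) = a *: ss_val s + ss_val t.
Proof. by []. Qed.
Fact ss_incl_res U V (h : osub V U) (s : sec (sheaf_of S) U) :
  ss_val (res h s) = res h (ss_val s).
Proof. by []. Qed.
Definition ss_incl : shom (sheaf_of S) F := Defs.Hom ss_inclL ss_incl_res.

Variables (f : shom G F) (fS : forall U s, smem S (f U s)).
Fact ss_liftL U (a : sring U) s t :
  mkss (fS (a *: s + t)) = a *: mkss (fS s) + mkss (fS t) :> sec (sheaf_of S) U.
Proof. by apply: ss_eq; exact: appL. Qed.
Fact ss_lift_res U V (h : osub V U) s :
  mkss (fS (res h s)) = res h (mkss (fS s) : sec (sheaf_of S) U).
Proof. by apply: ss_eq; exact: app_res. Qed.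
Definition ss_lift : shom G (sheaf_of S) := Defs.Hom ss_liftL ss_lift_res.
End GeneralMorphisms.

Lemma app_sum F G (f : shom F G) U (I : Type) (r : seq I) (P : pred I) (s : I -> sec F U) :
  f U (\sum_(i <- r | P i) s i) = \sum_(i <- r | P i) f U (s i).
Proof. by rewrite (big_morph (f U) (id1 := 0) (op1 := +%R)) ?app0 // => x y; exact: appD. Qed.

Lemma app_inj F G (f : shom F G) : (forall U s, f U s = 0 -> s = 0) ->
  forall U, injective (f U).
Proof.
move=> f0 U s t e; apply/eqP; rewrite -subr_eq0; apply/eqP/f0.
by rewrite -scaleN1r addrC appL e scaleN1r addNr.
Qed.

(** Surjectivity gives preimages only locally; injectivity makes them agree on overlaps, so they
    glue, and it makes the resulting inverse linear and compatible with restriction. *)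
Lemma inj_surj_iso F G (f : shom F G) :
  (forall U s, f U s = 0 -> s = 0) -> surjective f -> is_iso f.
Proof.
move=> /app_inj f_inj f_surj.
have onto U (t : sec G U) : exists s, f U s = t.
  pose I := {V : opn | exists (h : osub V U) s, f V s = res h t}.
  pose h (i : I) : osub (sval i) U := projT1 (cid (svalP i)).
  have hs (i : I) : exists s, f _ s = res (h i) t := projT2 (cid (svalP i)).
  pose s (i : I) : sec F (sval i) := sval (cid (hs i)).
  have sE i : f _ (s i) = res (h i) t := svalP (cid (hs i)).
  have cov : covers (fun i : I => sval i) U.
    move=> x Ux; have [V [hV [Vx [s' es]]]] := f_surj U t x Ux.
    by exists (exist _ V (ex_intro _ hV (ex_intro _ s' es))).
  have [|s0 es0] := sheaf_glue h cov (s := s).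
    move=> i j; apply: f_inj; rewrite !app_res !sE.
    have hc : osub (ocap (sval i) (sval j)) U by move=> x [/(h i)].
    by rewrite !(res_comp _ _ hc).
  exists s0; apply: (@sheaf_sep _ _ G U I _ h cov) => i.
  by rewrite -app_res es0 sE.
pose g U t := sval (cid (onto U t)).
have gE U t : f U (g U t) = t := svalP (cid (onto U t)).
have gL U (a : sring U) s t : g U (a *: s + t) = a *: g U s + g U t.
  by apply: f_inj; rewrite appL !gE.
have g_res U V (h : osub V U) s : g V (res h s) = res h (g U s).
  by apply: f_inj; rewrite app_res !gE.
exists (Defs.Hom gL g_res); split=> U s /=; last exact: gE.
by apply: f_inj; rewrite gE.
Qed.

Lemma iso_sym (F G : sheaf) : isomorphic F G -> isomorphic G F.
Proof. by move=> [f [g [e e']]]; exists g, f. Qed.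

Lemma sexactI F G H (f : shom F G) (g : shom G H) :
  (forall U s, g U (f U s) = 0) -> (forall U s, g U s = 0 -> loc_image f s) -> sexact f g.
Proof.
move=> gf H1 U s; split; first exact: H1.
move=> im; apply: sheaf_eq_local => x /im [V [h [Vx [t e]]]].
by exists V, h; split=> //; rewrite -app_res -e gf res0.
Qed.

(* The image of the sum of the O(d i) under the pointwise linear map pi, which need
   not be regular: pi = 1 gives the sum itself, and the cokernel of a constant rank
   matrix A is obtained from any pi(x) whose kernel is the row space of A(x). *)
Section QuotientSheaf.
Variables (p p' : nat) (d : 'I_p -> int) (pi : pt -> 'M[k]_(p, p')).

Definition lm_mem U (s : sec (Fn p') U) : Prop :=
  forall x : pts U, exists (V : opn) (w : pt -> 'rV[k]_p),
    [/\ V (sval x), regv V d w &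
        forall y : pts U, V (sval y) -> (s : fns p' U) y = w (sval y) *m pi (sval y)].

Fact lm_mem0 U : @lm_mem U 0.
Proof.
move=> x; exists U, (fun=> 0); split; [exact: svalP | exact: regv0 |].
by move=> y _; rewrite mul0mx.
Qed.

Fact lm_mem_lin U (a : sring U) s t : @lm_mem U s -> @lm_mem U t -> @lm_mem U (a *: s + t).
Proof.
move=> Hs Ht x; have [V [w [Vx rw ew]]] := Hs x; have [V' [w' [Vx' rw' ew']]] := Ht x.
pose O := ocap U (ocap V V'); exists O, (fun y => ext a y *: w y + w' y); split.
- by split; [exact: svalP | split].
- apply: regvD; last by apply: regv_sub rw' _ => y [_ []].
  apply: regvZ; last by apply: regv_sub rw _ => y [_ []].
  by apply: (reg_sub (reg_extend (hregP a))) => y [].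
move=> y [_ [Vy Vy']].
by rewrite mulmxDl -scalemxAl -ew // -ew' // extE.
Qed.

Fact lm_mem_res U V (h : osub V U) s : @lm_mem U s -> lm_mem (res h s).
Proof.
move=> Hs x; have [W [w [Wx rw ew]]] := Hs (pres h x).
by exists W, w; split=> // y Wy; exact: (ew (pres h y)).
Qed.

Fact lm_mem_loc U (s : sec (Fn p') U) :
  (forall x, U x -> exists (V : opn) (h : osub V U), V x /\ lm_mem (res h s)) -> lm_mem s.
Proof.
move=> H x; have [V [h [Vx Hs]]] := H _ (svalP x).
have [W [w [Wx rw ew]]] := Hs (exist _ (sval x) Vx).
exists (ocap V W), w; split=> //; first by apply: (regv_sub rw) => y [].
move=> y [Vy Wy]; rewrite -(ew (exist _ (sval y) Vy)) //=.
by rewrite /fn_res; congr s; exact: pts_eq.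
Qed.

Definition lm_sub : subsheaf (Fn p') := Subsheaf lm_mem0 lm_mem_lin lm_mem_res lm_mem_loc.
Definition LM : sheaf := sheaf_of lm_sub.

Definition at_ U (s : sec LM U) (x : pts U) : 'rV[k]_p' := (ss_val s : fns p' U) x.

Lemma lm_eq U (s t : sec LM U) : (forall x, at_ s x = at_ t x) -> s = t.
Proof. by move=> e; apply: ss_eq; apply/funext. Qed.

Lemma lm_local U (s : sec LM U) (x : pts U) : exists (V : opn) (w : pt -> 'rV[k]_p),
    [/\ V (sval x), regv V d w &
        forall y : pts U, V (sval y) -> at_ s y = w (sval y) *m pi (sval y)].
Proof. exact: (ss_mem s). Qed.

Fact lm_mk_mem U (w : pt -> 'rV[k]_p) : regv U d w ->
  lm_mem (fun x : pts U => w (sval x) *m pi (sval x)).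
Proof. by move=> rw x; exists U, w; split=> //; exact: svalP. Qed.
Definition lm_mk U (w : pt -> 'rV[k]_p) (rw : regv U d w) : sec LM U :=
  mkss (S := lm_sub) (lm_mk_mem rw).
Lemma lm_mkE U (w : pt -> 'rV[k]_p) (rw : regv U d w) x :
  at_ (lm_mk rw) x = w (sval x) *m pi (sval x).
Proof. by []. Qed.

End QuotientSheaf.

Notation free d := (LM d (fun=> 1%:M)).

Section PointwiseMorphism.
Variables (p q : nat) (Th : pt -> 'M[k]_(p, q)).
Definition fn_fun U (s : sec (Fn p) U) : sec (Fn q) U :=
  (fun x => (s : fns p U) x *m Th (sval x)) : fns q U.
Fact fn_funL U (a : sring U) s t : fn_fun (a *: s + t) = a *: fn_fun s + fn_fun t.
Proof. by apply/funext => x; rewrite /fn_fun mulmxDl -scalemxAl. Qed.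
Fact fn_fun_res U V (h : osub V U) s : fn_fun (res h s) = res h (fn_fun s).
Proof. by []. Qed.
Definition fn_hom : shom (Fn p) (Fn q) := Defs.Hom fn_funL fn_fun_res.
End PointwiseMorphism.

Section QuotientMorphism.
Variables (p p' q q' : nat) (d : 'I_p -> int) (pi : pt -> 'M[k]_(p, p')).
Variables (e : 'I_q -> int) (pi' : pt -> 'M[k]_(q, q')).

(** [Th] acts on values and need not be regular, as [pi] and [pi'] need not be. The regular lift [N]
    to the covering sums is what keeps the transformed sections locally of the form [w *m pi']. *)
Definition lm_ok (Th : pt -> 'M[k]_(p', q')) : Prop :=
  exists N : pt -> 'M[k]_(p, q), (forall U, regmx U d e N) /\
    forall x, x != 0 -> pi x *m Th x = N x *m pi' x.

Variables (Th : pt -> 'M[k]_(p', q')) (ok : lm_ok Th).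

Fact lm_hom_mem U (s : sec (LM d pi) U) :
  smem (lm_sub e pi') (comph (fn_hom Th) (ss_incl (lm_sub d pi)) U s).
Proof.
have [N [rN eN]] := ok.
move=> x; have [V [w [Vx rw ew]]] := lm_local s x.
exists V, (fun y => w y *m N y); split=> //; first exact: regvM rw (rN V).
move=> y Vy; rewrite /= /fn_fun -/(at_ s y) ew // -!mulmxA eN //.
exact: opn_neq0 (svalP y).
Qed.
Definition lm_hom : shom (LM d pi) (LM e pi') := ss_lift lm_hom_mem.

Lemma lm_homE U (s : sec (LM d pi) U) x : at_ (lm_hom U s) x = at_ s x *m Th (sval x).
Proof. by []. Qed.
End QuotientMorphism.

(** The criterion behind every exactness proof below. The rows of [R] span, at each point, the
    representatives of the kernel of [g], and [Y] writes the classes of these rows as images under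
    [Th]. What remains to be checked is linear algebra at one point. *)
Lemma lm_exact (p p' q q' m : nat) (d : 'I_p -> int) (pi : pt -> 'M[k]_(p, p'))
    (e : 'I_q -> int) (pi' : pt -> 'M[k]_(q, q')) (Th : pt -> 'M[k]_(p', q'))
    (ok : lm_ok d pi e pi' Th) (H : sheaf) (g : shom (LM e pi') H)
    (c : 'I_m -> int) (R : pt -> 'M[k]_(m, q)) (Y : pt -> 'M[k]_(m, p)) :
  (forall U, regmx U c d Y) -> lsplit c e R ->
  (forall x, x != 0 -> R x *m pi' x = Y x *m pi x *m Th x) ->
  (forall U s, g U (lm_hom ok U s) = 0) ->
  (forall U s, g U s = 0 -> forall (x : pts U) (w : 'rV_q),
     at_ s x = w *m pi' (sval x) -> (w <= R (sval x))%MS) ->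
  sexact (lm_hom ok) g.
Proof.
move=> rY sR eR gf Hg; apply: sexactI gf _ => U s gs x Ux.
have [V [w [Vx rw ew]]] := lm_local s (exist _ x Ux).
have [W [B [Wx rB eB]]] := sR x (opn_neq0 Ux).
pose O := ocap U (ocap V W).
have OU : osub O U by move=> y [].
(* From w = u R follows w B R = u R B R = w, and R pi' = Y pi Th then makes [w B Y] represent a
   preimage. *)
have rO : regv O d (fun y => w y *m B y *m Y y).
  apply: regvM (rY O); apply: (regvM (d := e)).
    by apply: (regv_sub rw) => y [_ []].
  by apply: (regmx_sub rB) => y [_ []].
exists O, OU; split; first by [].
exists (lm_mk pi rO); apply: lm_eq => y; rewrite lm_homE lm_mkE.
have [Uy [Vy Wy]] := svalP y; have y0 := opn_neq0 Uy.
have ey : at_ s (pres OU y) = w (sval y) *m pi' (sval y) by exact: ew.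
rewrite -[RHS]/(at_ s (pres OU y)) ey -!mulmxA [Y _ *m _]mulmxA -eR //.
have /submxP [u ->] := Hg _ _ gs _ _ ey.
by change (sval (pres OU y)) with (sval y); rewrite -[in RHS](eB _ Wy) !mulmxA.
Qed.

(** Independence of the frame at every point makes the coefficients unique as functions, so only the
    existence of regular coefficients has to be supplied. *)
Lemma vbundle_frames (F : sheaf) p (eta : shom F (Fn p)) :
  (forall U s, eta U s = 0 -> s = 0) ->
  (forall x : pt, x != 0 -> exists (V : opn) (r : nat) (e : 'I_r -> sec F V)
     (Fr : pt -> 'M[k]_(r, p)),
     [/\ V x, forall (y : pts V) i, (eta V (e i) : fns p V) y = row i (Fr (sval y)),
         forall y, V y -> forall c : 'rV_r, c *m Fr y = 0 -> c = 0 &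
         forall W (h : osub W V) (s : sec F W), exists c : pt -> 'rV_r,
           regv W deg0 c /\
           forall y : pts W, (eta W s : fns p W) y = c (sval y) *m Fr (sval y)]) ->
  vbundle F.
Proof.
move=> eta0 H x x0; have [V [r [e [Fr [Vx eE Fr0 Hs]]]]] := H x x0.
have comb W (h : osub W V) (c : {ffun 'I_r -> sring W}) (y : pts W) :
    (eta W (\sum_i c i *: res h (e i)) : fns p W) y =
    (\row_i c i y) *m Fr (sval y).
  rewrite app_sum fn_sumE mulmx_sum_row; apply: eq_bigr => i _.
  rewrite appZ app_res mxE -[RHS]/(c i y *: _); congr (_ *: _).
  by rewrite -(eE (pres h y) i).
exists V, r, e; split=> // W h s; have [c [rc ec]] := Hs W h s.
have rc' i : regular 0 (fun y : pts W => c (sval y) ord0 i) by case: (rc i).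
pose c' : {ffun 'I_r -> sring W} := [ffun i => mkreg (rc' i)].
have c'E y : \row_i c' i y = c (sval y) by apply/rowP => i; rewrite mxE ffunE.
exists c'; split.
  by apply: (app_inj eta0); apply/funext => y; rewrite comb ec c'E.
move=> c2 e2; apply/ffunP => i; apply: hreg_eq => y.
have : (\row_i c' i y) - (\row_i c2 i y) = 0.
  by apply: (Fr0 _ (h _ (svalP y))); rewrite mulmxBl c'E -comb -e2 -ec subrr.
by move/rowP/(_ i)/eqP; rewrite !mxE subr_eq0 => /eqP.
Qed.

(* The quotient sheaf is framed by splitting the idempotent 1 - B A. *)
Lemma LM_vbundle (p p' m : nat) (d : 'I_p -> int) (pi : pt -> 'M[k]_(p, p'))
    (c : 'I_m -> int) (A : pt -> 'M[k]_(m, p)) :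
  (forall U, regmx U c d A) -> lsplit c d A ->
  (forall x, x != 0 -> forall w : 'rV_p, (w *m pi x = 0 <-> (w <= A x)%MS)) ->
  vbundle (LM d pi).
Proof.
move=> rA sA kpi; apply: (@vbundle_frames _ _ (ss_incl (lm_sub d pi))) => [U s e|x x0].
  exact: ss_eq.
have [V [B [Vx rB eB]]] := sA x x0.
pose E y := 1%:M - B y *m A y.
have rE : regmx V d d E.
  by apply: regmxD; [exact: regmx1 | apply: regmxN; apply: regmxM rB (rA V)].
have BAB y : V y -> (B y *m A y) *m (B y *m A y) = B y *m A y.
  by move=> Vy; rewrite -mulmxA [A y *m _]mulmxA eB.
have idE y : V y -> E y *m E y = E y.
  by move=> Vy; rewrite /E mulmxBl mul1mx mulmxBr mulmx1 BAB // subrr subr0.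
have [W [r [F [G [[Wx WV] rF rG FG]]]]] := idem_split rE idE Vx.
have AG y : W y -> A y *m G y = 0.
  move=> Wy; have [f1 f2] := FG _ Wy.
  have -> : G y = E y *m G y by rewrite -f2 -mulmxA f1 mulmx1.
  by rewrite mulmxA /E mulmxBr mulmx1 mulmxA eB ?subrr ?mul0mx //; exact: WV.
have kG y (w : 'rV_p) : W y -> w *m pi y = 0 -> w *m G y = 0.
  move=> Wy /(kpi _ (opn_neq0 Wy)) /submxP [u ->].
  by rewrite -mulmxA AG // mulmx0.
have Api y : W y -> A y *m pi y = 0.
  move=> Wy; apply/row_matrixP => i; rewrite row_mul row0.
  by apply/(kpi _ (opn_neq0 Wy)); exact: row_sub.
have rFi i : regv W d (fun y => row i (F y)).
  by move=> j; apply: (reg_ext (eq_ind _ (fun t => reg W t _) (rF i j) _ (subr0 _))) => y _; rewrite mxE.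
exists W, r, (fun i => lm_mk pi (rFi i)), (fun y => F y *m pi y); split=> //.
- by move=> y i; rewrite row_mul.
- move=> y Wy v; rewrite mulmxA => /(kG _ _ Wy).
  by rewrite -mulmxA; have [-> _] := FG _ Wy; rewrite mulmx1.
(* The pseudo-inverse picks a representative that need not vary regularly. Since [G] kills the
   kernel of [pi], the product agrees with [w *m G] for any regular local representative [w]. *)
move=> O h s; exists (fun y => ext (at_ s) y *m pinvmx (pi y) *m G y).
have loc (y : pts O) : exists (Z : opn) (w : pt -> 'rV[k]_p), [/\ Z (sval y), regv Z d w,
    forall z : pts O, Z (sval z) -> at_ s z = w (sval z) *m pi (sval z) &
    forall z : pts O, Z (sval z) ->
      at_ s z *m pinvmx (pi (sval z)) *m G (sval z) = w (sval z) *m G (sval z)].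
  have [Z [w [Zy rw ew]]] := lm_local s y; exists Z, w; split=> // z Zz.
  apply/eqP; rewrite -subr_eq0 -mulmxBl; apply/eqP; apply: kG (h _ (svalP z)) _.
  by rewrite mulmxBl ew // mulmxKpV ?submxMl // subrr.
split.
  apply: regv_local => y Oy; have [Z [w [Zy rw _ ew]]] := loc (exist _ y Oy).
  exists (ocap O Z) => //.
  apply: (@regv_ext _ _ _ _ _ (fun z => w z *m G z)) => [|z [Oz Zz]].
    apply: (regvM (d := d)); first by apply: (regv_sub rw) => z [].
    by apply: (regmx_sub rG) => z [/h].
  by rewrite (extE (at_ s) (exist _ z Oz)) -(ew (exist _ z Oz)).
move=> y; have [Z [w [Zy rw e1 e2]]] := loc y; rewrite extE e2 // -[LHS]/(at_ s y) e1 //.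
have Wy := h _ (svalP y); have [_ e3] := FG _ Wy.
by rewrite mulmxA -[w _ *m _ *m _]mulmxA e3 /E mulmxBr mulmx1 mulmxBl -!mulmxA Api // !mulmx0 subr0.
Qed.

Lemma free_vbundle p (d : 'I_p -> int) : vbundle (free d).
Proof.
apply: (@LM_vbundle _ _ 0 d _ (fun=> 0) (fun=> 0)) => [U|x x0|x x0 w].
- exact: regmx0.
- by exists (otop k n), (fun=> 0); split=> [//||y _]; [exact: regmx0 | rewrite mulmx0].
by rewrite mulmx1; split=> [->|/submx0null //]; exact: sub0mx.
Qed.

(* The kernel is framed by splitting the idempotent 1 - A B. *)
Lemma ker_vbundle (p m : nat) (d : 'I_p -> int) (c : 'I_m -> int)
    (A : pt -> 'M[k]_(p, m)) (H : sheaf) (f : shom (free d) H) :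
  (forall U, regmx U d c A) -> lsplit d c A ->
  (forall U s, f U s = 0 <-> forall x : pts U, at_ s x *m A (sval x) = 0) ->
  vbundle (ker f).
Proof.
move=> rA sA kf.
apply: (@vbundle_frames _ _ (comph (ss_incl (lm_sub d _)) (ss_incl (ker_sub f)))).
  by move=> U s e; do 2!apply: ss_eq.
move=> x x0; have [V [B [Vx rB eB]]] := sA x x0.
pose E y := 1%:M - A y *m B y.
have rE : regmx V d d E.
  by apply: regmxD; [exact: regmx1 | apply: regmxN; apply: regmxM (rA V) rB].
have ABA y : V y -> (A y *m B y) *m (A y *m B y) = A y *m B y.
  by move=> Vy; rewrite mulmxA eB.
have idE y : V y -> E y *m E y = E y.
  by move=> Vy; rewrite /E mulmxBl mul1mx mulmxBr mulmx1 ABA // subrr subr0.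
have [W [r [F [G [[Wx WV] rF rG FG]]]]] := idem_split rE idE Vx.
have FA y : W y -> F y *m A y = 0.
  move=> Wy; have [f1 f2] := FG _ Wy.
  have -> : F y = F y *m E y by rewrite -f2 mulmxA f1 mul1mx.
  by rewrite -mulmxA /E mulmxBl mul1mx eB ?subrr ?mulmx0 //; exact: WV.
have rFi i : regv W d (fun y => row i (F y)).
  by move=> j; apply: (reg_ext (eq_ind _ (fun t => reg W t _) (rF i j) _ (subr0 _))) => y _; rewrite mxE.
have kFi i : f W (lm_mk _ (rFi i)) = 0.
  by apply/kf => y; rewrite lm_mkE mulmx1 -row_mul FA ?row0 //; exact: svalP.
exists W, r, (fun i => mkss (S := ker_sub f) (kFi i)), F; split=> //.
- by move=> y i; rewrite -[LHS]/(_ *m _) mulmx1.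
- by move=> y Wy v e; have [f1 _] := FG _ Wy; rewrite -[v]mulmx1 -f1 mulmxA e mul0mx.
move=> O h s; pose s' := ss_val s; exists (fun y => ext (at_ s') y *m G y); split.
  apply: regv_local => y Oy; have [Z [w [Zy rw ew]]] := lm_local s' (exist _ y Oy).
  exists (ocap O Z) => //.
  apply: (@regv_ext _ _ _ _ _ (fun z => w z *m G z)) => [|z [Oz Zz]].
    apply: (regvM (d := d)); first by apply: (regv_sub rw) => z [].
    by apply: (regmx_sub rG) => z [/h].
  by rewrite (extE (at_ s') (exist _ z Oz)) ew // mulmx1.
move=> y; rewrite extE -[LHS]/(at_ s' y).
have [_ e3] := FG _ (h _ (svalP y)).
rewrite -mulmxA e3 /E mulmxBr mulmx1 mulmxA.
by have /kf/(_ y) -> : f O s' = 0 by [exact: (ss_mem s)]; rewrite mul0mx subr0.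
Qed.

Section FreeSum.
Variables (t : int) (p : nat).
Fact free_of_sum_mem U (s : sec (fsum (OO k n t) p) U) :
  smem (lm_sub (fun=> t) (fun=> 1%:M))
    ((fun x => \row_j (s : {ffun 'I_p -> hreg t U}) j x) : sec (Fn p) U).
Proof.
move=> x; exists U, (fun y => \row_j ext ((s : {ffun 'I_p -> hreg t U}) j) y); split.
- exact: svalP.
- by move=> j; apply: (reg_ext (reg_extend (hregP _))) => y _; rewrite mxE.
by move=> y _; rewrite mulmx1; apply/rowP => j; rewrite !mxE extE.
Qed.
Definition free_of_sum_fun U (s : sec (fsum (OO k n t) p) U) : sec (free (fun=> t)) U :=
  mkss (free_of_sum_mem s).
Fact free_of_sumL U (a : sring U) s s' :
  free_of_sum_fun (a *: s + s') = a *: free_of_sum_fun s + free_of_sum_fun s'.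
Proof. by apply: lm_eq => x; apply/rowP => j; rewrite !mxE !ffunE. Qed.
Fact free_of_sum_res U V (h : osub V U) s : free_of_sum_fun (res h s) = res h (free_of_sum_fun s).
Proof. by apply: lm_eq => x; apply/rowP => j; rewrite !mxE !ffunE. Qed.
Definition free_of_sum : shom (fsum (OO k n t) p) (free (fun=> t)) :=
  Defs.Hom free_of_sumL free_of_sum_res.

Lemma free_of_sumE U s x :
  at_ (free_of_sum U s) x = \row_j (s : {ffun 'I_p -> hreg t U}) j x.
Proof. by []. Qed.

Lemma free_of_sum_iso : is_iso free_of_sum.
Proof.
apply: inj_surj_iso => [U s e|U s x Ux].
  apply/ffunP => j; apply: hreg_eq => x; rewrite ffunE.
  have : at_ (free_of_sum U s) x = 0 by rewrite e.
  by rewrite free_of_sumE => /rowP/(_ j); rewrite !mxE.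
have [V [w [Vx rw ew]]] := lm_local s (exist _ x Ux).
pose O := ocap U V; have OU : osub O U by move=> y [].
have rO j : regular t (fun y : pts O => w (sval y) ord0 j).
  by have /reg_sub r := rw j; case: (r O) => // y [].
exists O, OU; split=> //; exists ([ffun j => mkreg (rO j)] : {ffun 'I_p -> hreg t O}).
apply: lm_eq => y; rewrite free_of_sumE.
have e : at_ s (pres OU y) = w (sval y) by rewrite ew ?mulmx1 //; case: (svalP y).
rewrite -[RHS]/(at_ s (pres OU y)) e.
by apply/rowP => j; rewrite mxE ffunE.
Qed.
End FreeSum.

End MatrixSheaves.

(** * Twists and complexes *)

Section Twisting.
Variables (k : closedFieldType) (n : nat).
Notation pt := 'rV[k]_n.+1.
Notation opn := (opn k n).
Notation chart := (@chart k n).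
Notation sheaf := (sheaf k n).
Implicit Types (U V W : opn) (F G H : sheaf).

Lemma comph_iso F G H (g : shom G H) (f : shom F G) : is_iso f -> is_iso g -> is_iso (comph g f).
Proof.
move=> [f' [ff' f'f]] [g' [gg' g'g]]; exists (comph f' g'); split=> U s /=.
  by have /= -> := gg' U (f U s); exact: ff'.
by have /= -> := f'f U (g' U s); exact: g'g.
Qed.

Lemma twist_hom_iso F G (f : shom F G) t : is_iso f -> is_iso (twist_hom f t).
Proof.
move=> [g [e e']]; exists (twist_hom g t).
by split=> U s; apply: tw_eq => l; [exact: e | exact: e'].
Qed.

Lemma comph_surj F G H (g : shom G H) (f : shom F G) :
  surjective f -> surjective g -> surjective (comph g f).
Proof.
move=> sf sg U s x Ux; have [V [h [Vx [t et]]]] := sg U s x Ux.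
have [W [h' [Wx [t' et']]]] := sf V t x Vx.
exists W, (sub_trans h' h); split=> //; exists t'.
by rewrite /= et' app_res et (res_comp _ _ (sub_trans h' h)).
Qed.

Lemma sexact_surj F G H (f : shom F G) (g : shom G H) :
  sexact f g -> is_zeroh g -> surjective f.
Proof. by move=> ex g0 U s; apply/ex. Qed.

Lemma iso_surj F G (f : shom F G) : is_iso f -> surjective f.
Proof.
move=> [g [_ e]] U s x Ux; exists U, (@Defs.sub_refl _ _ U); split=> //; exists (g U s).
by rewrite res_id; exact: e.
Qed.

Lemma iso_inj F G (f : shom F G) : is_iso f -> forall U s, f U s = 0 -> s = 0.
Proof.
by move=> [g [e _]] U s fs; have /= := e U s; rewrite fs app0 => <-.
Qed.

Section KernelLift.
Variables (F G H : sheaf) (f : shom F G) (g : shom G H) (gf : forall U s, g U (f U s) = 0).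
Definition ker_lift : shom F (ker g) := @ss_lift _ _ _ _ (ker_sub g) f gf.
Lemma ker_lift_iso : sexact f g -> (forall U s, f U s = 0 -> s = 0) -> is_iso ker_lift.
Proof.
move=> ex f0; apply: inj_surj_iso => [U s e|U s x Ux].
  by apply: f0; exact: (congr1 (@ss_val _ _ _ _ _) e).
have [V [h [Vx [t et]]]] := (ex U (ss_val s)).1 (ss_mem s) x Ux.
by exists V, h; split=> //; exists t; apply: ss_eq.
Qed.
End KernelLift.

Section KernelInclusion.
Variables (F G : sheaf) (f : shom F G).
Definition ker_incl : shom (ker f) F := ss_incl (ker_sub f).
Lemma ker_incl_inj U (s : sec (ker f) U) : ker_incl U s = 0 -> s = 0.
Proof. by move=> e; apply: ss_eq. Qed.
Lemma ker_incl_exact : sexact ker_incl f.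
Proof.
apply: sexactI => [U s|U s fs x Ux]; first exact: (ss_mem s).
exists U, (@Defs.sub_refl _ _ U); split=> //; exists (mkss (S := ker_sub f) fs).
by rewrite res_id.
Qed.
End KernelInclusion.

Lemma ratio0 (U : opn) l m t : t = 0 -> Defs.ratio (k := k) U l m t = 1.
Proof. by move=> ->; apply: hreg_eq => x /=; rewrite !mulrfctE oppr0 !expr0z mulr1. Qed.

Section TwistByZero.
Variables (F : sheaf) (t : int) (t0 : t = 0).
Fact untw_cocycle U (s : sec F U) :
  @cocycle _ _ F t U (fun l => res (@capl _ _ U (chart l)) s).
Proof.
move=> l m; rewrite ratio0 // scale1r.
have h : osub (overlap U l m) U by move=> x [].
by rewrite !(res_comp _ _ h).
Qed.
Definition untw_fun U (s : sec F U) : sec (twist F t) U := Tw (untw_cocycle s).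
Fact untwL U (a : sring U) s s' : untw_fun (a *: s + s') = a *: untw_fun s + untw_fun s'.
Proof. by apply: tw_eq => l; rewrite /= resD resZ. Qed.
Fact untw_res U V (h : osub V U) s : untw_fun (res h s) = res h (untw_fun s).
Proof.
apply: tw_eq => l /=.
have h' : osub (ocap V (chart l)) U by move=> x [/h].
by rewrite !(res_comp _ _ h').
Qed.
(** The construction takes [j = 0], but the target of the morphism of complexes is still a twist, by
    [- 0], whose sections are families over the charts. The variable [t] with [t = 0] lets the
    comparison apply to it. *)
Definition untw : shom F (twist F t) := Defs.Hom untwL untw_res.

Lemma untw_iso : is_iso untw.
Proof.
apply: inj_surj_iso => [U s e|U s x Ux].
  apply: sheaf_eq_local => x Ux; have [l xl] := chart_neq0 (opn_neq0 Ux).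
  exists (ocap U (chart l)), (@capl _ _ U (chart l)); split=> //.
  by rewrite res0; exact: (congr1 (fun u : tw_type F t U => u l) e).
have [l xl] := chart_neq0 (opn_neq0 Ux).
pose V := ocap U (chart l); exists V, (@capl _ _ U (chart l)); split=> //.
(* All gluing factors are 1, so over chart [l] the component [s l] determines the others. *)
exists ((s : tw_type F t U) l); apply: tw_eq => m /=.
have h : osub (ocap V (chart m)) (overlap U l m) by move=> y [[? ?] ?].
have := congr1 (res h) (twP s l m); rewrite ratio0 // scale1r.
rewrite (res_comp _ _ (@capl _ _ V (chart m))) => ->.
by rewrite (res_comp _ _ (capl_mono (V := chart m) (@capl _ _ U (chart l)))).
Qed.
End TwistByZero.

Section TwistOfSum.
Variables (t u v : int) (e : v - u = t) (p : nat).
Notation A := (fsum (OO k n t) p).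
Let e' : t + u = v. Proof. by rewrite -e subrK. Qed.
Definition tau_sec U (s : sec (fsum (OO k n v) p) U) l : sec A (ocap U (chart l)) :=
  [ffun j => hmul e (hres (@capl _ _ U (chart l)) ((s : {ffun 'I_p -> hreg v U}) j))
                    (coordX (- u) (@capr _ _ U (chart l)))].
Fact tau_cocycle U s : @cocycle _ _ A u U (@tau_sec U s).
Proof.
move=> l m; apply/ffunP => j; rewrite !ffunE; apply: hreg_eq => x /=.
rewrite !mulrfctE /= /pres /=.
have xl : sval x ord0 l != 0 := overlap_l (svalP x).
have xm : sval x ord0 m != 0 := overlap_r (svalP x).
rewrite [RHS]mulrC -mulrA; congr (_ * _); first by congr (hval _ _); exact: pts_eq.
by rewrite mulrA -expfzDr // addNr expr0z mul1r.
Qed.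
Definition tau_fun U s : sec (twist A u) U := Tw (@tau_cocycle U s).
Fact tauL U (a : sring U) s s' : tau_fun (a *: s + s') = a *: tau_fun s + tau_fun s'.
Proof.
apply: tw_eq => l; apply/ffunP => j; rewrite !ffunE; apply: hreg_eq => x /=.
by rewrite !mulrfctE /= !addrfctE mulrDl mulrA.
Qed.
Fact tau_res U V (h : osub V U) s : tau_fun (res h s) = res h (tau_fun s).
Proof.
apply: tw_eq => l; apply/ffunP => j; rewrite !ffunE; apply: hreg_eq => x /=.
by rewrite !mulrfctE /=; congr (hval _ _ * _); exact: pts_eq.
Qed.
(** The isomorphism O(v) = O(v - u)(u): on chart [l] a section f is (f x_l^(-u)) tensor x_l^u. *)
Definition tau : shom (fsum (OO k n v) p) (twist A u) := Defs.Hom tauL tau_res.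

Lemma tauE U s l (x : pts (ocap U (chart l))) j :
  ((tau U s : tw_type A u U) l : {ffun 'I_p -> hreg t _}) j x =
  (s : {ffun 'I_p -> hreg v U}) j (pres (@capl _ _ U (chart l)) x) * sval x ord0 l ^ (- u).
Proof. by rewrite ffunE. Qed.

Lemma tau_iso : is_iso tau.
Proof.
apply: inj_surj_iso => [U s es|U s x Ux].
  apply/ffunP => j; apply: hreg_eq => x.
  have [l xl] := chart_neq0 (opn_neq0 (svalP x)).
  pose y : pts (ocap U (chart l)) := exist _ (sval x) (conj (svalP x) xl).
  have := tauE s y j; rewrite es ffunE => /esym/eqP; rewrite mulf_eq0 expfz_eq0 (negPf xl).
  rewrite andbF orbF => /eqP s0; rewrite ffunE -[RHS]s0; congr (hval _ _); exact: pts_eq.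
have [l xl] := chart_neq0 (opn_neq0 Ux).
pose V := ocap U (chart l); exists V, (@capl _ _ U (chart l)); split=> //.
pose sl := ((s : tw_type A u U) l : {ffun 'I_p -> hreg t V}).
exists ([ffun j => hmul e' (sl j) (coordX u (@capr _ _ U (chart l)))] : {ffun 'I_p -> hreg v V}).
apply: tw_eq => m; apply/ffunP => j; apply: hreg_eq => y; rewrite tauE !ffunE /=.
rewrite !mulrfctE /=.
have yl : sval y ord0 l != 0 by case: (svalP y) => -[].
have ym : sval y ord0 m != 0 by case: (svalP y).
have hy : overlap U l m (sval y) by case: (svalP y) => -[].
have := congr1 (fun f : {ffun 'I_p -> hreg t (overlap U l m)} => f j (exist _ (sval y) hy))
  (twP s l m); rewrite !ffunE /= !mulrfctE /= => h.
set a := hval _ _; have -> : a = hval (sl j) (pres (@overlap_ol _ _ U l m) (exist _ (sval y) hy)).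
  by congr (hval _ _); exact: pts_eq.
rewrite h; set b := hval _ _; set c := hval _ _.
have -> : b = c by congr (hval _ _); exact: pts_eq.
rewrite [_ * c]mulrC -!mulrA [X in c * X](_ : _ = 1) ?mulr1 //.
by rewrite [X in _ * X]mulrA -expfzDr // addNr expr0z mul1r -expfzDr // addrN expr0z.
Qed.
End TwistOfSum.

End Twisting.

(** * Complexes and their morphisms assembled from families indexed by natural numbers *)

Section Complexes.
Variables (k : closedFieldType) (n : nat).
Notation sheaf := (sheaf k n).
Notation opn := (opn k n).

Definition zs : sheaf := LM (@deg0 0) (fun=> 1%:M : 'M[k]_0).

Lemma zs_zero : is_zero zs.
Proof. by move=> U s; apply: lm_eq => x; rewrite thinmx0 [RHS]thinmx0. Qed.

Section FromNat.
Variables (X : nat -> sheaf) (dX : forall m, shom (X m) (X m.+1)).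

Definition zt (u : int) : sheaf := if u is Posz m then X m else zs.

Definition cast_d m m' (e : m.+1 = m') : shom (X m) (X m') :=
  match e in _ = z return shom (X m) (X z) with erefl => dX m end.

(** A [complex] carries maps between all pairs of degrees, so consecutiveness is decided and the
    differential is transported along the equality found; every other map is 0. *)
Definition zd u v : shom (zt u) (zt v) :=
  match u return shom (zt u) (zt v) with
  | Posz m =>
    match v return shom (X m) (zt v) with
    | Posz m' => match m.+1 =P m' with
                 | ReflectT e => cast_d e
                 | ReflectF _ => zeroh _ _
                 end
    | Negz _ => zeroh _ _
    end
  | Negz _ => zeroh _ _
  end.

Lemma zd_succ m : zd (Posz m) (Posz m.+1) = dX m.
Proof. by rewrite /zd; case: eqP => // e; rewrite (eq_axiomK e). Qed.

Lemma zd_off u v : u + 1 != v -> is_zeroh (zd u v).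
Proof.
case: u v => m [] m' //= h; case: eqP => // e.
by case/eqP: h; rewrite -e; lia.
Qed.

Hypothesis dd : forall m, is_zeroh (comph (dX m.+1) (dX m)).

Lemma zd_sq u v w : is_zeroh (comph (zd v w) (zd u v)).
Proof.
case: u v w => m [] m' [] m'' U s //=; try by rewrite ?app0.
case: (m.+1 =P m') => [e|_] /=; last by rewrite app0.
subst m'; case: eqP => // e; subst m''; exact: (@dd m U s).
Qed.

(** Index m sits in degree m - 4, so that five terms fill the degrees -4 to 0, which lie in the
    allowed window because [width n] is at least 4. *)
Definition cx : complex k n :=
  Complex (term := fun t => zt (t + 4)) (diff := fun s t => zd (s + 4) (t + 4))
    (fun s t h => @zd_off (s + 4) (t + 4) (eq_ind _ (fun b => ~~ b) h _
       (esym (etrans (congr1 (fun z => z == t + 4) (addrAC s 4 1)) (inj_eq (addIr 4) (s + 1) t)))))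
    (fun s t u => @zd_sq (s + 4) (t + 4) (u + 4)).

Lemma cx_acyclic : (forall U s, dX 0%N U s = 0 -> s = 0) ->
  (forall m, sexact (dX m) (dX m.+1)) -> acyclic cx.
Proof.
move=> inj ex t.
(* The three shifted degrees become variables, so that a case analysis on the middle one determines
   its neighbours. At index 0 exactness is the injectivity [inj]. *)
suff H u u' u'' : u' + 1 = u -> u'' = u + 1 -> sexact (zd u' u) (zd u u'').
  by apply: H; ring.
case: u => [[|m]|m] e1 e2.
- have {e1} -> : u' = Negz 0 by lia.
  have {e2} -> : u'' = Posz 1 by lia.
  rewrite zd_succ; apply: sexactI => [U s|U s /inj ->]; first exact: app0.
  exact: img_mem0.
- have {e1} -> : u' = Posz m by lia.
  have {e2} -> : u'' = Posz m.+2 by lia.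
  by rewrite !zd_succ; exact: ex.
apply: sexactI => [U s|U s _]; first by rewrite [zd _ _ U s]zs_zero app0.
by rewrite [s]zs_zero; exact: img_mem0.
Qed.

Lemma cx_vbundle : (forall m, vbundle (X m)) -> forall t, vbundle (cx t).
Proof. by move=> H t /=; case: (t + 4) => m //=; exact: free_vbundle. Qed.

Lemma cx_supported : (forall m, (5 <= m)%N -> is_zero (X m)) ->
  supported (- width n) 0 cx.
Proof.
move=> H t ht /=; case e: (t + 4) => [m|m] /=; last exact: zs_zero.
apply: H; rewrite leqNgt; apply: contra ht => hm.
have w4 : (4 <= (maxn n 3).+1)%N by rewrite ltnS leq_max orbT.
by rewrite /width; lia.
Qed.
End FromNat.

Section MapFromNat.
Variables (X Y : nat -> sheaf) (dX : forall m, shom (X m) (X m.+1)).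
Variables (dY : forall m, shom (Y m) (Y m.+1)).
Hypothesis ddX : forall m, is_zeroh (comph (dX m.+1) (dX m)).
Hypothesis ddY : forall m, is_zeroh (comph (dY m.+1) (dY m)).
Variable f : forall m, shom (X m) (Y m).
Hypothesis fC : forall m, eqhom (comph (f m.+1) (dX m)) (comph (dY m) (f m)).

Definition zf u : shom (zt X u) (zt Y u) :=
  match u return shom (zt X u) (zt Y u) with Posz m => f m | Negz _ => zeroh _ _ end.

Lemma zfC u v : eqhom (comph (zf v) (zd dX u v)) (comph (zd dY u v) (zf u)).
Proof.
move=> U s; case: u s => m s; last by rewrite /= app0.
case: v => m' //=; case: eqP => [e|_]; last by rewrite app0.
by subst m'; exact: (@fC m U s).
Qed.

(** The shift by [j = 0] places the target in degree [0 + t], which is not convertible to [t] for a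
    variable [t]; hence the transport along [u = v]. *)
Definition cxf_at z (z0 : z = 0) u v (e : u = v) : shom (zt X u) (twist (zt Y v) z) :=
  match e in _ = v return shom (zt X u) (twist (zt Y v) z) with
    erefl => comph (untw (zt Y u) z0) (zf u) end.

Lemma cxf_atC z (z0 : z = 0) u v (e : u = v) u' v' (e' : u' = v') :
  eqhom (comph (cxf_at z0 e') (zd dX u u'))
        (comph (twist_hom (zd dY v v') z) (cxf_at z0 e)).
Proof.
subst v v' => U s; apply: tw_eq => l /=.
by rewrite app_res; congr res; exact: zfC.
Qed.

Lemma cxf_at0 z (z0 : z = 0) u v (e : u = v) U s :
  cxf_at z0 e U s = 0 <-> zf u U s = 0.
Proof.
subst v => /=; split=> [|-> ]; last exact: (app0 (untw _ z0)).
exact: (iso_inj (untw_iso _ z0)).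
Qed.

Lemma cxf_at_surj z (z0 : z = 0) u v (e : u = v) :
  surjective (zf u) -> surjective (cxf_at z0 e).
Proof. by subst v => h; apply: comph_surj h _; exact: iso_surj (untw_iso _ _). Qed.

Definition cxf : cmap (cx ddX) (cshift (ctwist (cx ddY) (- 0)) 0) :=
  @Cmap _ _ (cx ddX) (cshift (ctwist (cx ddY) (- 0)) 0)
    (fun t => cxf_at (oppr0 int) (congr1 (fun z => z + 4) (esym (add0r t))))
    (fun s t => cxf_atC _ _ _).
End MapFromNat.

Section FiveTerms.
Variables (S0 S1 S2 S3 S4 : sheaf).
Definition five (m : nat) : sheaf :=
  match m with 0%N => S0 | 1%N => S1 | 2%N => S2 | 3%N => S3 | 4%N => S4 | _ => zs end.
Variables (f0 : shom S0 S1) (f1 : shom S1 S2) (f2 : shom S2 S3) (f3 : shom S3 S4).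
Definition five_d (m : nat) : shom (five m) (five m.+1) :=
  match m return shom (five m) (five m.+1) with
  | 0%N => f0 | 1%N => f1 | 2%N => f2 | 3%N => f3 | _ => zeroh _ _ end.
Hypotheses (e01 : sexact f0 f1) (e12 : sexact f1 f2) (e23 : sexact f2 f3).

Lemma sexact_zero (F G H : sheaf) (f : shom F G) (g : shom G H) : sexact f g -> is_zeroh (comph g f).
Proof.
move=> ex U s; apply/ex => x Ux; exists U, (@Defs.sub_refl _ _ U); split=> //.
by exists s; rewrite res_id.
Qed.

Lemma five_dd m : is_zeroh (comph (five_d m.+1) (five_d m)).
Proof. by case: m => [|[|[|m]]] //=; exact: sexact_zero. Qed.

Lemma five_exact : surjective f3 -> forall m, sexact (five_d m) (five_d m.+1).
Proof.
move=> s3 [|[|[|[|m]]]] //=; apply: sexactI => // U s _.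
by rewrite [s]zs_zero; exact: img_mem0.
Qed.

Lemma five_zero m : (5 <= m)%N -> is_zero (five m).
Proof. by case: m => [|[|[|[|[|m]]]]] // _; exact: zs_zero. Qed.

Lemma five_vbundle : vbundle S0 -> vbundle S1 -> vbundle S2 -> vbundle S3 -> vbundle S4 ->
  forall m, vbundle (five m).
Proof. by move=> v0 v1 v2 v3 v4 [|[|[|[|[|m]]]]] //; exact: free_vbundle. Qed.
End FiveTerms.

End Complexes.

(** * Forms and generators of the kernel *)

Section Minors.
Variable F : fieldType.

Lemma nonzero_minor a b (A : 'M[F]_(a, b)) (r : nat) : \rank A = r ->
  exists (f : {ffun 'I_r -> 'I_a}) (g : {ffun 'I_r -> 'I_b}), \det (mxsub f g A) != 0.
Proof.
move=> <-; set f := maxrankfun A.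
have h : row_full (rowsub f A)^T by rewrite /row_full mxrank_tr; exact: maxrowsub_free.
exists f, (fullrankfun h); rewrite -unitfE -unitmxE -unitmx_tr.
have -> : (mxsub f (fullrankfun h) A)^T = rowsub (fullrankfun h) (rowsub f A)^T.
  by apply/matrixP => i j; rewrite !mxE.
exact: fullrowsub_unit.
Qed.

(** A nonzero minor of maximal size makes the chosen rows span, A = Y A_f. The chosen columns are
    then Y times the minor's matrix, which cancels against its adjugate up to the determinant. *)
Lemma minor_factor a b (A : 'M[F]_(a, b)) r (f : 'I_r -> 'I_a) (g : 'I_r -> 'I_b) :
  \rank A = r -> \det (mxsub f g A) != 0 ->
  \det (mxsub f g A) *: A = colsub g A *m \adj (mxsub f g A) *m rowsub f A.
Proof.
move=> rk d0; have u : mxsub f g A \in unitmx by rewrite unitmxE unitfE.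
have sub := rowsub_sub f A.
have cg : mxsub f g A = rowsub f A *m colsub g 1%:M by rewrite mulmx_colsub mulmx1 -mxsubcr.
have rkf : \rank A = \rank (rowsub f A).
  apply/eqP; rewrite eqn_leq (mxrankS sub) andbT rk.
  apply: (@leq_trans (\rank (mxsub f g A))); first by rewrite mxrank_unit.
  by rewrite cg mxrankM_maxl.
have : (A <= rowsub f A)%MS by have := (mxrank_leqif_eq sub).2; rewrite -rkf eqxx => /esym/andP[].
case/submxP => Y eY.
have -> : colsub g A = Y *m mxsub f g A by rewrite cg mulmxA -eY mulmx_colsub mulmx1.
by rewrite -[Y *m _ *m _]mulmxA mul_mx_adj mul_mx_scalar -scalemxAl -eY.
Qed.
End Minors.

Section Forms.
Variables (k : closedFieldType) (n : nat).
Notation pt := 'rV[k]_n.+1.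
Notation opn := (opn k n).
Implicit Types (f g : pt -> k).

(** Forms of degree m as functions, peeling off one coordinate at a time. This non-unique expansion
    is the one used in the inductions on words. *)
Fixpoint homog_fun (m : nat) f : Prop :=
  if m is m'.+1 then
    exists2 g : 'I_n.+1 -> pt -> k, forall i, homog_fun m' (g i) &
      forall x, f x = \sum_i x ord0 i * g i x
  else exists c, forall x, f x = c.

Lemma homog_fun_ext m f g : (forall x, f x = g x) -> homog_fun m f -> homog_fun m g.
Proof.
case: m => [|m] e /=; first by move=> [c h]; exists c => x; rewrite -e.
by move=> [h dh eh]; exists h => // x; rewrite -e.
Qed.

Lemma homog_fun0 m : homog_fun m (fun=> 0).
Proof.
elim: m => [|m IH]; first by exists 0.
by exists (fun _ _ => 0) => // x; rewrite big1 // => i _; rewrite mulr0.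
Qed.

Lemma homog_funD m f g : homog_fun m f -> homog_fun m g -> homog_fun m (fun x => f x + g x).
Proof.
elim: m f g => [|m IH] f g /=.
  by move=> [c h] [c' h']; exists (c + c') => x; rewrite h h'.
move=> [u du eu] [v dv ev]; exists (fun i x => u i x + v i x) => [i|x]; first exact: IH.
by rewrite eu ev -big_split; apply: eq_bigr => i _; rewrite mulrDr.
Qed.

Lemma homog_fun_sum m (I : Type) (r : seq I) (P : pred I) (F : I -> pt -> k) :
  (forall i, P i -> homog_fun m (F i)) -> homog_fun m (fun x => \sum_(i <- r | P i) F i x).
Proof.
move=> H; elim: r => [|i r IH].
  by apply: homog_fun_ext (homog_fun0 m) => x; rewrite big_nil.
case Pi: (P i); last by apply: homog_fun_ext IH => x; rewrite big_cons Pi.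
by apply: homog_fun_ext (homog_funD (H _ Pi) IH) => x; rewrite big_cons Pi.
Qed.

Lemma homog_funM m l f g : homog_fun m f -> homog_fun l g -> homog_fun (m + l) (fun x => f x * g x).
Proof.
elim: m f => [|m IH] f.
  move=> [c h] dg; rewrite add0n; apply: (@homog_fun_ext _ (fun x => c * g x)).
    by move=> x; rewrite h.
  elim: l g dg => [|l IHl] g /=; first by move=> [c' h']; exists (c * c') => x; rewrite h'.
  move=> [u du eu]; exists (fun i x => c * u i x) => [i|x]; first exact: IHl.
  by rewrite eu mulr_sumr; apply: eq_bigr => i _; rewrite mulrCA.
move=> [u du eu] dg; exists (fun i x => u i x * g x) => [i|x]; first exact: (IH _ (du i) dg).
by rewrite eu mulr_suml; apply: eq_bigr => i _; rewrite mulrA.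
Qed.

Lemma homog_fun_cst c : homog_fun 0 (fun=> c). Proof. by exists c. Qed.

Lemma homog_funZ m c f : homog_fun m f -> homog_fun m (fun x => c * f x).
Proof. exact: homog_funM (homog_fun_cst c). Qed.

Lemma homog_funZr m c f : homog_fun m f -> homog_fun m (fun x => f x * c).
Proof. by move=> /(homog_funZ c); apply: homog_fun_ext => x; rewrite mulrC. Qed.

Lemma homog_fun_coord i : homog_fun 1 (fun x => x ord0 i).
Proof.
exists (fun j _ => (j == i)%:R) => [j|x]; first by exists (j == i)%:R.
by rewrite (bigD1 i) //= eqxx mulr1 big1 ?addr0 // => j /negPf ->; rewrite mulr0.
Qed.

Lemma homog_fun_prod r (F : 'I_r -> pt -> k) : (forall i, homog_fun 1 (F i)) ->
  homog_fun r (fun x => \prod_i F i x).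
Proof.
elim: r F => [|r IH] F H; first by exists 1 => x; rewrite big_ord0.
apply: (@homog_fun_ext _ (fun x => F ord0 x * \prod_i F (lift ord0 i) x)).
  by move=> x; rewrite big_ord_recl.
exact: (@homog_funM 1 r _ _ (H _) (IH _ _)).
Qed.

Lemma homog_fun_det r (A : pt -> 'M[k]_r) : (forall i j, homog_fun 1 (fun x => A x i j)) ->
  homog_fun r (fun x => \det (A x)).
Proof. by move=> H; apply: homog_fun_sum => s _; apply: homog_funZ; exact: homog_fun_prod. Qed.

Lemma homog_fun_adj r (A : pt -> 'M[k]_r) i j : (forall i j, homog_fun 1 (fun x => A x i j)) ->
  homog_fun r.-1 (fun x => \adj (A x) i j).
Proof.
move=> H; apply: (@homog_fun_ext _ (fun x => cofactor (A x) j i)) => [x|]; first by rewrite mxE.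
apply: homog_funZ; apply: homog_fun_det => i' j'.
by apply: homog_fun_ext (H (lift j i') (lift i j')) => x; rewrite !mxE.
Qed.

Lemma reg_homog_fun U m f : homog_fun m f -> reg U m%:Z f.
Proof.
elim: m f => [|m IH] f; first by move=> [c h]; apply: (reg_ext (reg_cst U c)) => x _.
move=> [g dg eg]; apply: (@reg_ext _ _ _ _ (fun x => \sum_i x ord0 i * g i x)) => [|x _] //.
apply: reg_sum => i _; apply: (regM _ (reg_coord U i) (IH _ (dg i))).
by rewrite -[in RHS]add1n PoszD.
Qed.

Lemma homog_fun_linear (p : {mpoly k[n.+1]}) : isform 1 p ->
  homog_fun 1 (fun x => meval (x ord0) p).
Proof.
(* The redundant test keeps membership in the support, hence degree one of the monomial, available
   in each summand. *)
move=> hp; apply: (@homog_fun_ext _ (fun x => \sum_(m <- msupp p)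
    if m \in msupp p then p@_m * \prod_i x ord0 i ^+ m i else 0)).
  by move=> x; rewrite mevalE big_seq_cond [RHS]big_seq_cond; apply: eq_bigr => m /andP[-> _].
apply: homog_fun_sum => m _; case hm: (m \in msupp p); last exact: homog_fun0.
have /eqP/mdeg1P[i /eqP ->] : mdeg m = 1%N by exact: (dhomog_mf hp hm).
apply: homog_fun_ext (homog_funZ _ (homog_fun_coord i)) => x; congr (_ * _).
rewrite (bigD1 i) //= big1 ?mulr1 => [|j /negPf ji]; first by rewrite mnm1E eqxx expr1.
by rewrite mnm1E eq_sym ji expr0.
Qed.

(* Cramer's rule: the generators are the rows of x_l d (d - A_g adj(A_fg) 1_f), where d
   is a minor det(A_fg) of size r.  The outer factor d makes them vanish on A also where
   the minor vanishes; the factor x_l makes their degree positive when r = 0. *)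
Lemma kernel_generators (a b r : nat) (A : pt -> 'M[k]_(a, b)) :
  (forall i j, homog_fun 1 (fun x => A x i j)) -> (forall x, x != 0 -> \rank (A x) = r) ->
  exists (N : nat) (V : pt -> 'M[k]_(N, a)),
    (forall i j, homog_fun (r + r).+1 (fun x => V x i j)) /\
    forall x, x != 0 -> forall v : 'rV_a, (v *m A x = 0 <-> (v <= V x)%MS).
Proof.
move=> dA rkA.
pose K := ({ffun 'I_r -> 'I_a} * {ffun 'I_r -> 'I_b} * 'I_n.+1 * 'I_a)%type.
pose B (f : {ffun 'I_r -> 'I_a}) (g : {ffun 'I_r -> 'I_b}) x : 'M[k]_r := mxsub f g (A x).
pose W (f : {ffun 'I_r -> 'I_a}) (g : {ffun 'I_r -> 'I_b}) x : 'M[k]_a :=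
  \det (B f g x) *: ((\det (B f g x))%:M - colsub g (A x) *m \adj (B f g x) *m rowsub f 1%:M).
pose rw (c : K) (x : pt) : 'rV[k]_a := x ord0 c.1.2 *: row c.2 (W c.1.1.1 c.1.1.2 x).
exists #|{: K}|, (fun x => \matrix_i rw (enum_val i) x); split.
  move=> i j; pose c := enum_val i; pose f := c.1.1.1; pose g := c.1.1.2.
  have dB i' j' : homog_fun 1 (fun x => B f g x i' j').
    by apply: homog_fun_ext (dA (f i') (g j')) => x; rewrite mxE.
  apply: (@homog_fun_ext _ (fun x => x ord0 c.1.2 * (\det (B f g x) *
    (\det (B f g x) * (c.2 == j)%:R + -1 * \sum_l \sum_s A x c.2 (g s) * \adj (B f g x) s l *
       (f l == j)%:R)))).
    move=> x; rewrite !mxE; congr (_ * (_ * (_ + _))); first by rewrite mulr_natr.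
    rewrite mulN1r; congr (- _); apply: eq_bigr => l _; rewrite !mxE mulr_suml.
    by apply: eq_bigr => s _; rewrite !mxE.
  apply: (@homog_funM 1 (r + r) _ _ (homog_fun_coord _)); apply: homog_funM; first exact: homog_fun_det.
  apply: homog_funD.
    by apply: homog_funZr; exact: homog_fun_det.
  apply: homog_funZ; apply: homog_fun_sum => l _; apply: homog_fun_sum => s _.
  (* A linear entry times an adjugate entry has degree 1 + (r - 1), which is r only for positive r;
     when r = 0 this sum is empty. *)
  have r0 : (0 < r)%N := leq_ltn_trans (leq0n s) (ltn_ord s).
  apply: homog_funZr; have := homog_funM (dA c.2 (g s)) (homog_fun_adj s l dB).
  by rewrite add1n prednK.
move=> x x0 v; split=> [vA|/submxP[u ->]].
  have [f [g fg0]] := nonzero_minor (rkA x x0); have [l xl] := chart_neq0 x0.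
  pose d := \det (B f g x).
  (* On the kernel of [A x] the correction term vanishes, so [x_l W] acts on [v] by the nonzero
     scalar x_l d^2. *)
  have vW : v *m W f g x = d ^+ 2 *: v.
    rewrite /W -scalemxAr mulmxBr !mulmxA mulmx_colsub vA.
    have -> : colsub g (0 : 'M[k]_(1, b)) = 0 by apply/matrixP => ? ?; rewrite !mxE.
    by rewrite !mul0mx subr0 mul_mx_scalar scalerA.
  have c0 : x ord0 l * d ^+ 2 != 0 by rewrite mulf_neq0 // expf_neq0.
  have -> : v = (x ord0 l * d ^+ 2)^-1 *: (x ord0 l *: (v *m W f g x)).
    by rewrite vW !scalerA -mulrA mulVf // scale1r.
  apply: scalemx_sub; rewrite mulmx_sum_row scaler_sumr; apply: summx_sub => i _.
  rewrite scalerA mulrC -scalerA; apply: scalemx_sub.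
  pose c : K := (f, g, l, i); rewrite -[X in (X <= _)%MS]/(rw c x).
  by apply: (eq_row_sub (enum_rank c)); rewrite rowK enum_rankK.
rewrite -mulmxA [_ *m A x](_ : _ = 0) ?mulmx0 //.
apply/row_matrixP => i; rewrite row_mul rowK row0 /rw.
move: (enum_val i) => [[[f g] l] j] /=; rewrite -scalemxAl -row_mul.
rewrite /W -scalemxAl mulmxBl mul_scalar_mx -!mulmxA -rowsubE.
have [->|d0] := eqVneq (\det (B f g x)) 0; first by rewrite scale0r row0 scaler0.
by rewrite (minor_factor (rkA x x0) d0) -!mulmxA subrr scaler0 row0 scaler0.
Qed.

(** * Systems of linear forms and words in the coordinates *)

Definition linform p (h : pt -> 'rV[k]_p -> k) : Prop :=
  exists t : pt -> 'cV[k]_p, (forall U i, reg U 1 (fun x => t x i ord0)) /\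
    forall x u, h x u = (u *m t x) ord0 ord0.

Lemma linform_ext p (h h' : pt -> 'rV[k]_p -> k) : (forall x u, h x u = h' x u) ->
  linform h -> linform h'.
Proof. by move=> e [t [rt et]]; exists t; split=> // x u; rewrite -e. Qed.

Lemma linform_sum p (I : Type) (r : seq I) (h : I -> pt -> 'rV[k]_p -> k) :
  (forall i, linform (h i)) -> linform (fun x u => \sum_(i <- r) h i x u).
Proof.
move=> H; elim: r => [|i r [t [rt et]]].
  exists (fun=> 0); split=> [U i|x u]; last by rewrite big_nil mulmx0 mxE.
  by apply: (reg_ext (reg0 _ _)) => x _; rewrite mxE.
have [t' [rt' et']] := H i; exists (fun x => t' x + t x); split=> [U j|x u].
  by apply: (reg_ext (regD (rt' U j) (rt U j))) => x _; rewrite mxE.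
by rewrite big_cons et et' mulmxDr [RHS]mxE.
Qed.

Lemma linform_coord p (f : pt -> k) (j : 'I_p) : (forall U, reg U 1 f) ->
  linform (fun x u => u ord0 j * f x).
Proof.
move=> rf; exists (fun x => f x *: delta_mx j 0); split=> [U i|x u].
  rewrite -[1]addr0; apply: (reg_ext (regM (erefl _) (rf U) (reg_cst U (i == j)%:R))) => x _.
  by rewrite !mxE eqxx andbT.
by rewrite -scalemxAr -colE !mxE mulrC.
Qed.

Lemma linformD p (h h' : pt -> 'rV[k]_p -> k) : linform h -> linform h' ->
  linform (fun x u => h x u + h' x u).
Proof.
move=> [t [rt et]] [t' [rt' et']]; exists (fun x => t x + t' x); split=> [U j|x u].
  by apply: (reg_ext (regD (rt U j) (rt' U j))) => x _; rewrite mxE.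
by rewrite et et' mulmxDr [RHS]mxE.
Qed.

Lemma linform_row p q (i : 'I_p) (h : pt -> 'rV[k]_q -> k) : linform h ->
  linform (fun x (u : 'rV_(p * q)) => h x (row i (vec_mx u))).
Proof.
move=> [t [rt et]].
apply: (@linform_ext _ (fun x u => \sum_j u ord0 (mxvec_index i j) * t x j ord0)).
  by move=> x u; rewrite et mxE; apply: eq_bigr => j _; rewrite !mxE.
by apply: linform_sum => j; apply: linform_coord => U; exact: rt.
Qed.

Lemma linform_matrix p q (h : 'I_q -> pt -> 'rV[k]_p -> k) : (forall j, linform (h j)) ->
  exists T : pt -> 'M[k]_(p, q), (forall U i j, reg U 1 (fun x => T x i j)) /\
    forall x u, u *m T x = \row_j h j x u.
Proof.
move=> H; pose t j := sval (cid (H j)).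
have tP j := svalP (cid (H j)).
exists (fun x => \matrix_(i, j) t j x i ord0); split=> [U i j|x u].
  by apply: (reg_ext ((tP j).1 U i)) => x _; rewrite mxE.
apply/rowP => j; rewrite !mxE (tP j).2 mxE.
by apply: eq_bigr => i _; rewrite mxE.
Qed.

(* Indexing by the words w of length m in the coordinates, X is the vector of the
   x_w and the functionals h are those of the relations x_l u_(iw') = x_i u_(lw') and
   their analogues in the later letters, which cut out the line spanned by X. *)
Lemma word_system (m : nat) :
  exists (p : nat) (K : finType) (h : K -> pt -> 'rV[k]_p -> k) (X : pt -> 'rV[k]_p),
    [/\ forall c, linform (h c), forall x, x != 0 -> X x != 0,
        forall x, x != 0 -> forall u,
          (forall c, h c x u = 0) <-> exists c, u = c *: X x &
        forall f, homog_fun m f -> exists c : 'cV[k]_p, forall x, f x = (X x *m c) ord0 ord0].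
Proof.
elim: m => [|m [p [K [h [X [lh X0 hX spX]]]]]].
  exists 1%N, void, (fun v : void => match v with end), (fun=> const_mx 1); split=> //.
  - by move=> x _; apply/eqP => /rowP/(_ ord0)/eqP; rewrite !mxE oner_eq0.
  - move=> x _ u; split=> // _; exists (u ord0 ord0); apply/rowP => i.
    by rewrite !mxE mulr1 ord1.
  move=> f [c ef]; exists (const_mx c) => x.
  by rewrite mxE big_ord1 !mxE mul1r ef.
pose h' (c : ('I_n.+1 * K) + ('I_n.+1 * 'I_n.+1 * 'I_p)) x (u : 'rV_(n.+1 * p)) :=
  match c with
  | inl (i, c) => h c x (row i (vec_mx u))
  | inr (l, i, w) => vec_mx u i w * x ord0 l + vec_mx u l w * - x ord0 i
  end.
exists (n.+1 * p)%N, ('I_n.+1 * K + 'I_n.+1 * 'I_n.+1 * 'I_p)%type, h'.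
exists (fun x => mxvec (x^T *m X x)); split.
- case=> [[i c]|[[l i] w]] /=; first exact: linform_row.
  apply: (@linform_ext _ (fun x (u : 'rV_(n.+1 * p)) => u ord0 (mxvec_index i w) * x ord0 l
      + u ord0 (mxvec_index l w) * - x ord0 i)) => [x u|]; first by rewrite /h' !mxE.
  apply: linformD; apply: linform_coord => U; first exact: reg_coord.
  by apply: regN; exact: reg_coord.
- move=> x x0; have [l xl] := chart_neq0 x0.
  have /rV0Pn[w Xw] := X0 x x0.
  apply/eqP => /(congr1 vec_mx); rewrite mxvecK linear0 => /matrixP/(_ l w)/eqP.
  by rewrite !mxE big_ord1 mxE mulf_eq0 (negPf xl) (negPf Xw).
- move=> x x0 u; have [l xl] := chart_neq0 x0; split=> [H|[c ->] [[i d]|[[l' i] w]]] /=.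
  + have rows i : exists c, row i (vec_mx u) = c *: X x.
      by apply/(hX x x0) => c; exact: (H (inl (i, c))).
    (* Row [l] is c X, and x_l u_(iw) = x_i u_(lw) = x_i c X_w determines the other rows after
       division by the nonzero x_l. *)
    have [c ec] := rows l; exists (c / x ord0 l); apply: (can_inj vec_mxK).
    rewrite linearZ /= mxvecK; apply/matrixP => i w.
    have := H (inr (l, i, w)) => /= /eqP; rewrite mulrN subr_eq0 => /eqP e.
    apply: (mulIf xl); rewrite e; have := congr1 (fun v : 'rV_p => v ord0 w) ec.
    by rewrite !mxE => ->; rewrite big_ord1 !mxE; field.
  + suff /(hX x x0) : exists c', row i (vec_mx (c *: mxvec (x^T *m X x))) = c' *: X x by apply.
    exists (c * x ord0 i); apply/rowP => w.
    by rewrite linearZ /= mxvecK !mxE big_ord1 mxE mulrA.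
  by rewrite linearZ /= mxvecK !mxE !big_ord1 !mxE; ring.
move=> f [g dg eg].
pose c i := sval (cid (spX _ (dg i))); have cP i x := svalP (cid (spX _ (dg i))) x.
exists (mxvec (\matrix_(i, w) c i w ord0))^T => x; rewrite eg.
transitivity (\sum_i \sum_w x ord0 i * (X x ord0 w * c i w ord0)).
  by apply: eq_bigr => i _; rewrite cP mxE mulr_sumr.
rewrite pair_bigA mxE [RHS](reindex _ (curry_mxvec_bij _ _)) /=.
by apply: eq_bigr => -[i w] _ /=; rewrite !mxE !mxvecE !mxE big_ord1 mxE mulrA.
Qed.

(** Write f as the sum of the x_i g_i with g_i = X c_i and c_i constant; the sum of the x_i c_i is
    the column sought. *)
Lemma forms_over_words m p (X : pt -> 'rV[k]_p) :
  (forall f, homog_fun m f -> exists c : 'cV_p, forall x, f x = (X x *m c) ord0 ord0) ->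
  forall f, homog_fun m.+1 f -> exists t : pt -> 'cV[k]_p,
    (forall U i, reg U 1 (fun x => t x i ord0)) /\ forall x, f x = (X x *m t x) ord0 ord0.
Proof.
move=> spX f [g dg eg].
pose c i := sval (cid (spX _ (dg i))); have cP i x := svalP (cid (spX _ (dg i))) x.
exists (fun x => \sum_i x ord0 i *: c i); split=> [U w|x].
  apply: (@reg_ext _ _ _ _ (fun x => \sum_i x ord0 i * c i w ord0)) => [|x _]; last first.
    by rewrite summxE; apply: eq_bigr => i _; rewrite mxE.
  apply: reg_sum => i _; rewrite -[1]addr0.
  exact: regM (erefl _) (reg_coord U i) (reg_cst U _).
rewrite eg mulmx_sumr summxE; apply: eq_bigr => i _.
by rewrite -scalemxAr mxE -cP.
Qed.

(* T is dual to a presentation of N copies of the module truncated in degree m: its kernel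
   at x consists of the c (x) X(x) with c in k^N; each form of degree m + 1 being a combination
   of the words X with linear coefficients, V extends from that kernel to a linear L. *)
Lemma linear_cover (m N a : nat) (V : pt -> 'M[k]_(N, a)) :
  (forall i j, homog_fun m.+1 (fun x => V x i j)) ->
  exists (p q s : nat) (T : pt -> 'M[k]_(p, q)) (L : pt -> 'M[k]_(p, a)),
    [/\ forall U i j, reg U 1 (fun x => T x i j), forall U i j, reg U 1 (fun x => L x i j),
        forall x, x != 0 -> \rank (T x) = s,
        forall x, x != 0 -> forall u : 'rV_p, u *m T x = 0 -> (u *m L x <= V x)%MS &
        forall x, x != 0 -> forall v : 'rV_a, (v <= V x)%MS ->
          exists2 u : 'rV_p, u *m T x = 0 & u *m L x = v].
Proof.
move=> dV; have [p [K [h [X [lh X0 hX spX]]]]] := word_system m.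
pose hT (j : 'I_#|{: 'I_N * K}|) x (u : 'rV_(N * p)) :=
  h (enum_val j).2 x (row (enum_val j).1 (vec_mx u)).
have [|T [rT eT]] := @linform_matrix _ _ hT; first by move=> j; exact: linform_row.
pose t i j := sval (cid (forms_over_words spX (dV i j))).
have tP i j := svalP (cid (forms_over_words spX (dV i j))).
pose hL (j : 'I_a) x (u : 'rV_(N * p)) :=
  \sum_i (row i (vec_mx u) *m t i j x) ord0 ord0.
have [|L [rL eL]] := @linform_matrix _ _ hL.
  move=> j; apply: linform_sum => i; apply: (@linform_row N p i (fun x u => (u *m t i j x) ord0 ord0)).
  by exists (t i j); split=> // U w; exact: (tP i j).1.
(* [Z x] sends [c] to c tensor X(x); it parametrizes the kernel of [T x], and composing it with
   [L x] gives back [V x]. *)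
pose Z x : 'M[k]_(N, N * p) := lin1_mx (mxvec \o (mulmxr (X x) \o trmx)).
have ZE x (c : 'rV_N) : c *m Z x = mxvec (c^T *m X x) by rewrite mul_rV_lin1.
have kT x (u : 'rV_(N * p)) : x != 0 -> u *m T x = 0 <-> exists c : 'rV_N, u = c *m Z x.
  move=> x0; split=> [uT|[c ->]]; last first.
    rewrite eT; apply/rowP => j; rewrite mxE [RHS]mxE /hT ZE mxvecK row_mul.
    suff /(hX x x0) : exists c', row (enum_val j).1 c^T *m X x = c' *: X x by apply.
    exists (c ord0 (enum_val j).1).
    by rewrite [row _ _]mx11_scalar mul_scalar_mx !mxE.
  have rows i : exists c, row i (vec_mx u) = c *: X x.
    apply/(hX x x0) => d; have := congr1 (fun v : 'rV_ _ => v ord0 (enum_rank (i, d))) uT.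
    by rewrite eT !mxE /hT enum_rankK.
  exists (\row_i sval (cid (rows i))); rewrite ZE; apply: (can_inj vec_mxK).
  rewrite mxvecK; apply/row_matrixP => i; rewrite (svalP (cid (rows i))) row_mul.
  by rewrite [row i _^T]mx11_scalar mul_scalar_mx !mxE.
have ZL x (c : 'rV_N) : c *m Z x *m L x = c *m V x.
  rewrite eL; apply/rowP => j; rewrite mxE /hL [RHS]mxE; apply: eq_bigr => i _.
  rewrite ZE mxvecK row_mul [row i _^T]mx11_scalar mul_scalar_mx -scalemxAl.
  by rewrite [LHS]mxE -(tP i j).2 !mxE.
(* The kernel of [T x] is the row space of [Z x], of dimension N because X(x) is nonzero. *)
exists (N * p)%N, #|{: 'I_N * K}|, (N * p - N)%N, T, L; split=> //.
- move=> x x0.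
  have Zfree : row_free (Z x).
    rewrite -kermx_eq0; apply/eqP/row_matrixP => i; rewrite row0.
    have : row i (kermx (Z x)) *m Z x = 0 by apply/sub_kermxP; exact: row_sub.
    move: (row i _) => c; rewrite ZE => /(congr1 vec_mx); rewrite mxvecK linear0 => cX.
    have /rV0Pn[w Xw] := X0 x x0; apply/rowP => l.
    have := congr1 (fun A : 'M_(N, p) => A l w) cX.
    by rewrite !mxE big_ord1 mxE => /eqP; rewrite mulf_eq0 (negPf Xw) orbF => /eqP.
  have e : (kermx (T x) :=: Z x)%MS.
    apply/eqmxP/andP; split.
      apply/row_subP => i; have /(kT _ _ x0)[c ->] : row i (kermx (T x)) *m T x = 0.
        by apply/sub_kermxP; exact: row_sub.
      exact: submxMl.
    apply/row_subP => i; apply/sub_kermxP; apply/(kT _ _ x0); exists (delta_mx 0 i).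
    exact: rowE.
  have kN : \rank (kermx (T x)) = N by rewrite e; exact/eqP.
  by move: kN (rank_leq_row (T x)); rewrite mxrank_ker; lia.
- by move=> x x0 u /(kT _ _ x0)[c ->]; rewrite ZL submxMl.
move=> x x0 v /submxP[c ->]; exists (c *m Z x); last exact: ZL.
by apply/(kT _ _ x0); exists c.
Qed.

End Forms.

(** * The two complexes *)

Section MatrixRanks.
Variable F : fieldType.

(** The kernel of (A, B) is the kernel of [A] restricted to ker B; the formula is rank-nullity for
    that restriction. *)
Lemma rank_row_mx p a q (A : 'M[F]_(p, a)) (B : 'M[F]_(p, q)) :
  \rank (row_mx A B) = (\rank B + \rank (kermx B *m A))%N.
Proof.
have e : (kermx (row_mx A B) :=: kermx B :&: kermx A)%MS.
  apply/eqmxP/andP; split.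
    rewrite sub_capmx; apply/andP; split; apply/sub_kermxP.
      by have := mulmx_ker (row_mx A B); rewrite mul_mx_row -row_mx0 => /eq_row_mx[].
    by have := mulmx_ker (row_mx A B); rewrite mul_mx_row -row_mx0 => /eq_row_mx[].
  apply/sub_kermxP; rewrite mul_mx_row -row_mx0; congr row_mx; apply/sub_kermxP.
    exact: capmxSr.
  exact: capmxSl.
have := mxrank_mul_ker (kermx B) A; rewrite -e !mxrank_ker.
have := rank_leq_row (row_mx A B); have := rank_leq_row B.
by lia.
Qed.

Lemma pinvmx_factor p q m (A : 'M[F]_(p, q)) (Z : 'M[F]_(p, m)) :
  (forall u : 'rV_p, u *m A = 0 -> u *m Z = 0) -> A *m (pinvmx A *m Z) = Z.
Proof.
move=> H; apply/eqP; rewrite -subr_eq0; apply/eqP/row_matrixP => i.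
rewrite mulmxA -[X in _ - X]mul1mx -mulmxBl row_mul row0; apply: H.
by rewrite -row_mul mulmxBl mul1mx mulmxKpV // subrr row0.
Qed.

Lemma cokermxP p q (A : 'M[F]_(p, q)) (w : 'rV_q) : w *m cokermx A = 0 <-> (w <= A)%MS.
Proof. by rewrite submxE; split=> [->|/eqP]. Qed.
End MatrixRanks.

Section MapOfFive.
Variables (k : closedFieldType) (n : nat).
Variables (S0 S1 S2 S3 S4 T0 T1 T2 T3 T4 : sheaf k n).
Variables (f0 : shom S0 T0) (f1 : shom S1 T1) (f2 : shom S2 T2) (f3 : shom S3 T3).
Variables (f4 : shom S4 T4).
Definition five_map m : shom (five S0 S1 S2 S3 S4 m) (five T0 T1 T2 T3 T4 m) :=
  match m return shom (five S0 S1 S2 S3 S4 m) (five T0 T1 T2 T3 T4 m) with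
  | 0%N => f0 | 1%N => f1 | 2%N => f2 | 3%N => f3 | 4%N => f4 | _ => zeroh _ _ end.
End MapOfFive.

Lemma lsplit1 (k : closedFieldType) n p (d : 'I_p -> int) :
  lsplit (n := n) d d (fun=> 1%:M : 'M[k]_p).
Proof.
by move=> x x0; exists (otop k n), (fun=> 1%:M); split=> [//||y _]; [exact: regmx1 | rewrite !mulmx1].
Qed.

Lemma regmx_linear (k : closedFieldType) n p q (d : 'I_p -> int) (e : 'I_q -> int)
    (A : 'rV[k]_n.+1 -> 'M[k]_(p, q)) (U : opn k n) :
  (forall i j, e j - d i = 1) -> (forall i j, reg U 1 (fun x => A x i j)) -> regmx U d e A.
Proof. by move=> de rA i j; rewrite de; exact: rA. Qed.

Lemma regmx_degrees (k : closedFieldType) n p q (d d' : 'I_p -> int) (e e' : 'I_q -> int)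
    (A : 'rV[k]_n.+1 -> 'M[k]_(p, q)) (U : opn k n) :
  d =1 d' -> e =1 e' -> regmx U d e A -> regmx U d' e' A.
Proof. by move=> dd ee rA i j; rewrite -dd -ee; exact: rA. Qed.

Section Construction.
Variables (k : closedFieldType) (n a b p q r s : nat).
Notation pt := 'rV[k]_n.+1.
Variables (MT : pt -> 'M[k]_(a, b)) (T : pt -> 'M[k]_(p, q)) (L : pt -> 'M[k]_(p, a)).
Hypotheses (rM : forall U i j, reg (n := n) U 1 (fun x => MT x i j))
  (rT : forall U i j, reg (n := n) U 1 (fun x => T x i j))
  (rL : forall U i j, reg (n := n) U 1 (fun x => L x i j)).
Hypotheses (rkM : forall x, x != 0 -> \rank (MT x) = r)
  (rkT : forall x, x != 0 -> \rank (T x) = s).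
Hypothesis TLM : forall x, x != 0 -> forall u : 'rV_p, u *m T x = 0 -> u *m L x *m MT x = 0.
Hypothesis TL : forall x, x != 0 -> forall v : 'rV_a, v *m MT x = 0 ->
  exists2 u : 'rV_p, u *m T x = 0 & u *m L x = v.

Implicit Types (U : opn k n) (x : pt).
Local Notation free d := (LM d (fun=> 1%:M)).
(** The complexes are twisted by -2, so that O(-1)^p and O^a + O^q become the sums of O(-3) and of
    O(-2) standing in degrees -3 and -2. *)
Definition degA : 'I_p -> int := fun=> - 3.
Definition degB : 'I_(a + q) -> int := fun=> - 2.
Definition degBQ : 'I_q -> int := fun=> - 2.
Definition degC : 'I_b -> int := fun=> - 1.
Definition degD : 'I_(b + q) -> int := catd degC degBQ.

Definition LT x := row_mx (L x) (T x).
Definition AD x := row_mx (L x *m MT x) (T x).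
Definition N x : 'M_(a + q, b + q) := block_mx (MT x) 0 0 1%:M.
Definition piD x := cokermx (AD x).
Definition piC x := cokermx (MT x).
Definition piQ x := cokermx (T x).

Lemma regmx_MT U : regmx U (fun=> - 2) degC MT.
Proof. exact: regmx_linear. Qed.
Lemma regmx_T U : regmx U degA degBQ T.
Proof. exact: regmx_linear. Qed.
Lemma regmx_LT U : regmx U degA degB LT.
Proof.
apply: (@regmx_degrees _ _ _ _ degA _ (catd (fun=> - 2) degBQ)) => // [j|].
  by rewrite /catd; case: fintype.split.
by apply: regmx_row => //; exact: regmx_linear.
Qed.
Lemma regmx_AD U : regmx U degA degD AD.
Proof.
apply: regmx_row => //; apply: (regmxM (e := fun=> - 2)) => //; exact: regmx_linear.
Qed.
Lemma regmx_N U : regmx U degB degD N.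
Proof.
apply: (@regmx_degrees _ _ _ _ (catd (fun=> - 2) degBQ) _ degD) => // [j|].
  by rewrite /catd; case: fintype.split.
apply: regmx_col; apply: regmx_row => //; by [exact: regmx0 | exact: regmx1].
Qed.
Lemma regmx_prB U : regmx U degB degBQ (fun=> col_mx 0 1%:M).
Proof.
apply: (@regmx_degrees _ _ _ _ (catd (fun=> - 2) degBQ) _ degBQ) => // [j|].
  by rewrite /catd; case: fintype.split.
by apply: regmx_col; [exact: regmx0 | exact: regmx1].
Qed.
Lemma regmx_D_C U : regmx U degD degC (fun=> col_mx 1%:M 0).
Proof. by apply: regmx_col; [exact: regmx1 | exact: regmx0]. Qed.
Lemma regmx_D_BQ U : regmx U degD degBQ (fun=> col_mx 0 1%:M).
Proof. by apply: regmx_col; [exact: regmx0 | exact: regmx1]. Qed.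
Lemma regmx_incD U : regmx U degC degD (fun=> row_mx 1%:M 0).
Proof. by apply: regmx_row; [exact: regmx1 | exact: regmx0]. Qed.
Lemma regmx_incB U : regmx U (fun=> - 2) degB (fun=> row_mx 1%:M 0 : 'M_(a, a + q)).
Proof.
apply: (@regmx_degrees _ _ _ _ (fun=> - 2) _ (catd (fun=> - 2) degBQ)) => // [j|].
  by rewrite /catd; case: fintype.split.
by apply: regmx_row; [exact: regmx1 | exact: regmx0].
Qed.

Lemma lsplit_MT : lsplit (fun=> - 2) degC MT.
Proof. by apply: const_rank_lsplit rkM => U; exact: regmx_MT. Qed.
Lemma lsplit_T : lsplit degA degBQ T.
Proof. by apply: const_rank_lsplit rkT => U; exact: regmx_T. Qed.
(** [L] maps ker T onto ker M, of dimension a - r, so the rank is s + (a - r) everywhere. *)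
Lemma lsplit_LT : lsplit degA degB LT.
Proof.
apply: (@const_rank_lsplit _ _ _ _ _ _ _ (s + (a - r))%N) => [U|x x0]; first exact: regmx_LT.
rewrite /LT rank_row_mx rkT //; congr addn; rewrite -(rkM x0) -mxrank_ker.
apply: eqmx_rank; apply/andP; split.
  apply/sub_kermxP/row_matrixP => i; rewrite 2!row_mul row0 TLM //.
  by apply/sub_kermxP; exact: row_sub.
apply/row_subP => i.
have [|u uT <-] := TL x0 (v := row i (kermx (MT x))).
  by apply/sub_kermxP; exact: row_sub.
by apply: submxMr; apply/sub_kermxP.
Qed.
Lemma ker_T_LMT x : x != 0 -> kermx (T x) *m (L x *m MT x) = 0.
Proof.
move=> x0; apply/row_matrixP => i; rewrite row_mul row0 mulmxA TLM //.
by apply/sub_kermxP; exact: row_sub.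
Qed.
(** The product of [L] and [MT] vanishes on ker T, so the rank is that of [T]. This is what makes D
    a vector bundle. *)
Lemma lsplit_AD : lsplit degA degD AD.
Proof.
apply: (@const_rank_lsplit _ _ _ _ _ _ _ s) => [U|x x0]; first exact: regmx_AD.
by rewrite /AD rank_row_mx rkT // ker_T_LMT // mxrank0 addn0.
Qed.
Lemma lsplit_N : lsplit degB degD N.
Proof.
apply: (@const_rank_lsplit _ _ _ _ _ _ _ (r + q)%N) => [U|x x0]; first exact: regmx_N.
by rewrite /N rank_diag_block_mx rkM // mxrank1.
Qed.
(** Its row space consists of the rows whose second block lies in the row space of [T]: the
    representatives in O(1)^b + O^q of the kernel of D -> coker T. *)
Definition R x : 'M_(b + p, b + q) := col_mx (row_mx 1%:M 0) (AD x).
Lemma lsplit_R : lsplit (catd degC degA) degD R.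
Proof.
apply: (@const_rank_lsplit _ _ _ _ _ _ _ (b + s)%N) => [U|x x0].
  by apply: regmx_col; [exact: regmx_incD | exact: regmx_AD].
have -> : R x = block_mx 1%:M 0 (L x *m MT x) 1%:M *m block_mx 1%:M 0 0 (T x).
  by rewrite mulmx_block !mulmx0 !mul0mx !mulmx1 !mul1mx !addr0 add0r.
rewrite (eqmxMfull _ (_ : row_full _)) ?rank_diag_block_mx ?mxrank1 ?rkT //.
by rewrite row_full_unit unitmxE det_lblock !det1 mulr1 unitr1.
Qed.
Definition lsplit_incB : lsplit (n := n) (fun=> - 2) degB (fun=> row_mx 1%:M 0 : 'M[k]_(a, a + q)).
Proof.
apply: (@const_rank_lsplit _ _ _ _ _ _ _ (\rank (row_mx 1%:M 0 : 'M[k]_(a, a + q)))) => [U|//].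
exact: regmx_incB.
Qed.

Lemma AD_piD x : AD x *m piD x = 0. Proof. exact: mulmx_coker. Qed.
Lemma MT_piC x : MT x *m piC x = 0. Proof. exact: mulmx_coker. Qed.
Lemma T_piQ x : T x *m piQ x = 0. Proof. exact: mulmx_coker. Qed.
Lemma AD_factor x : AD x = LT x *m N x.
Proof. by rewrite mul_row_block !mulmx0 mulmx1 addr0 add0r. Qed.
Lemma piD_eq0 x (w : 'rV_(b + q)) : w *m piD x = 0 -> exists t : 'rV_p,
  w = row_mx (t *m L x *m MT x) (t *m T x).
Proof. by move=> /cokermxP/submxP[t ->]; exists t; rewrite mul_mx_row mulmxA. Qed.

(** The map induced on D by the first projection. It is defined through a pseudo-inverse, and is
    legitimate because that projection followed by [piC] vanishes on ker piD. *)
Definition ThC x := pinvmx (piD x) *m (col_mx 1%:M 0 *m piC x).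
Definition ThQ x := pinvmx (piD x) *m (col_mx 0 1%:M *m piQ x).
Lemma piD_ThC x : piD x *m ThC x = col_mx 1%:M 0 *m piC x.
Proof.
apply: pinvmx_factor => u /piD_eq0[t ->].
by rewrite mulmxA mul_row_col mulmx1 mulmx0 addr0 -(mulmxA _ (MT x)) MT_piC mulmx0.
Qed.
Lemma piD_ThQ x : piD x *m ThQ x = col_mx 0 1%:M *m piQ x.
Proof.
apply: pinvmx_factor => u /piD_eq0[t ->].
by rewrite mulmxA mul_row_col mulmx1 mulmx0 add0r -(mulmxA _ (T x)) T_piQ mulmx0.
Qed.

(** * The morphisms of the two rows and their exactness *)

Lemma ok_P_AB : lm_ok degA (fun=> 1%:M) degB (fun=> 1%:M) LT.
Proof. by exists LT; split=> [U|x _]; [exact: regmx_LT | rewrite mul1mx mulmx1]. Qed.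
Lemma ok_P_BD : lm_ok degB (fun=> 1%:M) degD piD (fun x => N x *m piD x).
Proof. by exists N; split=> [U|x _]; [exact: regmx_N | rewrite mul1mx]. Qed.
Lemma ok_P_DC : lm_ok degD piD degC piC ThC.
Proof. by exists (fun=> col_mx 1%:M 0); split=> [U|x _]; [exact: regmx_D_C | exact: piD_ThC]. Qed.
Lemma ok_Q_AB : lm_ok degA (fun=> 1%:M) degBQ (fun=> 1%:M) T.
Proof. by exists T; split=> [U|x _]; [exact: regmx_T | rewrite mul1mx mulmx1]. Qed.
Lemma ok_Q_BD : lm_ok degBQ (fun=> 1%:M) degBQ piQ piQ.
Proof. by exists (fun=> 1%:M); split=> // U; exact: regmx1. Qed.
Lemma ok_prB : lm_ok (k := k) (n := n) degB (fun=> 1%:M) degBQ (fun=> 1%:M) (fun=> col_mx 0 1%:M).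
Proof. by exists (fun=> col_mx 0 1%:M); split=> [U|x _]; [exact: regmx_prB | rewrite mul1mx mulmx1]. Qed.
Lemma ok_prD : lm_ok degD piD degBQ piQ ThQ.
Proof. by exists (fun=> col_mx 0 1%:M); split=> [U|x _]; [exact: regmx_D_BQ | exact: piD_ThQ]. Qed.
Lemma ok_incB : lm_ok (k := k) (n := n) (fun=> - 2) (fun=> 1%:M) degB (fun=> 1%:M)
  (fun=> row_mx 1%:M 0 : 'M_(a, a + q)).
Proof. by exists (fun=> row_mx 1%:M 0); split=> [U|x _]; [exact: regmx_incB | rewrite mul1mx mulmx1]. Qed.
Lemma ok_incD : lm_ok degC (fun=> 1%:M) degD piD (fun x => row_mx 1%:M 0 *m piD x).
Proof. by exists (fun=> row_mx 1%:M 0); split=> [U|x _]; [exact: regmx_incD | rewrite mul1mx]. Qed.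

Definition P_AB := lm_hom ok_P_AB.
Definition P_BD := lm_hom ok_P_BD.
Definition P_DC := lm_hom ok_P_DC.
Definition Q_AB := lm_hom ok_Q_AB.
Definition Q_BD := lm_hom ok_Q_BD.
Definition prB := lm_hom ok_prB.
Definition prD := lm_hom ok_prD.
Definition incB := lm_hom ok_incB.
Definition incD := lm_hom ok_incD.

Lemma pts_neq0 (U : opn k n) (x : pts U) : sval x != 0.
Proof. exact: opn_neq0 (svalP x). Qed.

Lemma P_exactB : sexact P_AB P_BD.
Proof.
apply: (lm_exact (R := LT) (Y := fun=> 1%:M) _ lsplit_LT) => [U|x _|U t|U t t0 x w].
- exact: regmx1.
- by rewrite !mul1mx mulmx1.
- apply: lm_eq => x; rewrite !lm_homE -mulmxA [LT _ *m _]mulmxA -AD_factor.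
  by rewrite AD_piD mulmx0.
rewrite mulmx1 => ew; have := congr1 (fun v => at_ v x) t0.
rewrite lm_homE ew -[RHS]/0 mulmxA => /piD_eq0[v].
rewrite -[w]hsubmxK mul_row_block !mulmx0 mulmx1 addr0 add0r => /eq_row_mx[e1 e2].
(* [v] already gives the second block of [w]. The first block is off by an element of ker M, which
   is u L for some u in ker T; adding [u] corrects it and leaves the second block alone. *)
have [|u uT uL] := TL (pts_neq0 x) (v := lsubmx w - v *m L (sval x)).
  by rewrite mulmxBl e1 subrr.
apply/submxP; exists (u + v); rewrite mul_mx_row !mulmxDl uL subrK uT add0r.
by rewrite -e2 hsubmxK.
Qed.

Lemma P_exactD : sexact P_BD P_DC.
Proof.
apply: (lm_exact (R := N) (Y := fun=> 1%:M) _ lsplit_N) => [U|x _|U t|U t t0 x w ew].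
- exact: regmx1.
- by rewrite !mul1mx.
- apply: lm_eq => x; rewrite !lm_homE -(mulmxA (at_ t x)) -(mulmxA (N _)) piD_ThC (mulmxA (N _)).
  by rewrite mul_block_col !mul0mx !mulmx0 !mulmx1 !addr0 mul_col_mx MT_piC mul0mx col_mx0 mulmx0.
have := congr1 (fun v => at_ v x) t0; rewrite lm_homE ew -[RHS]/0 -mulmxA piD_ThC mulmxA.
rewrite -[w]hsubmxK mul_row_col mulmx1 mulmx0 addr0 => /cokermxP/submxP[v e].
apply/submxP; exists (row_mx v (rsubmx w)).
by rewrite mul_row_block !mulmx0 mulmx1 addr0 add0r -e hsubmxK.
Qed.

(** Surjectivity is exactness in front of the zero sheaf, so [lm_exact] applies; a class of [w] in
    coker M lifts to that of (w, 0) in D. *)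
Lemma P_surjC : surjective P_DC.
Proof.
apply: (@sexact_surj _ _ _ _ (zs k n) _ (zeroh _ _)) => //.
apply: (lm_exact (R := fun=> 1%:M) (Y := fun=> row_mx 1%:M 0) _ (@lsplit1 _ _ _ degC))
  => [U|x _|//|U t _ x w _]; [exact: regmx_incD | | exact: submx1].
by rewrite -(mulmxA _ (piD x)) piD_ThC mulmxA mul_row_col mulmx1 mul0mx addr0.
Qed.

Lemma Q_exactB : sexact Q_AB Q_BD.
Proof.
apply: (lm_exact (R := T) (Y := fun=> 1%:M) _ lsplit_T) => [U|x _|U t|U t t0 x w].
- exact: regmx1.
- by rewrite !mul1mx mulmx1.
- by apply: lm_eq => x; rewrite !lm_homE -mulmxA T_piQ mulmx0.
rewrite mulmx1 => ew; apply/cokermxP; rewrite -ew.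
by have := congr1 (fun v => at_ v x) t0; rewrite lm_homE.
Qed.

Lemma Q_exactD : sexact Q_BD (zeroh _ (zs k n)).
Proof.
apply: (lm_exact (R := fun=> 1%:M) (Y := fun=> 1%:M) _ (@lsplit1 _ _ _ degBQ)) => //.
- by move=> U; exact: regmx1.
- by move=> x _; rewrite !mul1mx.
by move=> U t _ x w _; exact: submx1.
Qed.

Lemma prB_P_AB : eqhom (comph Q_AB (idh _)) (comph prB P_AB).
Proof.
move=> U t; apply: lm_eq => x; rewrite !lm_homE -mulmxA mul_row_col mulmx0 mulmx1 add0r.
by [].
Qed.

(** * The complexes P and Q and the morphism between them *)

Definition diffP := five_d (ker_incl P_AB) P_AB P_BD P_DC.
Definition diffQ := five_d (ker_incl Q_AB) Q_AB Q_BD (zeroh _ (zs k n)).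
Definition diffP_sq := five_dd (ker_incl_exact P_AB) P_exactB P_exactD.
Definition diffQ_sq := five_dd (ker_incl_exact Q_AB) Q_exactB Q_exactD.
Definition psi := five_map (kermap prB_P_AB) (idh (free degA)) prB prD (zeroh (LM degC piC) (zs k n)).

Lemma psiC m : eqhom (comph (psi m.+1) (diffP m)) (comph (diffQ m) (psi m)).
Proof.
case: m => [|[|[|[|m]]]] U t.
- by [].
- by rewrite -[LHS]/(comph prB P_AB U t) -prB_P_AB.
- change (prD U (P_BD U t) = Q_BD U (prB U t)); apply: lm_eq => x.
  rewrite !lm_homE -(mulmxA (at_ t x)) -(mulmxA (N _)) piD_ThQ (mulmxA (N _)).
  by rewrite mul_block_col !mul0mx !mulmx0 !mulmx1 !add0r mulmxA.
- by [].
by rewrite [LHS]zs_zero [RHS]zs_zero.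
Qed.

Definition cxP : complex k n := cx diffP_sq.
Definition cxQ : complex k n := cx diffQ_sq.
Definition phi : cmap cxP (cshift (ctwist cxQ (- 0)) 0) := cxf diffP_sq diffQ_sq psiC.

Lemma cxP_supported : supported (- width n) 0 cxP.
Proof. by apply: cx_supported; exact: five_zero. Qed.
Lemma cxQ_supported : supported (- width n) 0 cxQ.
Proof. by apply: cx_supported; exact: five_zero. Qed.
Lemma cxP_acyclic : acyclic cxP.
Proof.
apply: cx_acyclic; first exact: ker_incl_inj.
exact: five_exact (ker_incl_exact P_AB) P_exactB P_exactD P_surjC.
Qed.
Lemma cxQ_acyclic : acyclic cxQ.
Proof.
apply: cx_acyclic; first exact: ker_incl_inj.
apply: five_exact (ker_incl_exact Q_AB) Q_exactB Q_exactD _.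
by move=> U t x Ux; rewrite [t]zs_zero; exact: img_mem0.
Qed.

Lemma cxP_vbundle t : vbundle (cxP t).
Proof.
apply: cx_vbundle; apply: five_vbundle.
- apply: (ker_vbundle regmx_LT lsplit_LT) => U u; split=> [e x|e]; last exact: lm_eq.
  exact: (congr1 (fun v => at_ v x) e).
- exact: free_vbundle.
- exact: free_vbundle.
- by apply: (LM_vbundle regmx_AD lsplit_AD) => x _ w; exact: cokermxP.
by apply: (LM_vbundle regmx_MT lsplit_MT) => x _ w; exact: cokermxP.
Qed.

Lemma cxQ_vbundle t : vbundle (cxQ t).
Proof.
apply: cx_vbundle; apply: five_vbundle.
- apply: (ker_vbundle regmx_T lsplit_T) => U u; split=> [e x|e]; last exact: lm_eq.
  exact: (congr1 (fun v => at_ v x) e).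
- exact: free_vbundle.
- exact: free_vbundle.
- by apply: (LM_vbundle regmx_T lsplit_T) => x _ w; exact: cokermxP.
exact: free_vbundle.
Qed.

Lemma cxP_linear : linear_between (- 3) (- 2) cxP.
Proof.
move=> t ht; have [->|->] : t = - 3 \/ t = - 2 by lia.
  by exists p; apply: iso_sym; exists (free_of_sum _ _ _ _); exact: free_of_sum_iso.
by exists (a + q)%N; apply: iso_sym; exists (free_of_sum _ _ _ _); exact: free_of_sum_iso.
Qed.

Lemma cxQ_linear : linear_between (- 3) (- 2) cxQ.
Proof.
move=> t ht; have [->|->] : t = - 3 \/ t = - 2 by lia.
  by exists p; apply: iso_sym; exists (free_of_sum _ _ _ _); exact: free_of_sum_iso.
by exists q; apply: iso_sym; exists (free_of_sum _ _ _ _); exact: free_of_sum_iso.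
Qed.

Lemma phi_surjA : surjective (phi (- 3)).
Proof.
apply: (@cxf_at_surj _ _ _ _ psi _ _ (- 3 + 4)).
by apply: iso_surj; exists (idh _).
Qed.

Lemma prB_surj : surjective prB.
Proof.
apply: (@sexact_surj _ _ _ _ (zs k n) _ (zeroh _ _)) => //.
apply: (lm_exact (R := fun=> 1%:M) (Y := fun=> row_mx 0 1%:M) (c := degBQ)) => [U||x _|//|].
- apply: (@regmx_degrees _ _ _ _ degBQ _ (catd (fun=> - 2) degBQ)) => // [j|].
    by rewrite /catd; case: fintype.split.
  by apply: regmx_row; [exact: regmx0 | exact: regmx1].
- exact: lsplit1.
- by rewrite !mulmx1 mul_row_col mulmx1 mul0mx add0r.
by move=> U t _ x w _; exact: submx1.
Qed.

Lemma phi_surjB : surjective (phi (- 3 + 1)).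
Proof. exact: (@cxf_at_surj _ _ _ _ psi _ _ (- 3 + 1 + 4) _ _ prB_surj). Qed.

Lemma phi_kerB U (t : sec (free degB) U) : phi (- 3 + 1) U t = 0 <-> prB U t = 0.
Proof. exact: (@cxf_at0 _ _ _ _ psi _ _ (- 3 + 1 + 4)). Qed.

Lemma phi_kerD U (t : sec (LM degD piD) U) : phi (- 3 + 2) U t = 0 <-> prD U t = 0.
Proof. exact: (@cxf_at0 _ _ _ _ psi _ _ (- 3 + 2 + 4)). Qed.

Lemma incB_phi U t : phi (- 3 + 1) U (incB U t) = 0.
Proof.
apply/phi_kerB; apply: lm_eq => x; rewrite !lm_homE -mulmxA mul_row_col.
by rewrite mulmx0 mul0mx addr0 mulmx0.
Qed.

Lemma incD_phi U t : phi (- 3 + 2) U (incD U t) = 0.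
Proof.
apply/phi_kerD; apply: lm_eq => x.
rewrite !lm_homE -(mulmxA (at_ t x)) -(mulmxA _ (piD _)) piD_ThQ mulmxA mul_row_col.
by rewrite mulmx0 mul0mx addr0 mul0mx mulmx0.
Qed.

Definition sum_kerB := ker_lift incB_phi.
Definition sum_kerD := ker_lift incD_phi.

Lemma sum_kerB_iso : is_iso sum_kerB.
Proof.
apply: ker_lift_iso => [|U t t0]; last first.
  apply: lm_eq => x; have := congr1 (fun v => at_ v x) t0.
  rewrite lm_homE mul_mx_row mulmx1 mulmx0 -[RHS]/0 -row_mx0 => /eq_row_mx[e _]; exact: e.
apply: (lm_exact (R := fun=> row_mx 1%:M 0) (Y := fun=> 1%:M) _ lsplit_incB) => [U|x _|U t|U t t0 x w].
- exact: regmx1.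
- by rewrite !mul1mx mulmx1.
- exact: incB_phi.
rewrite mulmx1 => ew; have /phi_kerB t1 := t0.
have := congr1 (fun v => at_ v x) t1; rewrite lm_homE ew -[RHS]/0 -[w]hsubmxK mul_row_col.
rewrite mulmx0 mulmx1 add0r => ->; apply/submxP; exists (lsubmx w).
by rewrite mul_mx_row mulmx1 mulmx0.
Qed.

Lemma sum_kerD_iso : is_iso sum_kerD.
Proof.
apply: ker_lift_iso => [|U t t0]; last first.
  apply: lm_eq => x; have := congr1 (fun v => at_ v x) t0.
  rewrite lm_homE -[RHS]/0 mulmxA => /piD_eq0[v]; rewrite mul_mx_row mulmx1 mulmx0.
  (* If (u, 0) dies in D, it is v (LM, T) for some v; then v is in ker T, where LM vanishes, so u =
     0. *)
  move=> /eq_row_mx[e /esym e0]; rewrite e; apply: TLM => //; exact: pts_neq0.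
apply: (lm_exact (R := R) (Y := fun=> col_mx 1%:M 0) _ lsplit_R) => [U|x _|U t|U t t0 x w ew].
- by apply: regmx_col; [exact: regmx1 | exact: regmx0].
- by rewrite mulmx1 /R !mul_col_mx AD_piD mul1mx mul0mx.
- exact: incD_phi.
have /phi_kerD t1 := t0.
have := congr1 (fun v => at_ v x) t1.
rewrite lm_homE ew -[RHS]/0 -(mulmxA w) piD_ThQ mulmxA -[w]hsubmxK mul_row_col.
rewrite mulmx0 mulmx1 add0r => /cokermxP/submxP[v ev].
apply/submxP; exists (row_mx (lsubmx w - v *m (L (sval x) *m MT (sval x))) v).
rewrite /R mul_row_col !mul_mx_row mulmx1 mulmx0 add_row_mx subrK add0r.
by rewrite -ev hsubmxK.
Qed.

(** * Identification of the map of kernels with M *)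

Variables (M : 'M[{mpoly k[n.+1]}]_(b, a)) (hM : linear_mx M).
Hypothesis ME : forall x i j, MT x i j = meval (x ord0) (M j i).

(** The twist [- - 3 - 1] is 2, that is [- i - 1] for [i = -3]; it undoes the global twist of the
    complexes by -2. *)
Definition alpha : shom (fsum (OO k n 0) a) (twist (ker (phi (- 3 + 1))) (- - 3 - 1)) :=
  comph (twist_hom (comph sum_kerB (free_of_sum k n (- 2) a)) (- - 3 - 1))
    (tau k n (erefl : 0 - (- - 3 - 1) = - 2 :> int) a).
Definition beta_inv : shom (fsum (OO k n 1) b) (twist (ker (phi (- 3 + 2))) (- - 3 - 1)) :=
  comph (twist_hom (comph sum_kerD (free_of_sum k n (- 1) b)) (- - 3 - 1))
    (tau k n (erefl : 1 - (- - 3 - 1) = - 1 :> int) b).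

Lemma alpha_iso : is_iso alpha.
Proof.
apply: comph_iso; first exact: tau_iso.
by apply: twist_hom_iso; apply: comph_iso; [exact: free_of_sum_iso | exact: sum_kerB_iso].
Qed.

Lemma beta_inv_iso : is_iso beta_inv.
Proof.
apply: comph_iso; first exact: tau_iso.
by apply: twist_hom_iso; apply: comph_iso; [exact: free_of_sum_iso | exact: sum_kerD_iso].
Qed.

(** The middle differential of P is block diagonal before passing to D, so it sends (y, 0) to the
    class of (y M, 0), on every chart. *)
Lemma kermap_alpha :
  eqhom (comph (twist_hom (kermap (cm_comm phi (- 3 + 1) (- 3 + 2))) (- - 3 - 1)) alpha)
        (comph beta_inv (mx_hom hM)).
Proof.
move=> U t; apply: tw_eq => l; apply: ss_eq.
have dE : diff cxP (- 3 + 1) (- 3 + 2) = P_BD := zd_succ diffP 2.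
transitivity (P_BD _ (incB _ (free_of_sum k n (- 2) a _ ((tau k n (erefl : 0 - (- - 3 - 1) = - 2 :> int) a U t : tw_type _ _ _) l)))).
  by rewrite -dE.
set y := free_of_sum k n (- 2) a _ _.
transitivity (incD _ (free_of_sum k n (- 1) b _
  ((tau k n (erefl : 1 - (- - 3 - 1) = - 1 :> int) b U (mx_hom hM U t) : tw_type _ _ _) l))); last by [].
set z := free_of_sum k n (- 1) b _ _.
apply: lm_eq => x; rewrite !lm_homE.
(* Source and target are both trivialized on chart [l] by the scalar x_l^(-2), which commutes with
   the matrix. *)
have -> : at_ z x = at_ y x *m MT (sval x).
  rewrite !free_of_sumE; apply/rowP => i; rewrite !mxE tauE ffunE.
  rewrite (big_morph (fun f : hreg 1 U => f (pres (@capl _ _ U (chart k l)) x)) (id1 := 0) (op1 := +%R)) //.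
  rewrite mulr_suml; apply: eq_bigr => j _; rewrite !mxE tauE ME /= mulrAC; congr (_ * _).
have -> : N (sval x) = block_mx (MT (sval x)) 0 0 1%:M by [].
rewrite (mulmxA _ (block_mx _ _ _ _)) -(mulmxA _ (row_mx _ _)) mul_row_block.
rewrite !mul0mx !mul1mx !addr0 (mulmxA _ (row_mx _ _)).
by rewrite -(mulmxA _ (MT _)) mul_mx_row mulmx1 mulmx0.
Qed.

Lemma construction :
  exists (P Q : complex k n) (j : int) (phi : cmap P (cshift (ctwist Q (- j)) j))
         (rP sP rQ sQ i : int),
    [/\ [/\ supported (- width n) 0 P, supported (- width n) 0 Q,
            (forall t, vbundle (P t)) /\ (forall t, vbundle (Q t)),
            acyclic P & acyclic Q],
        linear_between rP sP P /\ linear_between rQ sQ Q,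
        (rP <= i < sP) /\ (rQ <= i + j < sQ),
        surjective (phi i) /\ surjective (phi (i + 1)) &
        exists (alpha : shom (fsum (OO k n 0) a) (twist (ker (phi (i + 1))) (- i - 1)))
               (beta : shom (twist (ker (phi (i + 2))) (- i - 1)) (fsum (OO k n 1) b)),
          [/\ is_iso alpha, is_iso beta &
              eqhom (comph beta
                       (comph (twist_hom (kermap (cm_comm phi (i + 1) (i + 2))) (- i - 1))
                              alpha))
                    (mx_hom hM)]].
Proof.
(* With [i = -3], degree i is O(-1)^p up to the twist, where the morphism is the identity; degrees i
   + 1 and i + 2 are the terms O^a + O^q and D whose kernels are compared. *)
exists cxP, cxQ, 0, phi, (- 3), (- 2), (- 3), (- 2), (- 3).
split.
- split; [exact: cxP_supported | exact: cxQ_supported | | exact: cxP_acyclic | exact: cxQ_acyclic].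
  by split; [exact: cxP_vbundle | exact: cxQ_vbundle].
- by split; [exact: cxP_linear | exact: cxQ_linear].
- by [].
- by split; [exact: phi_surjA | exact: phi_surjB].
have [beta [betaK beta_invK]] := beta_inv_iso.
exists alpha, beta; split; [exact: alpha_iso | by exists beta_inv | move=> U t].
have h := kermap_alpha t; rewrite -[LHS]/(beta U (comph _ alpha U t)) h.
exact: betaK.
Qed.

End Construction.

Theorem theorem3p5 (k : closedFieldType) (k_char0 : [pchar k] =i pred0)
    (n a b r : nat) (M : 'M[{mpoly k[n.+1]}]_(b, a)) (M_linear : linear_mx M)
    (M_rank : constant_rank M r) (M_indec : indecomposable (img (mx_hom M_linear)))
    (C : sheaf k n) (c : shom (fsum (OO k n 1) b) C)
    (C_coker : is_cokernel (mx_hom M_linear) c)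
    (C_lin : L_linear 1%N (twist C (- 1))) :
  exists (P Q : complex k n) (j : int) (phi : cmap P (cshift (ctwist Q (- j)) j))
         (rP sP rQ sQ i : int),
    [/\ [/\ supported (- width n) 0 P, supported (- width n) 0 Q,
            (forall t, vbundle (P t)) /\ (forall t, vbundle (Q t)),
            acyclic P & acyclic Q],
        linear_between rP sP P /\ linear_between rQ sQ Q,
        (rP <= i < sP) /\ (rQ <= i + j < sQ),
        surjective (phi i) /\ surjective (phi (i + 1)) &
        exists (alpha : shom (fsum (OO k n 0) a) (twist (ker (phi (i + 1))) (- i - 1)))
               (beta : shom (twist (ker (phi (i + 2))) (- i - 1)) (fsum (OO k n 1) b)),
          [/\ is_iso alpha, is_iso beta &
              eqhom (comph beta
                       (comph (twist_hom (kermap (cm_comm phi (i + 1) (i + 2))) (- i - 1))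
                              alpha))
                    (mx_hom M_linear)]].
Proof.
pose MT (x : 'rV[k]_n.+1) := (map_mx (meval (x ord0)) M)^T.
have ME x i j : MT x i j = meval (x ord0) (M j i) by rewrite !mxE.
have dM i j : homog_fun 1 (fun x => MT x i j).
  by apply: homog_fun_ext (homog_fun_linear (M_linear j i)) => x; rewrite ME.
have rkM x : x != 0 -> \rank (MT x) = r by move=> x0; rewrite mxrank_tr M_rank.
have [N [V [dV kV]]] := kernel_generators dM rkM.
(* The generators have degree [(r + r).+1], so the words used here have length 2r. *)
have [p [q [s [T [L [rT rL rkT TV VT]]]]]] := linear_cover dV.
apply: (construction (T := T) (L := L) (r := r) (s := s) _ rT rL rkM rkT _ _ M_linear ME).
- by move=> U i j; exact: reg_homog_fun (dM i j).
- by move=> x x0 u uT; apply/kV => //; exact: TV.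
by move=> x x0 v vM; apply: VT => //; apply/kV.
Qed.
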